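(* Let $m_0\in L^\infty(\mathbb{R}^3;\mathbb{R}^3)$ with $|m_0|=1$ almost everywhere and $\nabla m_0\in L^2(\mathbb{R}^3;\mathbb{R}^9)$, and let $E_0,H_0\in L^2(\mathbb{R}^3;\mathbb{R}^3)$ with $\operatorname{div}E_0=\operatorname{div}(H_0+m_0)=0$. Assume moreover that $m_0,E_0,H_0$ are smooth. Assume that (1) $(m_2,E_2,H_2):(0,\infty)\times\mathbb{R}^3\to\mathbb{R}^9$ is a global finite-energy weak solution (in the sense of the context, including the energy inequality) of the Maxwell-Landau-Lifshitz equations with initial value $(m_0,E_0,H_0)$; (2) $(m_1,E_1,H_1)$ is a smooth solution of the Maxwell-Landau-Lifshitz equations up to some time $T>0$, with the same initial value $(m_0,E_0,H_0)$. Then $(m_2,E_2,H_2)=(m_1,E_1,H_1)$ on $(0,T)\times\mathbb{R}^3$.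
   Context: $\times$ between vectors of $\mathbb{R}^3$ is the cross product. The Maxwell-Landau-Lifshitz (MLL) equations for $(m,E,H)$ with values in $\mathbb{R}^3\times\mathbb{R}^3\times\mathbb{R}^3$ are $$\partial_t m+m\times\partial_t m=2\sum_{i=1}^3\partial_i(m\times\partial_i m)+2\,m\times H,$$ $$\partial_t H+\operatorname{curl}E=-\partial_t m,\qquad \partial_t E-\operatorname{curl}H=0,\qquad \operatorname{div}E=\operatorname{div}(H+m)=0.$$ A global finite-energy weak solution with initial value $(m_0,E_0,H_0)$ is a triple $(m,E,H)$ on $(0,\infty)\times\mathbb{R}^3$ such that, for all $T>0$, $m\in L^\infty((0,T)\times\mathbb{R}^3;\mathbb{R}^3)$, $|m|=1$ a.e., $\nabla m\in L^\infty((0,T);L^2(\mathbb{R}^3;\mathbb{R}^9))$, $\partial_t m\in L^2((0,T)\times\mathbb{R}^3;\mathbb{R}^3)$, $(E,H)\in L^\infty((0,T);L^2(\mathbb{R}^3;\mathbb{R}^6))$, the MLL equations hold in the sense of distributions on $(0,\infty)\times\mathbb{R}^3$, the initial value is attained (for $m$ in the trace sense, for $E,H$ in the sense of the weak formulation of the equations with initial data), and the following energy inequality holds: for almost every $T>0$, $$\mathcal{E}(T)+\int_0^T\int_{\mathbb{R}^3}|\partial_t m|^2\,dx\,dt\le\mathcal{E}(0),$$ where $\mathcal{E}(t)=\int_{\mathbb{R}^3}(|E|^2+|H|^2+|\nabla m|^2)(t,x)\,dx$ and $\mathcal{E}(0)=\int_{\mathbb{R}^3}(|E_0|^2+|H_0|^2+|\nabla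 m_0|^2)\,dx$. No attempt is made to minimize the smoothness: ''smooth solution'' means a strong solution regular enough for the formal energy computations to be valid; in particular it satisfies the energy relation above with equality. *)

(* Defs.v *)
From HB Require Import structures.
From mathcomp Require Import all_boot all_order all_algebra.
From mathcomp Require Import all_classical all_reals all_analysis.

Set Implicit Arguments.
Unset Strict Implicit.
Unset Printing Implicit Defensive.

Import Order.TTheory GRing.Theory Num.Theory.
Import numFieldNormedType.Exports.

Local Open Scope classical_set_scope.
Local Open Scope ring_scope.

(* Points of the physical space and of space-time are tuples of reals, which
   carry both a product sigma-algebra and a normed space structure; values of
   the fields are row vectors. *)
Notation space3 R := (R * R * R)%type.
Notation spacetime R := (R * (R * R * R))%type.
Notation vec R := 'rV[R]_3.

(* The same types seen as products of the measurable space on which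
   lebesgue_measure lives. *)
Notation mspace R :=
  (measurableTypeR R * measurableTypeR R * measurableTypeR R)%type.
Notation mspacetime R := (measurableTypeR R * mspace R)%type.

(* For m1 \x m2 the library's canonical sigma-finite structure is only found
   when m1 and m2 are subprobabilities. *)
Section SigmaFiniteProduct.
Context {R : realType} d1 d2 (T1 : measurableType d1) (T2 : measurableType d2).
Variable m1 : {sigma_finite_measure set T1 -> \bar R}.
Variable m2 : {sigma_finite_measure set T2 -> \bar R}.

Definition sfprod : set (T1 * T2) -> \bar R := (m1 \x m2)%E.

HB.instance Definition _ := Measure.on sfprod.

Lemma sfprod_sigma_finite : sigma_finite setT sfprod.
Proof.
have /sigma_finiteP[F [TF ndF Foo]] := sigma_finiteT m1.
have /sigma_finiteP[G [TG ndG Goo]] := sigma_finiteT m2.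
exists (fun n => F n `*` G n).
  rewrite -setXTT TF TG predeqE => -[x y]; split.
    move=> [/= [n _ Fnx] [k _ Gky]]; exists (maxn n k) => //; split.
    - by move: x Fnx; exact/subsetPset/ndF/leq_maxl.
    - by move: y Gky; exact/subsetPset/ndG/leq_maxr.
  by move=> [n _ []/= ? ?]; split; exists n.
move=> k; have [? ?] := Foo k; have [? ?] := Goo k.
split; first exact: measurableX.
by rewrite /sfprod product_measure1E// lte_mul_pinfty// ge0_fin_numE.
Qed.

HB.instance Definition _ :=
  @Measure_isSigmaFinite.Build _ _ _ sfprod sfprod_sigma_finite.

End SigmaFiniteProduct.

Section Geometry.
Context {R : realType}.

Definition leb3 : {sigma_finite_measure set (mspace R) -> \bar R} :=
  sfprod (sfprod (@lebesgue_measure R) (@lebesgue_measure R))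
         (@lebesgue_measure R).

Definition leb4 : {sigma_finite_measure set (mspacetime R) -> \bar R} :=
  sfprod (@lebesgue_measure R) leb3.

Definition slab (T : R) : set (spacetime R) := `]0, T[ `*` setT.
Definition halfspace : set (spacetime R) := `]0, +oo[ `*` setT.

Definition ex (i : 'I_3) : space3 R :=
  ((i == 0 :> nat)%:R, (i == 1 :> nat)%:R, (i == 2 :> nat)%:R).
Definition dirx (i : 'I_3) : spacetime R := (0, ex i).
Definition dirt : spacetime R := (1, 0).

Definition dot (u v : vec R) : R := \sum_(k < 3) u 0 k * v 0 k.

(* The library norm on row vectors is the max norm; this is the square of the
   Euclidean one. *)
Definition sqnorm (u : vec R) : R := dot u u.

(* Indices are added modulo 3 in 'I_3. *)
Definition cross (u v : vec R) : vec R :=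
  \row_(k < 3) (u 0 (k + 1) * v 0 (k + 2%:R) - u 0 (k + 2%:R) * v 0 (k + 1)).

End Geometry.

Section Smooth.
Context {R : realType} {V W : normedModType R}.

Definition iter_deriv (vs : seq V) (f : V -> W) : V -> W :=
  foldr (fun v g x => 'D_v g x) f vs.

(* C^oo on an open set A of a finite-dimensional V: differentiability of each
   iterated derivative entails its continuity. *)
Definition smooth (A : set V) (f : V -> W) : Prop :=
  forall (vs : seq V) (x : V), A x -> differentiable (iter_deriv vs f) x.

End Smooth.

Section ClassicalOperators.
Context {R : realType} {V : normedModType R}.
Variable e : 'I_3 -> V.

Definition grad (f : V -> R) (p : V) : vec R := \row_(i < 3) 'D_(e i) f p.

Definition div (F : V -> vec R) (p : V) : R :=
  \sum_(i < 3) ('D_(e i) F p) 0 i.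

Definition curl (F : V -> vec R) (p : V) : vec R :=
  \row_(k < 3) (('D_(e (k + 1)) F p) 0 (k + 2%:R)
              - ('D_(e (k + 2%:R)) F p) 0 (k + 1)).

End ClassicalOperators.

Section FunctionSpaces.
Context {R : realType}.

Definition L2_space (f : space3 R -> vec R) : Prop :=
  forall k, (fun x => f x 0 k) \in Lfun leb3 2%:E.

Definition Linfty_space (f : space3 R -> vec R) : Prop :=
  forall k, (fun x => f x 0 k) \in Lfun leb3 +oo%E.

Definition L2_slab (T : R) (f : spacetime R -> vec R) : Prop :=
  forall k, (fun p => f p 0 k) \_ (slab T) \in Lfun leb4 2%:E.

Definition Linfty_slab (T : R) (f : spacetime R -> vec R) : Prop :=
  forall k, (fun p => f p 0 k) \_ (slab T) \in Lfun leb4 +oo%E.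

Definition LinftyL2 (T : R) (f : spacetime R -> vec R) : Prop :=
  (forall k, measurable_fun (slab T : set (mspacetime R)) (fun p => f p 0 k)) /\
  exists C : R, {ae lebesgue_measure, forall t : R, 0 < t < T ->
    (\int[leb3]_x (sqnorm (f (t, x)))%:E <= C%:E)%E}.

Definition test_fun (D : set (spacetime R)) (phi : spacetime R -> R) : Prop :=
  smooth setT phi /\
  exists K : set (spacetime R),
    [/\ compact K, K `<=` D & forall p, ~ K p -> phi p = 0].

Definition weak_deriv (v : spacetime R) (f g : spacetime R -> vec R) : Prop :=
  forall (phi : spacetime R -> R) (k : 'I_3), test_fun halfspace phi ->
    \int[leb4]_(p in halfspace) (f p 0 k * 'D_v phi p) =
    - (\int[leb4]_(p in halfspace) (g p 0 k * phi p)).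

(* f0 is the trace at t = 0 of f, whose weak time derivative is ft: Green's
   formula against test functions that need not vanish at t = 0. *)
Definition trace0 (f ft : spacetime R -> vec R) (f0 : space3 R -> vec R)
    : Prop :=
  forall (phi : spacetime R -> R) (k : 'I_3), test_fun setT phi ->
    \int[leb4]_(p in halfspace) (f p 0 k * 'D_dirt phi p) =
    - (\int[leb4]_(p in halfspace) (ft p 0 k * phi p))
    - (\int[leb3]_x (f0 x 0 k * phi (0, x))).

End FunctionSpaces.

Section MaxwellLandauLifshitz.
Context {R : realType}.

Definition energy (E H : space3 R -> vec R) (Dm : 'I_3 -> space3 R -> vec R)
    : \bar R :=
  (\int[leb3]_x
     (sqnorm (E x) + sqnorm (H x) + \sum_(i < 3) sqnorm (Dm i x))%:E)%E.

Definition energy_at (E H : spacetime R -> vec R)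
    (Dm : 'I_3 -> spacetime R -> vec R) (t : R) : \bar R :=
  energy (fun x => E (t, x)) (fun x => H (t, x)) (fun i x => Dm i (t, x)).

Definition initial_energy (m0 E0 H0 : space3 R -> vec R) : \bar R :=
  energy E0 H0 (fun i x => 'D_(ex i) m0 x).

Definition dissipation (mt : spacetime R -> vec R) (T : R) : \bar R :=
  (\int[leb4]_(p in slab T) (sqnorm (mt p))%:E)%E.

Record admissible_data (m0 E0 H0 : space3 R -> vec R) : Prop := {
  data_m_bounded : Linfty_space m0;
  data_m_unit : {ae leb3, forall x, sqnorm (m0 x) = 1};
  data_gradm_L2 : forall i, L2_space (fun x => 'D_(ex i) m0 x);
  data_E_L2 : L2_space E0;
  data_H_L2 : L2_space H0;
  data_divE : forall x, div ex E0 x = 0;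
  data_divHm : forall x, div ex (fun y => H0 y + m0 y) x = 0;
  data_m_smooth : smooth setT m0;
  data_E_smooth : smooth setT E0;
  data_H_smooth : smooth setT H0
}.

(* Dm and mt are the weak space gradient and time derivative of m.  Against a
   scalar test function phi, the distribution curl F is
   - \int grad phi x F and div F is - \int grad phi . F.  The equations for E
   and H are the weak formulations with initial data; those on
   ]0, +oo[ x R^3 are the case of phi supported in t > 0. *)
Record weak_solution_with (m E H : spacetime R -> vec R)
    (Dm : 'I_3 -> spacetime R -> vec R) (mt : spacetime R -> vec R)
    (m0 E0 H0 : space3 R -> vec R) : Prop := {
  weak_gradm : forall i, weak_deriv (dirx i) m (Dm i);
  weak_dtm : weak_deriv dirt m mt;
  weak_m_Linfty : forall T : R, 0 < T -> Linfty_slab T m;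
  weak_m_unit : {ae leb4, forall p, halfspace p -> sqnorm (m p) = 1};
  weak_gradm_LinftyL2 : forall T : R, 0 < T -> forall i, LinftyL2 T (Dm i);
  weak_dtm_L2 : forall T : R, 0 < T -> L2_slab T mt;
  weak_E_LinftyL2 : forall T : R, 0 < T -> LinftyL2 T E;
  weak_H_LinftyL2 : forall T : R, 0 < T -> LinftyL2 T H;
  weak_landau_lifshitz : forall (phi : spacetime R -> R) (k : 'I_3),
    test_fun halfspace phi ->
    \int[leb4]_(p in halfspace) ((mt p + cross (m p) (mt p)) 0 k * phi p) =
    - 2 * (\sum_(i < 3) \int[leb4]_(p in halfspace)
             ((cross (m p) (Dm i p)) 0 k * 'D_(dirx i) phi p))
    + 2 * (\int[leb4]_(p in halfspace) ((cross (m p) (H p)) 0 k * phi p));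
  weak_faraday : forall (phi : spacetime R -> R) (k : 'I_3),
    test_fun setT phi ->
    - (\int[leb4]_(p in halfspace) (H p 0 k * 'D_dirt phi p))
    - (\int[leb3]_x (H0 x 0 k * phi (0, x)))
    - (\int[leb4]_(p in halfspace) ((cross (grad dirx phi p) (E p)) 0 k)) =
    - (\int[leb4]_(p in halfspace) (mt p 0 k * phi p));
  weak_ampere : forall (phi : spacetime R -> R) (k : 'I_3),
    test_fun setT phi ->
    - (\int[leb4]_(p in halfspace) (E p 0 k * 'D_dirt phi p))
    - (\int[leb3]_x (E0 x 0 k * phi (0, x)))
    + (\int[leb4]_(p in halfspace) ((cross (grad dirx phi p) (H p)) 0 k)) = 0;
  weak_divE : forall phi : spacetime R -> R, test_fun halfspace phi ->
    \int[leb4]_(p in halfspace) (dot (grad dirx phi p) (E p)) = 0;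
  weak_divHm : forall phi : spacetime R -> R, test_fun halfspace phi ->
    \int[leb4]_(p in halfspace) (dot (grad dirx phi p) (H p + m p)) = 0;
  weak_m_initial : trace0 m mt m0;
  weak_energy : {ae lebesgue_measure, forall T : R, 0 < T ->
    (energy_at E H Dm T + dissipation mt T <= initial_energy m0 E0 H0)%E}
}.

Definition weak_solution (m E H : spacetime R -> vec R)
    (m0 E0 H0 : space3 R -> vec R) : Prop :=
  exists Dm mt, weak_solution_with m E H Dm mt m0 E0 H0.

Definition bounded_derivatives (T : R) (f : spacetime R -> vec R) : Prop :=
  forall (vs : seq (spacetime R)), exists C : R,
    forall p, slab T p -> `|iter_deriv vs f p| <= C.

(* Derivatives are bounded on each ]0, T'[ x R^3 with T' < T, so that nothing
   is required as t tends to T. *)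
Record smooth_solution (T : R) (m E H : spacetime R -> vec R)
    (m0 E0 H0 : space3 R -> vec R) : Prop := {
  strong_m_smooth : smooth (slab T) m;
  strong_E_smooth : smooth (slab T) E;
  strong_H_smooth : smooth (slab T) H;
  strong_bounded : forall T' : R, 0 < T' < T ->
    [/\ bounded_derivatives T' m, bounded_derivatives T' E
      & bounded_derivatives T' H];
  strong_m_unit : forall p, slab T p -> sqnorm (m p) = 1;
  strong_landau_lifshitz : forall p, slab T p ->
    'D_dirt m p + cross (m p) ('D_dirt m p) =
    2 *: (\sum_(i < 3) 'D_(dirx i) (fun q => cross (m q) ('D_(dirx i) m q)) p)
    + 2 *: cross (m p) (H p);
  strong_faraday : forall p, slab T p ->
    'D_dirt H p + curl dirx E p = - 'D_dirt m p;
  strong_ampere : forall p, slab T p -> 'D_dirt E p - curl dirx H p = 0;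
  strong_divE : forall p, slab T p -> div dirx E p = 0;
  strong_divHm : forall p, slab T p -> div dirx (fun q => H q + m q) p = 0;
  strong_m_initial : forall x, m (t, x) @[t --> 0^'+] --> m0 x;
  strong_E_initial : forall x, E (t, x) @[t --> 0^'+] --> E0 x;
  strong_H_initial : forall x, H (t, x) @[t --> 0^'+] --> H0 x;
  strong_energy : forall t : R, 0 < t < T ->
    (energy_at E H (fun i p => 'D_(dirx i) m p) t
       + dissipation (fun p => 'D_dirt m p) t = initial_energy m0 E0 H0)%E
}.

End MaxwellLandauLifshitz.

(* Main.v *)
Require Import Defs.
From mathcomp Require Import all_boot all_order all_algebra.
From mathcomp Require Import all_classical all_reals all_analysis.
From mathcomp Require Import measurable_realfun ring lra.

(** Weak-strong uniqueness by the relative energy method. Write w for the weak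
    and u for the strong magnetization, and put e = |E|^2 + |H|^2 + |grad m|^2.
    The aim is a Gronwall estimate for the energy e of the difference of the two
    solutions, plus |w - u|^2. Nothing can be differentiated on the weak side, so
    this quantity is obtained by expanding squares: the energies of both solutions
    are controlled by their energy inequalities, and the scalar products of the
    two solutions are computed by testing the weak equations with fields built
    from the strong solution.

    The magnetic part is the delicate one. With p = D_t u - 2 (Lap u + H1) the
    strong equation says that D_t u = p x u. The weak Landau-Lifshitz equation is
    tested with p, and the relations defining the weak gradient and time
    derivative of w are tested with the gradient of u and with p x D_i u. All
    terms linear in the difference then cancel, and the remaining error is twice -
    d_t . (p x d) / 2 + G . (p x d) - sum_i d_i . (D_i p x d), where d = w - u, G
    is the difference of the fields H, and d_t, d_i are the differences of the
    derivatives. It is quadratic in the difference, and the term with d_t is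
    absorbed by the dissipation. Since |w| = |u| = 1, the quantity |d|^2 equals 2
    - 2 w . u and is handled in the same way, with the tests u and D_i u x u. This
    algebra is [tested_totalE] and [relative_energy_le].

    All tests carry the weight theta_n = eta(t) xi_n(x)^2. The function eta
    vanishes for t >= T1, where T1 < T, and decays at a rate lam, which replaces
    Gronwall's lemma: for lam large, - eta' dominates all quadratic errors. The
    energy inequality holds at almost every time only; integrated against - eta'
    it becomes [weighted_energy]. The cutoffs xi_n, equal to exp(1 - 1/(1 -
    |x|^2/N^2)) in the ball of radius N = n + 1, have gradients of size 1/N, so
    the cutoff errors vanish as n --> oo. What remains is the initial energy minus
    the weighted initial energy, which tends to 0 ([initial_testP],
    [weighted_gap_zero]).

    The fields used as tests are smooth with bounded derivatives for 0 < t < T1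
    but do not extend to t <= 0 as test functions. Shifting them in time and
    switching them off smoothly gives test functions on the whole space-time; the
    limit of vanishing shift is [weak_form_tested]. Smoothness of these products,
    of exp(-1/s) and of compositions comes from [alg_smooth]. *)

Set Implicit Arguments.
Unset Strict Implicit.
Unset Printing Implicit Defensive.

Import Order.TTheory GRing.Theory Num.Theory.
Import numFieldNormedType.Exports.

Local Open Scope classical_set_scope.
Local Open Scope ring_scope.


(** * Smooth functions, via algebras closed under differentiation *)

Section NearEq.
Context {R : realType} {V W : normedModType R}.

Lemma near_eq_differentiable (f g : V -> W) (x : V) :
  (\near x, f x = g x) -> differentiable f x -> differentiable g x.
Proof.
move=> fg df.
have gdf : g \o shift x = cst (g x) + 'd f x +o_ (0 : V) id.
  apply/eqaddoP => e e0; move: (diff_locally df) => /eqaddoP/(_ _ e0).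
  have fgx : \forall h \near (0 : V), f (h + x) = g (h + x).
    by move: fg; rewrite (near_shift 0 x) subr0.
  apply: filterS2 fgx => h /= fgh.
  by rewrite /= !fctE /= fgh (nbhs_singleton fg).
have dE : 'd g x = 'd f x :> (V -> W).
  by apply: diff_unique => //; exact: diff_continuous.
apply/diff_locallyP; rewrite dE; split => //; exact: diff_continuous.
Qed.

Lemma open_near_eq (A : set V) (f g : V -> W) (x : V) :
  open A -> {in A, f =1 g} -> A x -> \near x, f x = g x.
Proof.
move=> oA fg Ax; near=> y; apply: fg; rewrite inE.
by near: y; exact: open_nbhs_nbhs.
Unshelve. all: by end_near. Qed.

Lemma iter_deriv_in (A : set V) (f g : V -> W) (vs : seq V) :
  open A -> {in A, f =1 g} -> {in A, iter_deriv vs f =1 iter_deriv vs g}.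
Proof.
move=> oA fg; elim: vs => [//|v vs ih] x Ax /=.
apply: near_eq_derive; apply: open_near_eq oA ih _; exact: set_mem.
Qed.

Lemma smooth_in (A : set V) (f g : V -> W) :
  open A -> {in A, f =1 g} -> smooth A f -> smooth A g.
Proof.
move=> oA fg sf vs x Ax; apply: near_eq_differentiable (sf vs x Ax).
exact: open_near_eq oA (iter_deriv_in _ oA fg) Ax.
Qed.

Lemma smooth_derive (A : set V) (f : V -> W) (v : V) :
  smooth A f -> smooth A ('D_v f).
Proof.
move=> sf vs x Ax; have := sf (rcons vs v) x Ax.
by rewrite /iter_deriv foldr_rcons.
Qed.

Lemma smooth_derivable (A : set V) (f : V -> W) (v x : V) :
  smooth A f -> A x -> derivable f x v.
Proof. by move=> sf Ax; apply: diff_derivable; exact: (sf [::]). Qed.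

End NearEq.

Section Algebra.
Context {R : realType} {V : normedModType R}.

(** If the directional derivatives of the members of B lie again in the
    algebra generated by B, then so do all iterated derivatives of its
    members: smoothness and boundedness of all derivatives then need to be
    checked on B only. *)
Inductive alg (B : set (V -> R)) : (V -> R) -> Prop :=
| alg_base b : B b -> alg B b
| alg_cst c : alg B (cst c)
| alg_add f g : alg B f -> alg B g -> alg B (f + g)
| alg_mul f g : alg B f -> alg B g -> alg B (f * g).

Variables (A : set V) (B : set (V -> R)).
Hypothesis oA : open A.
Hypothesis B_diff : forall b x, B b -> A x -> differentiable b x.
Hypothesis B_derive : forall b v, B b ->
  exists2 g, alg B g & {in A, 'D_v b =1 g}.

Lemma alg_diff f x : alg B f -> A x -> differentiable f x.
Proof.
move=> Bf Ax; elim: Bf => [b Bb|c|g h _ dg _ dh|g h _ dg _ dh].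
- exact: B_diff.
- exact: differentiable_cst.
- exact: differentiableD.
- exact: differentiableM.
Qed.

Lemma alg_derive f v : alg B f -> exists2 g, alg B g & {in A, 'D_v f =1 g}.
Proof.
elim=> [b Bb|c|g h Bg [g' Bg' gg'] Bh [h' Bh' hh']
  |g h Bg [g' Bg' gg'] Bh [h' Bh' hh']].
- exact: B_derive.
- by exists (cst 0); [exact: alg_cst|move=> x _; rewrite derive_cst].
- exists (g' + h'); first exact: alg_add.
  move=> x xA; have Ax := set_mem xA.
  by rewrite deriveD ?gg' ?hh'//; apply/diff_derivable/alg_diff.
- exists (g * h' + h * g'); first by apply: alg_add; exact: alg_mul.
  move=> x xA; have Ax := set_mem xA.
  by rewrite deriveM ?gg' ?hh'//; apply/diff_derivable/alg_diff.
Qed.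

Lemma alg_iter f vs : alg B f ->
  exists2 g, alg B g & {in A, iter_deriv vs f =1 g}.
Proof.
move=> Bf; elim: vs => [|v vs [g Bg fg]]; first by exists f.
have [g' Bg' gg'] := alg_derive v Bg; exists g' => // x xA /=.
rewrite -gg'//; apply: near_eq_derive.
by apply: open_near_eq oA fg _; exact: set_mem.
Qed.

Lemma alg_smooth f : alg B f -> smooth A f.
Proof.
move=> Bf vs x Ax; have [g Bg fg] := alg_iter vs Bf.
apply: near_eq_differentiable (alg_diff Bg Ax).
by apply: open_near_eq oA _ Ax => y yA; rewrite fg.
Qed.

Lemma alg_bounded (S : set V) f :
  (forall b, B b -> exists C : R, forall x, S x -> `|b x| <= C) ->
  alg B f -> exists C : R, forall x, S x -> `|f x| <= C.
Proof.
move=> Bb; elim=> [b /Bb//|c|g h _ [C1 h1] _ [C2 h2]|g h _ [C1 h1] _ [C2 h2]].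
- by exists `|c|.
- exists (C1 + C2) => x Sx; rewrite (le_trans (ler_normD _ _))// lerD//.
    exact: h1.
  exact: h2.
- exists (C1 * C2) => x Sx; rewrite [(g * h) x]/(g x * h x) normrM.
  by apply: ler_pM => //; [exact: h1|exact: h2].
Qed.

Lemma alg_iter_bounded (S : set V) f : S `<=` A ->
  (forall b, B b -> exists C : R, forall x, S x -> `|b x| <= C) ->
  alg B f ->
  forall vs, exists C : R, forall x, S x -> `|iter_deriv vs f x| <= C.
Proof.
move=> SA Bb Bf vs; have [g Bg fg] := alg_iter vs Bf.
have [C gC] := alg_bounded Bb Bg; exists C => x Sx.
by rewrite fg ?gC// inE; exact: SA.
Qed.

End Algebra.

Section SmoothClosure.
Context {R : realType} {V : normedModType R}.
Implicit Types (A : set V) (f g : V -> R).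

Definition jets (F : set (V -> R)) : set (V -> R) :=
  [set h | exists2 f, F f & exists vs, h = iter_deriv vs f].

Lemma jets_derive A (F : set (V -> R)) b v : jets F b ->
  exists2 g, alg (jets F) g & {in A, 'D_v b =1 g}.
Proof.
move=> [f Ff [vs ->]]; exists ('D_v (iter_deriv vs f)) => //.
by apply: alg_base; exists f => //; exists (v :: vs).
Qed.

Lemma jets_smooth A (F : set (V -> R)) : open A ->
  (forall f, F f -> smooth A f) -> forall f, alg (jets F) f -> smooth A f.
Proof.
move=> oA Fs f; apply: alg_smooth => //; last by move=> b v; exact: jets_derive.
by move=> b x [h /Fs sh [vs ->]] Ax; exact: sh.
Qed.

Lemma jets_self (F : set (V -> R)) f : F f -> alg (jets F) f.
Proof. by move=> Ff; apply: alg_base; exists f => //; exists [::]. Qed.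

Lemma smooth_cst A (c : R) : open A -> smooth A (cst c).
Proof. by move=> oA; apply: (@jets_smooth _ set0) => //; exact: alg_cst. Qed.

Lemma smoothD A f g : open A -> smooth A f -> smooth A g -> smooth A (f + g).
Proof.
move=> oA sf sg; apply: (@jets_smooth _ [set f; g]) => // [h [->|->]//|].
by apply: alg_add; apply: jets_self; [left|right].
Qed.

Lemma smoothM A f g : open A -> smooth A f -> smooth A g -> smooth A (f * g).
Proof.
move=> oA sf sg; apply: (@jets_smooth _ [set f; g]) => // [h [->|->]//|].
by apply: alg_mul; apply: jets_self; [left|right].
Qed.

(** The functions f^-1 and all derivatives of f generate an algebra closed
    under differentiation, because the derivative of f^-1 is - f^-1 * f^-1 * D
    f. *)
Lemma smoothV A f : open A -> smooth A f -> (forall x, A x -> f x != 0) ->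
  smooth A (fun x => (f x)^-1).
Proof.
move=> oA sf f0.
pose B := [set fun x => (f x)^-1] `|` jets [set f].
apply: (@alg_smooth _ _ _ B) => // [b x [->|[_ -> [vs ->]]] Ax|b v [->|Bb]|].
- by apply: differentiableV; [exact: (sf [::])|exact: f0].
- exact: sf.
- exists (cst (-1) * ((fun x => (f x)^-1) * (fun x => (f x)^-1)) * 'D_v f).
    apply: alg_mul; last first.
      by apply: alg_base; right; exists f => //; exists [:: v].
    by apply: alg_mul; [exact: alg_cst|apply: alg_mul; apply: alg_base; left].
  move=> x xA; have Ax := set_mem xA.
  rewrite deriveV; [|exact: f0|exact: smooth_derivable sf Ax].
  by rewrite !fctE /= /GRing.scale /= expr2 invfM mulN1r.
- have [g Bg gE] := jets_derive A v Bb; exists g => //.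
  elim: Bg => [h Bh|c|h k _ ? _ ?|h k _ ? _ ?].
  + by apply: alg_base; right.
  + exact: alg_cst.
  + exact: alg_add.
  + exact: alg_mul.
- by apply: alg_base; left.
Qed.

Lemma alg_sub (B B' : set (V -> R)) f : B `<=` B' -> alg B f -> alg B' f.
Proof.
move=> BB'; elim=> [h /BB' Bh|c|h k _ ? _ ?|h k _ ? _ ?].
- exact: alg_base.
- exact: alg_cst.
- exact: alg_add.
- exact: alg_mul.
Qed.

Lemma derive_comp1 (rho : R -> R) (q : V -> R) (v x : V) :
  differentiable q x -> differentiable rho (q x) ->
  'D_v (rho \o q) x = 'D_1 rho (q x) * 'D_v q x.
Proof.
move=> dq dr; rewrite deriveE; last exact: differentiable_comp.
rewrite diff_comp// -derive1E derive1E'// [in RHS]deriveE//=.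
by rewrite -[X in 'd rho _ X = _]mulr1 linearZ mulrC.
Qed.

(** The chain rule keeps the algebra generated by the D^k rho \o q and the
    derivatives of q closed under differentiation. *)
Lemma smooth_comp A (rho : R -> R) (q : V -> R) : open A ->
  smooth setT rho -> smooth A q -> smooth A (rho \o q).
Proof.
move=> oA sr sq.
pose B := [set h | exists vs, h = iter_deriv vs rho \o q] `|` jets [set q].
apply: (@alg_smooth _ _ _ B) => // [b x [[vs ->]|[_ -> [vs ->]]] Ax
  |b v [[vs ->]|Bb]|].
- by apply: differentiable_comp; [exact: (sq [::])|exact: sr].
- exact: sq.
- exists ((iter_deriv (1 :: vs) rho \o q) * 'D_v q).
    apply: alg_mul; apply: alg_base; first by left; exists (1 :: vs).
    by right; exists q => //; exists [:: v].
  move=> x xA; have Ax := set_mem xA.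
  by rewrite derive_comp1//; [exact: (sq [::])|exact: sr].
- have [g Bg gE] := jets_derive A v Bb; exists g => //.
  by apply: alg_sub Bg => h; right.
- by apply: alg_base; left; exists [::].
Qed.

End SmoothClosure.

Section Affine.
Context {R : realType} {V W : normedModType R}.

Lemma derive_shift_fun (f : V -> W) (c v x : V) :
  'D_v (fun y => f (y + c)) x = 'D_v f (x + c).
Proof.
rewrite /derive (_ : (fun h => _) =
  (fun h : R => h^-1 *: ((f \o shift (x + c)) (h *: v) - f (x + c))))//.
by apply/funext => h /=; rewrite addrA.
Qed.

Lemma iter_deriv_shift (f : V -> W) (c : V) vs :
  iter_deriv vs (fun y => f (y + c)) = (fun y => iter_deriv vs f (y + c)).
Proof.
elim: vs => // v vs ih; apply/funext => x.
by rewrite /= -/(iter_deriv _ _) ih derive_shift_fun.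
Qed.

Lemma smooth_shift (A : set V) (f : V -> W) (c : V) :
  smooth A f -> smooth [set x | A (x + c)] (fun y => f (y + c)).
Proof.
move=> sf vs x /= Ax; rewrite iter_deriv_shift.
have := @differentiable_comp _ _ _ _ (fun y : V => y + c) (iter_deriv vs f) x.
apply; last exact: sf.
apply: (@differentiableD _ _ _ id (cst c)) => //; exact: differentiable_cst.
Qed.

Lemma smooth_linear (f : {linear V -> W}) : continuous f -> smooth setT f.
Proof.
move=> cf.
have dfE v x : 'D_v f x = f v.
  by rewrite deriveE; [rewrite diff_lin|exact: linear_differentiable].
have H vs : iter_deriv vs f = f \/ exists c, iter_deriv vs f = cst c.
  elim: vs => [|v vs [E|[c E]]]; first by left.
    right; exists (f v); apply/funext => x /=.
    by rewrite -/(iter_deriv _ _) E dfE.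
  right; exists 0; apply/funext => x /=.
  by rewrite -/(iter_deriv _ _) E derive_cst.
move=> vs x _; have [->|[c ->]] := H vs; first exact: linear_differentiable.
exact: differentiable_cst.
Qed.

End Affine.

(** * The flat function exp(-1/s) *)

Section Bump.
Context {R : realType}.

(** The polynomial factor in 1/s makes this family closed under
    differentiation; exp(-1/s) alone is not. *)
Definition flat (P : {poly R}) (s : R) : R :=
  if 0 < s then P.[s^-1] * expR (- s^-1) else 0.

(** With y = 1/s, the bound y^n <= n^n exp(y) follows from y/n <= exp(y/n). *)
Lemma flat_bounded (P : {poly R}) : exists2 C : R, 0 <= C & forall s, `|flat P s| <= C.
Proof.
exists (\sum_(i < size P) `|P`_i| * i%:R ^+ i); first by apply: sumr_ge0 => i _; rewrite mulr_ge0// exprn_ge0.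
move=> s; rewrite /flat; case: ltrP => s0; last first.
  by rewrite normr0; apply: sumr_ge0 => i _; rewrite mulr_ge0// exprn_ge0.
rewrite horner_coef mulr_suml (le_trans (ler_norm_sum _ _ _))// ler_sum// => i _.
rewrite -mulrA normrM ler_wpM2l// ger0_norm ?mulr_ge0 ?expR_ge0//; last first.
  by rewrite exprn_ge0// invr_ge0 ltW.
have y0 : 0 < s^-1 by rewrite invr_gt0.
move: (s^-1) y0 => y y0; case: (nat_of_ord i) => [|n].
  by rewrite !expr0 mul1r -expR0 ler_expR oppr_le0 ltW.
rewrite expRN ler_pdivrMr ?expR_gt0//.
have -> : expR y = expR (y / n.+1%:R) ^+ n.+1.
  by rewrite -expRM_natl mulrC divfK.
have h : y <= n.+1%:R * expR (y / n.+1%:R).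
  rewrite mulrC -ler_pdivrMr ?ltr0n//.
  by rewrite (le_trans _ (expR_ge1Dx _))// lerDr.
rewrite -exprMn; apply: lerXn2r => //; rewrite nnegrE ?(ltW y0)//.
Qed.

(** This decay at the origin is what makes the derivative at 0 exist and
    vanish. *)
Lemma flat_le_sqr (P : {poly R}) :
  exists2 C : R, 0 <= C & forall s, `|flat P s| <= C * s ^+ 2.
Proof.
have [C C0 PC] := flat_bounded ('X^2 * P); exists C => // s.
have -> : flat P s = s ^+ 2 * flat ('X^2 * P) s.
  rewrite /flat; case: ltrP => s0; last by rewrite mulr0.
  by rewrite hornerM hornerXn; field; rewrite gt_eqF.
rewrite normrM normrX real_normK ?num_real// mulrC.
by rewrite ler_wpM2r ?sqr_ge0.
Qed.

Lemma is_derive_flat (P : {poly R}) (s : R) :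
  is_derive s 1 (flat P) (flat ('X^2 * (P - P^`())) s).
Proof.
have [s0|s0|->] := ltgtP s 0.
- have -> : flat ('X^2 * (P - P^`())) s = 0 by rewrite /flat ltNge ltW.
  apply: near_eq_is_derive (is_derive_cst (0 : R) s 1).
  near=> t; rewrite /flat /= ltNge ltW//=.
  by near: t; exact: lt_nbhsl.
- have -> : flat ('X^2 * (P - P^`())) s =
      ('X^2 * (P - P^`())).[s^-1] * expR (- s^-1) by rewrite /flat s0.
  have s1 : s != 0 by rewrite gt_eqF.
  have dV : is_derive s 1 (fun t : R => t^-1) (- s ^- 2).
    have := @is_deriveV _ id s 1 1 s1 (is_derive_id _ _).
    by rewrite /GRing.scale /= mulr1.
  have dP : is_derive s 1 (fun t : R => P.[t^-1]) (P^`().[s^-1] * - s ^- 2).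
    by apply: (@is_derive1_comp _ (horner P) (fun t : R => t^-1)).
  have dE : is_derive s 1 (fun t : R => expR (- t^-1)) (expR (- s^-1) * s ^- 2).
    have := @is_derive1_comp _ (@expR R) (fun t : R => - t^-1) s _ _ (is_derive_expR _) (is_deriveN dV).
    by rewrite opprK.
  have near_eq : \near s, P.[s^-1] * expR (- s^-1) = flat P s.
    near=> t; rewrite /flat ifT//.
    by near: t; exact: lt_nbhsr.
  apply: near_eq_is_derive near_eq _.
  apply: is_derive_eq (is_deriveM dP dE) _.
  rewrite hornerM hornerXn hornerD hornerN /GRing.scale /=.
  rewrite exprVn; ring.
- have [C C0 HC] := flat_le_sqr P.
  have f0 : flat P 0 = 0 by rewrite /flat ltxx.
  have -> : flat ('X^2 * (P - P^`())) 0 = 0 by rewrite /flat ltxx.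
  have cv : h^-1 *: ((flat P \o shift 0) (h *: 1) - flat P 0) @[h --> 0^'] --> (0:R).
    apply/cvgrPdist_le => e e0; near=> h.
    rewrite sub0r normrN f0 subr0 /= addr0 /GRing.scale /= mulr1 normrM normfV.
    have h0 : h != 0 by near: h; exact: nbhs_dnbhs_neq.
    rewrite mulrC ler_pdivrMr ?normr_gt0// (le_trans (HC h))//.
    rewrite -real_normK ?num_real// expr2 mulrA ler_wpM2r//.
    have : `|h| <= e / (C + 1).
      near: h; apply: dnbhs0_le; by rewrite divr_gt0// ltr_wpDl.
    rewrite ler_pdivlMr ?ltr_wpDl//; apply: le_trans.
    by rewrite mulrC ler_wpM2l// lerDl.
  by split; [apply/cvg_ex; exists 0|exact: cvg_lim cv].
Unshelve. all: by end_near. Qed.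

Lemma smooth_flat (P : {poly R}) : smooth setT (flat P).
Proof.
apply: (@alg_smooth _ _ _ [set flat P | P in setT]); first exact: openT.
- move=> b x [Q _ <-] _; apply/derivable1_diffP.
  by have [] := is_derive_flat Q x.
- move=> b v [Q _ <-]; exists (cst v * flat ('X^2 * (Q - Q^`()))).
    by apply: alg_mul; [exact: alg_cst|apply: alg_base; eexists].
  move=> x _; have [dQ dE] := is_derive_flat Q x.
  rewrite deriveE; last exact/derivable1_diffP.
  rewrite -[v]mulr1 -[v * 1]/(v *: 1) linearZ -deriveE; last exact/derivable1_diffP.
  by rewrite dE [v *: 1]mulr1.
- by apply: alg_base; exists P.
Qed.

Definition rho (s : R) : R := flat 1 s.

Lemma rhoE s : 0 < s -> rho s = expR (- s^-1).
Proof. by move=> s0; rewrite /rho /flat s0 hornerC mul1r. Qed.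

Lemma rho_le0 s : s <= 0 -> rho s = 0.
Proof. by move=> s0; rewrite /rho /flat ltNge s0. Qed.

Lemma rho_ge0 s : 0 <= rho s.
Proof.
by have [s0|s0] := ltP 0 s; [rewrite rhoE// expR_ge0|rewrite rho_le0].
Qed.

Lemma smooth_rho : smooth setT rho.
Proof. exact: smooth_flat. Qed.

Lemma is_derive_rho (s : R) : is_derive s 1 rho (flat 'X^2 s).
Proof.
have := is_derive_flat 1 s; congr (is_derive _ _ _ (flat _ _)).
by rewrite derivC subr0 mulr1.
Qed.

Lemma flat_X2E (s : R) : flat 'X^2 s = s ^- 2 * rho s.
Proof.
rewrite /rho /flat; case: ifP => _; last by rewrite mulr0.
by rewrite hornerXn hornerC mul1r exprVn.
Qed.

End Bump.

(** * A smooth step, the mean value theorem and the symmetry of second derivatives *)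

Section Plateau.
Context {R : realType}.

Definition plateau (s : R) : R := rho s * (rho s + rho (1 - s))^-1.

Lemma rho_gt0 (s : R) : 0 < s -> 0 < rho s.
Proof. by move=> s0; rewrite rhoE// expR_gt0. Qed.

Lemma plateau_den_gt0 (s : R) : 0 < rho s + rho (1 - s).
Proof.
have [s0|s0] := ltP 0 s; first by rewrite ltr_pwDl ?rho_gt0 ?rho_ge0.
by rewrite ltr_wpDl ?rho_ge0// rho_gt0// subr_gt0 (le_lt_trans s0).
Qed.

Lemma smooth_affine (a b : R) : smooth setT (fun s : R => a * s + b).
Proof.
have -> : (fun s : R => a * s + b) = (cst a * idfun) + cst b by apply/funext.
apply: smoothD; [exact: openT| |exact: (smooth_cst b openT)].
apply: smoothM; [exact: openT|exact: (smooth_cst a openT)|].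
by apply: (@smooth_linear _ _ _ idfun) => x.
Qed.

Lemma smooth_plateau : smooth setT plateau.
Proof.
have s1 : smooth setT (fun s : R => rho (1 - s)).
  have -> : (fun s : R => rho (1 - s)) = rho \o (fun s => -1 * s + 1).
    by apply/funext => s /=; congr rho; ring.
  by apply: smooth_comp; [exact: openT|exact: smooth_rho|exact: smooth_affine].
apply: smoothM; [exact: openT|exact: smooth_rho|].
apply: smoothV; [exact: openT| |by move=> s _; rewrite gt_eqF// plateau_den_gt0].
by apply: smoothD; [exact: openT|exact: smooth_rho|].
Qed.

Lemma plateau0 s : s <= 0 -> plateau s = 0.
Proof. by move=> s0; rewrite /plateau rho_le0// mul0r. Qed.

Lemma plateau1 s : 1 <= s -> plateau s = 1.
Proof.
move=> s1; rewrite /plateau [rho (1 - s)]rho_le0 ?subr_le0// addr0 divff//.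
by rewrite gt_eqF// rho_gt0// (lt_le_trans _ s1).
Qed.

Lemma plateau_itv s : 0 <= plateau s <= 1.
Proof.
rewrite /plateau divr_ge0 ?rho_ge0// ?(ltW (plateau_den_gt0 _))//=.
by rewrite ler_pdivrMr ?plateau_den_gt0// mul1r lerDl rho_ge0.
Qed.

End Plateau.

Section MeanValue.
Context {R : realType} {V : normedModType R}.
Implicit Types (f : V -> R) (x v w : V).

Lemma is_derive_line f x v (s : R) : derivable f (x + s *: v) v ->
  is_derive s 1 (fun t : R => f (x + t *: v)) ('D_v f (x + s *: v)).
Proof.
move=> df.
have E : (fun h : R => h^-1 *: (((fun t : R => f (x + t *: v)) \o shift s) (h *: 1)
            - f (x + s *: v))) =
         (fun h : R => h^-1 *: ((f \o shift (x + s *: v)) (h *: v) - f (x + s *: v))).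
  apply/funext => h /=; congr (_ *: (f _ - _)).
  by rewrite scalerDl [h *: 1]mulr1 addrCA.
by split; [rewrite /derivable E|rewrite /derive E].
Qed.

Lemma is_derive_shift_fun f c x v d : is_derive (x + c) v f d ->
  is_derive x v (fun y => f (y + c)) d.
Proof.
move=> [df dE]; split; last by rewrite derive_shift_fun.
move: df; rewrite /derivable.
rewrite (_ : (fun h : R => _) =
  (fun h : R => h^-1 *: (((fun y => f (y + c)) \o shift x) (h *: v) - f (x + c))))//.
by apply/funext => h /=; rewrite addrA.
Qed.

Lemma mvt_line f x v (h : R) : 0 <= h ->
  (forall s, 0 <= s <= h -> derivable f (x + s *: v) v) ->
  exists2 c, 0 <= c <= h & f (x + h *: v) - f x = h * 'D_v f (x + c *: v).
Proof.
move=> h0 df.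
have [|s /[!in_itv]/= /andP[s0 sh]||c] := @MVT_segment _ (fun t => f (x + t *: v))
  (fun s => 'D_v f (x + s *: v)) 0 h.
- exact: h0.
- by apply: is_derive_line; apply: df; rewrite !ltW.
- apply: derivable_within_continuous => s /[!in_itv]/= s0h.
  by have [] := is_derive_line (df s s0h).
- rewrite in_itv /= => c0h; rewrite scale0r addr0 subr0 mulrC => E.
  by exists c.
Qed.

(** The mean value theorem is applied to y |-> f (y + h w) - f y on the
    segment from x to x + h v; the differentiability of D_v f at x then
    expands the resulting increment of D_v f. *)
Lemma second_difference (A : set V) f x v w : open A -> smooth A f -> A x ->
  forall e : R, 0 < e -> exists2 d : R, 0 < d & forall h : R, 0 < h < d ->
  `|f (x + h *: w + h *: v) - f (x + h *: w) - (f (x + h *: v) - f x)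
    - h ^+ 2 * 'D_w ('D_v f) x| <= e * h ^+ 2.
Proof.
move=> oA sf Ax e e0.
have [r /= r0 xrA] : nbhs_ball x A by apply/nbhs_ballP; exact: open_nbhs_nbhs.
pose K := `|v| + `|w| + 1; pose F := 'D_v f.
have K0 : 0 < K by rewrite ltr_wpDl// addr_ge0.
have dF : differentiable F x by exact: (smooth_derive v sf) [::] x Ax.
have e'0 : 0 < e / (2 * K) by rewrite divr_gt0// mulr_gt0.
have := diff_locally dF; move=> /eqaddoP/(_ _ e'0)/nbhs_ballP[r' /= r'0 Hr'].
exists (Num.min r r' / K); first by rewrite divr_gt0// lt_min r0.
move=> h /andP[h0 hd].
have hK : h * K < Num.min r r' by rewrite -ltr_pdivlMr.
have small s : 0 <= s <= h -> `|s *: v| + h * `|w| < Num.min r r'.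
  move=> /andP[s0 sh]; apply: le_lt_trans hK.
  rewrite normrZ ger0_norm// /K mulrDr mulrDr -addrA lerD ?ler_wpM2r//.
  by rewrite lerDl mulr_ge0// ltW.
(* b tells the segments from x and from x + h w apart *)
have inA s (b : bool) : 0 <= s <= h -> A (x + (b%:R * h) *: w + s *: v).
  move=> sh; apply: xrA; rewrite -ball_normE /ball_ /=.
  rewrite -addrA opprD addrA subrr add0r normrN (le_lt_trans (ler_normD _ _))//.
  rewrite addrC (@lt_le_trans _ _ (Num.min r r')) ?ge_min ?lexx//.
  apply: le_lt_trans (small s sh); rewrite lerD2l normrZ normrM (gtr0_norm h0).
  by rewrite ler_wpM2r//; case: b; rewrite ?normr1 ?mul1r ?normr0 ?mul0r// ltW.
have df s (b : bool) : 0 <= s <= h -> derivable f (x + (b%:R * h) *: w + s *: v) v.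
  by move=> sh; apply: smooth_derivable sf (inA s b sh).
pose g y := f (y + h *: w) - f y.
have dg s : 0 <= s <= h -> is_derive (x + s *: v) v g
    (F (x + s *: v + h *: w) - F (x + s *: v)).
  move=> sh; apply: is_deriveB.
    have /derivableP D1 := df s true sh.
    rewrite mul1r addrAC in D1; exact: is_derive_shift_fun D1.
  have := df s false sh; rewrite mul0r scale0r addr0 => /derivableP D1.
  exact: D1.
have [|s sh|c ch E] := @mvt_line g x v h.
- exact: ltW.
- by have [] := dg s sh.
have [_ gE] := dg c ch; rewrite gE in E.
rewrite (_ : _ - _ - (_ - _) = h * (F (x + c *: v + h *: w) - F (x + c *: v))); last first.
  by rewrite -E /g [x + h *: v + _]addrAC; ring.
have cs := small c ch.
have DF k : `|k| < r' -> `|F (x + k) - F x - 'd F x k| <= e / (2 * K) * `|k|.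
  move=> kr; have := Hr' k; rewrite -ball_normE /ball_ /= sub0r normrN => /(_ kr).
  by rewrite !fctE /= opprD addrA [k + x]addrC.
have csm : `|c *: v + h *: w| <= h * K.
  rewrite (le_trans (ler_normD _ _))// !normrZ (gtr0_norm h0).
  case/andP: ch => c0 ch; rewrite (ger0_norm c0) /K !mulrDr -addrA lerD ?ler_wpM2r//.
  by rewrite lerDl mulr1 ltW.
have csv : `|c *: v| <= h * K.
  rewrite normrZ; case/andP: ch => c0 ch; rewrite (ger0_norm c0).
  rewrite /K !mulrDr -addrA (@le_trans _ _ (h * `|v|))// ?ler_wpM2r// lerDl.
  by rewrite addr_ge0 ?mulr_ge0// ltW.
have hKr' : h * K < r' by rewrite (lt_le_trans hK)// ge_min lexx orbT.
have D1 := DF _ (le_lt_trans csm hKr').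
have D2 := DF _ (le_lt_trans csv hKr').
rewrite [in 'D_w _ _]deriveE//.
have Z : 'd F x (c *: v + h *: w) = 'd F x (c *: v) + h * 'd F x w.
  by rewrite linearD; congr (_ + _); exact: linearZ.
rewrite Z addrA in D1.
have -> : h * (F (x + c *: v + h *: w) - F (x + c *: v)) - h ^+ 2 * 'd F x w =
  h * ((F (x + c *: v + h *: w) - F x - ('d F x (c *: v) + h * 'd F x w))
     - (F (x + c *: v) - F x - 'd F x (c *: v))) by ring.
have -> : e * h ^+ 2 = h * (e * h) by ring.
rewrite normrM (gtr0_norm h0) ler_wpM2l ?(ltW h0)//.
rewrite (le_trans (ler_normB _ _))// (le_trans (lerD D1 D2))//.
rewrite -mulrDr -ler_pdivlMl// invf_div.
have -> : (2 * K) / e * (e * h) = h * K + h * K.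
  by field; rewrite gt_eqF.
exact: lerD.
Qed.

(** Schwarz' theorem: the second difference is symmetric in v and w. *)
Lemma derive_comm (A : set V) f x v w : open A -> smooth A f -> A x ->
  'D_v ('D_w f) x = 'D_w ('D_v f) x.
Proof.
move=> oA sf Ax; apply/eqP; rewrite -subr_eq0 -normr_le0.
apply/ler_addgt0Pl => e e0; rewrite addr0.
have e2 : 0 < e / 2 by rewrite divr_gt0.
have [d1 d10 H1] := second_difference v w oA sf Ax e2.
have [d2 d20 H2] := second_difference w v oA sf Ax e2.
have [h h0 [hd1 hd2]] : exists2 h : R, 0 < h & h < d1 /\ h < d2.
  have m0 : 0 < Num.min d1 d2 by rewrite lt_min d10.
  exists (Num.min d1 d2 / 2); first by rewrite divr_gt0.
  by apply/andP; rewrite -lt_min ltr_pdivrMr// ltr_pMr ?ltr1n.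
have {}H1 := H1 h; have {}H2 := H2 h; rewrite h0 hd1 in H1; rewrite h0 hd2 in H2.
have {}H1 := H1 isT; have {}H2 := H2 isT.
rewrite [x + h *: v + h *: w]addrAC in H2.
have h20 : 0 < h ^+ 2 by rewrite exprn_gt0.
have H := le_trans (ler_normB _ _) (lerD H1 H2).
rewrite -mulrDl -splitr in H.
rewrite -(ler_pM2r h20) -[X in _ * X <= _](gtr0_norm h20) -normrM.
apply: le_trans H; rewrite le_eqVlt; apply/orP; left; apply/eqP.
congr `|_|.
move: (f (x + h *: w + h *: v)) (f (x + h *: w)) (f (x + h *: v)) => a b c.
by move: ('D_v _ x) ('D_w _ x) (f x) (h ^+ 2) => d e' y k; ring.
Qed.

End MeanValue.

(** * Functions with bounded derivatives on slabs *)

Section Components.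
Context {R : realType} {V : normedModType R}.

Lemma normr_mx_le (m n : nat) (M : 'M[R]_(m.+1, n.+1)) i j : `|M i j| <= `|M|.
Proof.
rewrite [leRHS]/Num.Def.normr/= mx_normrE.
exact: (le_bigmax _ (fun ij : 'I_m.+1 * 'I_n.+1 => `|M ij.1 ij.2|) (i, j)).
Qed.

Lemma derive_coord (F : V -> 'rV[R]_3) (v x : V) (k : 'I_3) :
  derivable F x v -> 'D_v F x 0 k = 'D_v (fun y => F y 0 k) x.
Proof. by move=> dF; rewrite derive_mx// mxE. Qed.

Lemma iter_deriv_coord (A : set V) (F : V -> 'rV[R]_3) (k : 'I_3) vs :
  open A -> smooth A F ->
  {in A, iter_deriv vs (fun y => F y 0 k) =1 fun y => iter_deriv vs F y 0 k}.
Proof.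
move=> oA sF; elim: vs => [//|v vs ih] x xA /=.
rewrite -/(iter_deriv _ _) -/(iter_deriv _ _) derive_coord; last first.
  by apply: diff_derivable; apply: sF; exact: set_mem.
apply: near_eq_derive; apply: open_near_eq oA _ (set_mem xA) => y; exact: ih.
Qed.

Lemma smooth_coord (A : set V) (F : V -> 'rV[R]_3) (k : 'I_3) :
  open A -> smooth A F -> smooth A (fun y => F y 0 k).
Proof.
move=> oA sF vs x Ax.
apply: (@near_eq_differentiable _ _ _ (fun y => iter_deriv vs F y 0 k)).
  apply: (open_near_eq oA _ Ax) => y yA /=.
  by rewrite (iter_deriv_coord k vs oA sF).
apply: (@differentiable_comp _ _ _ _ (iter_deriv vs F) (fun M => M 0 k)).
  exact: sF.
exact: differentiable_coord.
Qed.

End Components.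

Section Tame.
Context {R : realType}.
Implicit Types (T : R) (f g : spacetime R -> R).

Lemma open_slab T : open (slab T : set (spacetime R)).
Proof.
have -> : slab T = fst @^-1` `]0, T[ :> set (spacetime R).
  by apply/seteqP; split => [p [] //|p /= pT]; split.
by apply: open_comp => [p _|]; [exact: cvg_fst|exact: interval_open].
Qed.

Lemma slabE T (p : spacetime R) : slab T p = (0 < p.1 < T) :> Prop.
Proof.
by rewrite /slab /setX /= in_itv/=; apply/propext; split => [[]|].
Qed.

Lemma sub_slab T T' : T' <= T -> (slab T' : set (spacetime R)) `<=` slab T.
Proof.
by move=> TT p; rewrite !slabE => /andP[-> /lt_le_trans]; apply.
Qed.

(** The regularity of the components of a strong solution. It is stable under
    sums, products and derivatives, hence shared by every field built from
    them that serves as a test function. *)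
Definition tame T f := smooth (slab T) f /\
  forall T', 0 < T' < T -> forall vs, exists C : R, forall p, slab T' p -> `|iter_deriv vs f p| <= C.

Lemma tame_jets T (F : set (spacetime R -> R)) :
  (forall f, F f -> tame T f) -> forall f, alg (jets F) f -> tame T f.
Proof.
move=> Ft f Ff; split; first by apply: jets_smooth Ff; [exact: open_slab|move=> h /Ft[]].
move=> T' /[dup] T'T /andP[_ /ltW/sub_slab TT]; apply: alg_iter_bounded TT _ Ff.
- exact: open_slab.
- by move=> b x [h /Ft[sh _] [vs ->]] Ax; exact: sh.
- by move=> b v; exact: jets_derive.
- by move=> b [h /Ft[_ bh] [vs ->]]; exact: bh.
Qed.

Lemma tame_cst T (c : R) : tame T (cst c).
Proof. by apply: (@tame_jets _ set0) => //; exact: alg_cst. Qed.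

Lemma tameD T f g : tame T f -> tame T g -> tame T (f + g).
Proof.
move=> tf tg; apply: (@tame_jets _ [set f; g]) => [h [->|->]//|].
by apply: alg_add; apply: jets_self; [left|right].
Qed.

Lemma tameM T f g : tame T f -> tame T g -> tame T (f * g).
Proof.
move=> tf tg; apply: (@tame_jets _ [set f; g]) => [h [->|->]//|].
by apply: alg_mul; apply: jets_self; [left|right].
Qed.

Lemma tame_derive T f v : tame T f -> tame T ('D_v f).
Proof.
move=> tf; apply: (@tame_jets _ [set f]) => [h ->//|].
by apply: alg_base; exists f => //; exists [:: v].
Qed.

Lemma tameB T f g : tame T f -> tame T g -> tame T (f - g).
Proof.
move=> tf tg; rewrite (_ : f - g = f + cst (-1) * g); last first.
  by apply/funext => p; rewrite !fctE mulN1r.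
by apply: tameD => //; apply: tameM => //; exact: tame_cst.
Qed.

Lemma tame_coord T (F : spacetime R -> vec R) k : smooth (slab T) F ->
  (forall T', 0 < T' < T -> bounded_derivatives T' F) ->
  tame T (fun p => F p 0 k).
Proof.
move=> sF bF; split; first exact: smooth_coord (@open_slab T) sF.
move=> T' T'T vs; have [C FC] := bF T' T'T vs; exists C => p pT'.
rewrite (iter_deriv_coord k vs (@open_slab T) sF) ?(le_trans _ (FC p pT'))//.
  exact: normr_mx_le.
by rewrite inE; apply: sub_slab pT'; case/andP: T'T => _ /ltW.
Qed.

Lemma tame_bounded T f T' : tame T f -> T' < T ->
  exists2 C : R, 0 <= C & forall p, slab T' p -> `|f p| <= C.
Proof.
move=> tf T'T; have [T'0|T'0] := ltP 0 T'; last first.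
  exists 0 => // p; rewrite slabE => /andP[p0 /(lt_trans p0)].
  by rewrite ltNge T'0.
have T0T : 0 < T' < T by rewrite T'0.
have [C fC] := tf.2 _ T0T [::].
by exists `|C| => // p /fC /le_trans; apply; exact: ler_norm.
Qed.

Lemma tame_derivable T f v p : tame T f -> slab T p -> derivable f p v.
Proof. by move=> [sf _]; exact: smooth_derivable. Qed.

Lemma tame_continuous T f p : tame T f -> slab T p -> {for p, continuous f}.
Proof.
by move=> [sf _] Tp; apply: differentiable_continuous; exact: (sf [::]).
Qed.

Lemma tame_comm T f v w p : tame T f -> slab T p ->
  'D_v ('D_w f) p = 'D_w ('D_v f) p.
Proof. by move=> [sf _]; apply: derive_comm; [exact: open_slab|]. Qed.

(** The difference quotients of f (t, .) in the direction e converge uniformly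
    in t, with error C h, because second derivatives are bounded; so the
    limits in h and in t may be exchanged. *)
Lemma tame_trace_derive T f (f0 : space3 R -> R) (e : space3 R) : 0 < T ->
  tame T f -> (forall x, f (t, x) @[t --> 0^'+] --> f0 x) ->
  (forall x, derivable f0 x e) ->
  forall x, 'D_(0, e) f (t, x) @[t --> 0^'+] --> 'D_e f0 x.
Proof.
move=> T0 tf ff0 df0 x; pose v : spacetime R := (0, e).
have tg : tame T ('D_v f) by exact: tame_derive.
have TT : T / 2 < T by rewrite ltr_pdivrMr// ltr_pMr ?ltr1n.
have [C C0 HC] := tame_bounded (tame_derive v tg) TT.
have shiftE (t h : R) : (t, x) + h *: v = (t, x + h *: e) :> spacetime R.
  transitivity ((t + h *: 0, x + h *: e) : spacetime R); first by [].
  by rewrite scaler0 addr0.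
have taylor (t h : R) : 0 < t < T / 2 -> 0 <= h ->
    `|f (t, x + h *: e) - f (t, x) - h * 'D_v f (t, x)| <= C * h ^+ 2.
  move=> tT h0; have inS (y : space3 R) : slab (T / 2) ((t, y) : spacetime R) by rewrite slabE.
  have inT (y : space3 R) : slab T ((t, y) : spacetime R).
    exact: (sub_slab (ltW TT)).
  have [s _|c /andP[c0 ch] E1] := @mvt_line _ _ f (t, x) v h h0.
    by apply: tame_derivable tf _; rewrite shiftE.
  have [s _|c' /andP[c'0 c'c] E2] := @mvt_line _ _ ('D_v f) (t, x) v c c0.
    by apply: tame_derivable tg _; rewrite shiftE.
  rewrite -shiftE E1 -mulrBr E2 mulrA normrM ger0_norm ?mulr_ge0// mulrC.
  rewrite shiftE ler_pM ?mulr_ge0 ?HC// expr2.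
  by rewrite ler_wpM2l.
apply/cvgrPdist_le => eps eps0.
have := df0 x => /cvgrPdist_le-/(_ (eps / 3)).
rewrite divr_gt0// => /(_ isT) [d /= d0 Hd].
have C1 : 0 < C + 1 by rewrite ltr_wpDl.
have [h h0 [hd2 hC1]] : exists2 h : R, 0 < h & h <= d / 2 /\ h <= eps / 3 / (C + 1).
  exists (Num.min (d / 2) (eps / 3 / (C + 1))).
    by rewrite lt_min !divr_gt0.
  by rewrite !ge_min !lexx orbT.
have hd : ball_ Num.norm (0 : R) d h.
  rewrite /ball_ /= sub0r normrN gtr0_norm// (le_lt_trans hd2)//.
  by rewrite ltr_pdivrMr// ltr_pMr ?ltr1n.
have {}Hd : `|'D_e f0 x - h^-1 * (f0 (x + h *: e) - f0 x)| <= eps / 3.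
  by have := Hd h hd (lt0r_neq0 h0); rewrite /= [h *: e + x]addrC.
have hC : C * h <= eps / 3.
  apply: (@le_trans _ _ ((C + 1) * h)); first by rewrite ler_wpM2r ?lerDl// ltW.
  by rewrite mulrC -ler_pdivlMr.
have eh0 : 0 < eps / 3 * h / 2 by rewrite !divr_gt0// mulr_gt0// divr_gt0.
have /cvgrPdist_le/(_ _ eh0) L1 := ff0 x.
have /cvgrPdist_le/(_ _ eh0) L2 := ff0 (x + h *: e).
near=> t.
have t0 : 0 < t < T / 2.
  apply/andP; split; near: t; first exact: nbhs_right_gt.
  by apply: nbhs_right_lt; rewrite divr_gt0.
have l1 : `|f0 x - f (t, x)| <= eps / 3 * h / 2 by near: t.
have l2 : `|f0 (x + h *: e) - f (t, x + h *: e)| <= eps / 3 * h / 2 by near: t.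
have tay := taylor t h t0 (ltW h0).
rewrite -(ler_pM2r h0) -[X in _ * X <= _](gtr0_norm h0) -normrM.
move: l1 l2 tay Hd; rewrite /v.
move: (f0 x) (f (t, x)) (f0 (x + _)) (f (t, x + _)) ('D_e f0 x) ('D_(0, e) f (t, x)).
move=> a b c k D D' l1 l2 tay Hd.
have E : (D - D') * h =
  (D - h^-1 * (c - a)) * h + ((c - k) - (a - b)) + (k - b - h * D').
  by field; rewrite gt_eqF.
rewrite E (le_trans (ler_normD _ _))//.
have -> : eps * h = (eps / 3 * h + (eps / 3 * h / 2 + eps / 3 * h / 2)) + eps / 3 * h by field.
apply: lerD; last first.
  by rewrite (le_trans tay)// expr2 mulrA ler_wpM2r// ltW.
rewrite (le_trans (ler_normD _ _))// lerD//; last first.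
  by rewrite (le_trans (ler_normB _ _))// lerD.
rewrite normrM (gtr0_norm h0); apply: ler_wpM2r; [exact: ltW|exact: Hd].
Unshelve. all: by end_near. Qed.

End Tame.

(** * Measurability of open sets and integrals with a known value *)

(** The product sigma-algebra and the product topology are built
    independently. A countable measurable basis of neighbourhoods passes to
    products and shows that open sets are measurable. *)
Definition mbasis d (T : measurableType d) (nb : T -> set (set T)) :=
  exists U : nat -> set T, (forall n, measurable (U n)) /\
  forall x N, nb x N -> exists n, U n x /\ U n `<=` N.

Section MeasurableBasis.
Context {R : realType}.

Lemma mbasis_real : @mbasis _ (measurableTypeR R) (fun x => @nbhs R R x).
Proof.
pose U (n : nat) : set R := match (unpickle n : option (rat * rat)) with
  | Some (a, b) => `]ratr a, ratr b[%classic | None => set0 end.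
exists U; split => [n|x N].
  rewrite /U; case: unpickle => [[a b]|]; last exact: measurable0.
  exact: measurable_itv.
move=> /nbhs_ballP[e /= e0 eN].
have [a] := @rat_in_itvoo R (x - e) x (ltac:(by rewrite ltrBlDr ltrDl)).
have [b] := @rat_in_itvoo R x (x + e) (ltac:(by rewrite ltrDl)).
rewrite !in_itv/= => /andP[xb be] /andP[ea ax].
exists (pickle (a, b)); rewrite /U pickleK /=; split.
  by rewrite /= in_itv/= ax.
move=> y; rewrite /= in_itv/= => /andP[ay yb]; apply: eN.
rewrite /ball /= ltr_distlC; apply/andP; split.
  exact: lt_trans ea ay.
exact: lt_trans yb be.
Qed.

Lemma mbasis_prod d1 d2 (T1 : measurableType d1) (T2 : measurableType d2)
   (n1 : T1 -> set (set T1)) (n2 : T2 -> set (set T2)) :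
  mbasis n1 -> mbasis n2 ->
  @mbasis _ (T1 * T2)%type (fun x => filter_prod (n1 x.1) (n2 x.2)).
Proof.
move=> [U [mU HU]] [W [mW HW]].
pose Z (n : nat) : set (T1 * T2) := match (unpickle n : option (nat * nat)) with
  | Some (a, b) => U a `*` W b | None => set0 end.
exists Z; split => [n|[x y] N].
  rewrite /Z; case: unpickle => [[a b]|]; last exact: measurable0.
  exact: measurableX.
move=> [[P Q] /= [/HU[a [ax aP]] /HW[b [bx bQ]]] PQN].
exists (pickle (a, b)); rewrite /Z pickleK; split => // -[u v] [/= ua vb].
by apply: PQN; split => /=; [exact: aP|exact: bQ].
Qed.

Lemma open_measurable_mbasis d (T : measurableType d) (nb : T -> set (set T)) (O : set T) :
  mbasis nb -> (forall x, O x -> nb x O) -> measurable O.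
Proof.
move=> [U [mU HU]] oO.
have -> : O = \bigcup_(n in [set n | U n `<=` O]) U n.
  apply/seteqP; split => [x Ox|x [n /= UO Ux]]; last exact: UO.
  by have [n [Ux UO]] := HU x O (oO x Ox); exists n.
by apply: bigcup_measurable.
Qed.

Lemma open_measurable3 (O : set (space3 R)) : open O ->
  measurable (O : set (mspace R)).
Proof.
move=> oO.
apply: (open_measurable_mbasis (mbasis_prod (mbasis_prod mbasis_real mbasis_real) mbasis_real)).
by move=> x; rewrite openE in oO => /oO.
Qed.

Lemma open_measurable4 (O : set (spacetime R)) : open O ->
  measurable (O : set (mspacetime R)).
Proof.
move=> oO.
apply: (open_measurable_mbasis (mbasis_prod mbasis_real (mbasis_prod (mbasis_prod mbasis_real mbasis_real) mbasis_real))).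
by move=> x; rewrite openE in oO => /oO.
Qed.

Lemma continuous_measurable4 (A : set (spacetime R)) (f : spacetime R -> R) :
  open A -> (forall x, A x -> {for x, continuous f}) ->
  measurable_fun (A : set (mspacetime R)) (f : mspacetime R -> R).
Proof.
move=> oA cf; apply: (measurability _ (measurable_realfun.RGenOpens.measurableE R)).
move=> _ [_ [a [b ->]] <-]; apply: open_measurable4.
rewrite openE => x [Ax /= fx]; apply: filterI; first exact: open_nbhs_nbhs.
by apply: (cf x Ax); apply: open_nbhs_nbhs; split => //; exact: interval_open.
Qed.

Lemma continuous_measurable3 (f : space3 R -> R) :
  continuous f ->
  measurable_fun setT (f : mspace R -> R).
Proof.
move=> cf; apply: (measurability _ (measurable_realfun.RGenOpens.measurableE R)).
move=> _ [_ [a [b ->]] <-]; apply: open_measurable3.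
rewrite openE => x [_ /= fx]; apply: filterI; first exact: filterT.
by apply: cf; apply: open_nbhs_nbhs; split => //; exact: interval_open.
Qed.

End MeasurableBasis.

Section Integrals.
Context d (X : measurableType d) {R : realType} (mu : {measure set X -> \bar R}).
Implicit Types (A B : set X) (f g h : X -> R).

Definition intg A f := mu.-integrable A (EFin \o f).
(** Integrability is kept together with the value, so that integral identities
    can be added and scaled without further side conditions. *)
Definition has_int A f (c : R) := intg A f /\ \int[mu]_(x in A) f x = c.

Lemma intg_measurable A f : intg A f -> measurable_fun A f.
Proof. by move=> /integrableP[/measurable_EFinP]. Qed.

Lemma intg_le A f g : measurable A -> measurable_fun A f -> intg A g ->
  (forall x, A x -> `|f x| <= g x) -> intg A f.
Proof.
move=> mA mf ig fg; apply: le_integrable ig => //; first exact/measurable_EFinP.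
by move=> x Ax; rewrite lee_fin (le_trans (fg x Ax))// ler_norm.
Qed.

Lemma intgD A f g : measurable A -> intg A f -> intg A g -> intg A (f + g).
Proof.
move=> mA fi gi; apply: eq_integrable (integrableD mA fi gi) => // x _.
Qed.

Lemma intgZ A f k : measurable A -> intg A f -> intg A (fun x => k * f x).
Proof.
move=> mA fi; apply: eq_integrable (integrableZl mA k fi) => // x _.
Qed.

Lemma intg_sub A B f : measurable A -> measurable B -> B `<=` A ->
  intg A f -> intg B f.
Proof. by move=> mA mB BA; exact: integrableS. Qed.

Lemma intg_eq A f g : measurable A -> (forall x, A x -> f x = g x) ->
  intg A f -> intg A g.
Proof.
by move=> mA fg; apply: eq_integrable => // x /set_mem Ax /=; rewrite fg.
Qed.

Lemma intg_mul A f g : measurable A -> measurable_fun A f -> measurable_fun A g ->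
  intg A (fun x => f x ^+ 2) -> intg A (fun x => g x ^+ 2) ->
  intg A (fun x => f x * g x).
Proof.
move=> mA mf mg fi gi; apply: intg_le (intgD mA fi gi) _ => //.
  exact: measurable_funM.
move=> x _; rewrite fctE ler_norml; apply/andP; split; nra.
Qed.

Lemma has_intD A f g a b : measurable A -> has_int A f a -> has_int A g b ->
  has_int A (fun x => f x + g x) (a + b).
Proof.
move=> mA [fi fa] [gi gb]; split; first exact: intgD.
by rewrite RintegralD// fa gb.
Qed.

Lemma has_intZ A f k a : measurable A -> has_int A f a ->
  has_int A (fun x => k * f x) (k * a).
Proof.
by move=> mA [fi fa]; split; [exact: intgZ|rewrite RintegralZl// fa].
Qed.

Lemma has_intN A f a : measurable A -> has_int A f a ->
  has_int A (fun x => - f x) (- a).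
Proof.
move=> mA /(has_intZ (-1) mA); rewrite mulN1r.
by under eq_fun do rewrite mulN1r.
Qed.

Lemma has_int_eq A f g a b : measurable A -> has_int A f a ->
  (forall x, A x -> f x = g x) -> a = b -> has_int A g b.
Proof.
move=> mA [fi fa] fg <-; split; first exact: intg_eq fi.
rewrite -fa; apply: eq_Rintegral => x /set_mem Ax; exact/esym/fg.
Qed.

Lemma has_int_sum A n (f : 'I_n -> X -> R) (a : 'I_n -> R) : measurable A ->
  (forall i, has_int A (f i) (a i)) ->
  has_int A (fun x => \sum_i f i x) (\sum_i a i).
Proof.
move=> mA; elim: n f a => [|n ih] f a fa.
  apply: (@has_int_eq _ (cst 0) _ 0) => //; last first.
  - by rewrite big_ord0.
  - by move=> x _; rewrite big_ord0.
  - split; first exact: integrable0.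
    by rewrite /Rintegral integral0.
have H := has_intD mA (ih (fun i => f (widen_ord (leqnSn n) i)) _ (fun i => fa _)) (fa ord_max).
by apply: has_int_eq H _ _ => // [x _|]; rewrite big_ord_recr.
Qed.

Lemma has_int_le A f g a b : measurable A -> has_int A f a -> has_int A g b ->
  {ae mu, forall x, A x -> f x <= g x} -> a <= b.
Proof.
move=> mA [fi <-] [gi <-] fg.
have mf := intg_measurable fi; have mg := intg_measurable gi.
have h0 : (0 <= \int[mu]_(x in A) (g x - f x)%:E)%E.
  rewrite (ae_eq_integral (fun x => (`|g x - f x|)%:E)) //.
  - by apply: integral_ge0 => x _; rewrite lee_fin.
  - by apply/measurable_EFinP; exact: measurable_funB.
  - by apply/measurable_EFinP; apply: measurableT_comp => //; exact: measurable_funB.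
  - by apply: filterS fg => x fgx Ax; rewrite ger0_norm// subr_ge0 fgx.
rewrite -subr_ge0 -RintegralB// /Rintegral fine_ge0//.
Qed.

Lemma cvg_Rintegral A (f_ : (X -> R)^nat) f g : measurable A ->
  (forall n, measurable_fun A (f_ n)) ->
  (forall x, A x -> f_ n x @[n --> \oo] --> f x) ->
  intg A g -> (forall n x, A x -> `|f_ n x| <= g x) ->
  intg A f /\ \int[mu]_(x in A) f_ n x @[n --> \oo] --> \int[mu]_(x in A) f x.
Proof.
move=> mA mf_ f_f ig f_g.
have mf : measurable_fun A f by apply: measurable_fun_cvg mf_ f_f.
have [|||||fi _ cv] := @dominated_convergence _ _ _ mu A mA (fun n => EFin \o f_ n)
  (EFin \o f) (EFin \o g).
- by move=> n; exact/measurable_EFinP.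
- exact/measurable_EFinP.
- apply: aeW => x Ax; apply: cvg_EFin; first by apply: nearW.
  exact: f_f.
- exact: ig.
- by apply: aeW => x n Ax; rewrite lee_fin; exact: f_g.
split => //.
rewrite -[X in _ --> X]/(fine _); apply: fine_cvg.
rewrite fineK//; exact: integrable_fin_num.
Qed.

End Integrals.

(** * Boxes, slabs and local integrability *)

Section IntegralsMore.
Context d (X : measurableType d) {R : realType} (mu : {measure set X -> \bar R}).
Implicit Types (A B : set X) (f g h : X -> R).

Lemma intgP A f : measurable_fun A f ->
  (\int[mu]_(x in A) (`|f x|)%:E < +oo)%E -> intg mu A f.
Proof. by move=> mf fi; apply/integrableP; split => //; exact/measurable_EFinP. Qed.

Lemma intg_le_ae A f g : measurable A -> measurable_fun A f -> intg mu A g ->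
  {ae mu, forall x, A x -> `|f x| <= g x} -> intg mu A f.
Proof.
move=> mA mf ig fg; apply: intgP => //.
have /integrableP[mg gi] := ig.
apply: le_lt_trans gi; apply: ae_ge0_le_integral => //.
- by apply/measurable_EFinP; exact: measurableT_comp.
- exact: measurableT_comp.
- by apply: filterS fg => x h Ax; rewrite lee_fin (le_trans (h Ax))// ler_norm.
Qed.

Lemma intg_ext A B f : measurable A -> measurable B -> A `<=` B ->
  (forall x, B x -> ~ A x -> f x = 0) -> intg mu A f -> intg mu B f.
Proof.
move=> mA mB AB f0 /(integrable_mkcond _ mA) fi; apply/integrable_mkcond => //.
apply: eq_integrable fi => // x _; rewrite !patchE.
case: ifPn => [/set_mem xA|/negP xA]; first by rewrite ifT// inE; exact: AB.
by case: ifPn => // /set_mem xB /=; rewrite f0// => /mem_set.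
Qed.

Lemma Rintegral_ext A B f : A `<=` B ->
  (forall x, B x -> ~ A x -> f x = 0) ->
  \int[mu]_(x in B) f x = \int[mu]_(x in A) f x.
Proof.
move=> AB f0; rewrite [LHS]Rintegral_mkcond [RHS]Rintegral_mkcond.
apply: eq_Rintegral => x _; rewrite !patchE.
case: ifPn => [/set_mem xB|/negP xB].
  by case: ifPn => // /negP xA; rewrite f0// => /mem_set.
by rewrite ifF//; apply/negP => /set_mem/AB/mem_set.
Qed.

End IntegralsMore.

Section Domains.
Context {R : realType}.
Implicit Types (T r : R).

Notation mu3 := (@leb3 R).
Notation mu4 := (@leb4 R).

Definition cube r : set (space3 R) :=
  (`[- r, r]%classic `*` `[- r, r]%classic) `*` `[- r, r]%classic.

Definition box r : set (spacetime R) := `]0, r]%classic `*` cube r.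

Lemma measurable_cube r : measurable (cube r : set (mspace R)).
Proof. by apply: measurableX; [apply: measurableX|]; exact: measurable_itv. Qed.

Lemma measurable_box r : measurable (box r : set (mspacetime R)).
Proof. by apply: measurableX; [exact: measurable_itv|exact: measurable_cube]. Qed.

Lemma measurable_slab T : measurable (slab T : set (mspacetime R)).
Proof. by apply: measurableX; [exact: measurable_itv|exact: measurableT]. Qed.

Lemma measurable_half : measurable (halfspace : set (mspacetime R)).
Proof. by apply: measurableX; [exact: measurable_itv|exact: measurableT]. Qed.

Lemma cube_compact r : compact (cube r).
Proof.
exact: (compact_setX (compact_setX (@segment_compact R _ _) (@segment_compact R _ _)) (@segment_compact R _ _)).
Qed.

Lemma leb_itv_lty (i : interval R) : (i.1 < +oo)%E -> (-oo < i.1)%E ->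
  (i.2 < +oo)%E -> (-oo < i.2)%E -> (lebesgue_measure ([set` i] : set R) < +oo)%E.
Proof.
rewrite lebesgue_measure_itv; case: ifP => // _.
move: (i.1 : \bar R) (i.2 : \bar R) => [a| |] [b| |] //= _ _ _ _.
by rewrite -EFinB ltry.
Qed.

Lemma leb_segment_lty a b : (lebesgue_measure (`[a, b]%classic : set R) < +oo)%E.
Proof. by apply: leb_itv_lty; rewrite /= ?ltry ?ltNyr. Qed.

Lemma sfprodE d1 d2 (X1 : measurableType d1) (X2 : measurableType d2)
    (m1 : {sigma_finite_measure set X1 -> \bar R})
    (m2 : {sigma_finite_measure set X2 -> \bar R}) A B :
  measurable A -> measurable B -> sfprod m1 m2 (A `*` B) = (m1 A * m2 B)%E.
Proof. by move=> mA mB; exact: product_measure1E. Qed.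

Lemma sfprod_lty d1 d2 (X1 : measurableType d1) (X2 : measurableType d2)
    (m1 : {sigma_finite_measure set X1 -> \bar R})
    (m2 : {sigma_finite_measure set X2 -> \bar R}) A B :
  measurable A -> measurable B -> (m1 A < +oo)%E -> (m2 B < +oo)%E ->
  (sfprod m1 m2 (A `*` B) < +oo)%E.
Proof.
by move=> mA mB fA fB; rewrite sfprodE// lte_mul_pinfty// ge0_fin_numE.
Qed.

Lemma cube_lty r : (mu3 (cube r) < +oo)%E.
Proof.
have mI : measurable (`[- r, r]%classic : set (measurableTypeR R)) by exact: measurable_itv.
apply: sfprod_lty => //; [exact: measurableX| |exact: leb_segment_lty].
by apply: sfprod_lty => //; exact: leb_segment_lty.
Qed.

Lemma box_lty r : (mu4 (box r) < +oo)%E.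
Proof.
apply: sfprod_lty; [exact: measurable_itv|exact: measurable_cube| |exact: cube_lty].
by apply: leb_itv_lty; rewrite /= ?ltry ?ltNyr.
Qed.

Lemma intg_cst_box r (c : R) : intg mu4 (box r) (cst c).
Proof.
apply: intgP; first exact: measurable_cst.
rewrite (_ : (fun x => _) = cst (`|c|)%:E)// integral_cst; last exact: measurable_box.
by rewrite lte_mul_pinfty// box_lty.
Qed.

Lemma intg_cst_cube r (c : R) : intg mu3 (cube r) (cst c).
Proof.
apply: intgP; first exact: measurable_cst.
rewrite (_ : (fun x => _) = cst (`|c|)%:E)// integral_cst; last exact: measurable_cube.
by rewrite lte_mul_pinfty// cube_lty.
Qed.

Lemma halfE (p : spacetime R) : halfspace p = (0 < p.1) :> Prop.
Proof.
by rewrite /halfspace /setX /= in_itv/= andbT; apply/propext; split => [[]|].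
Qed.

Lemma box_half r : (box r : set (spacetime R)) `<=` halfspace.
Proof. by move=> p [/=]; rewrite halfE in_itv/= => /andP[]. Qed.

Lemma slab_half T : (slab T : set (spacetime R)) `<=` halfspace.
Proof. by move=> p; rewrite halfE slabE => /andP[]. Qed.

Lemma box_slab r T : r < T -> (box r : set (spacetime R)) `<=` slab T.
Proof.
move=> rT p [/=]; rewrite slabE in_itv/= => /andP[-> pr] _.
exact: le_lt_trans rT.
Qed.

Lemma tonelli_slab T (h : spacetime R -> R) :
  measurable_fun (slab T : set (mspacetime R)) h ->
  (forall p, slab T p -> 0 <= h p) ->
  (\int[mu4]_(p in slab T) (h p)%:E =
   \int[lebesgue_measure]_(t in `]0%R, T[) \int[mu3]_x (h (t, x))%:E)%E
  /\ measurable_fun (`]0, T[%classic : set (measurableTypeR R))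
       (fun t => \int[mu3]_x (h (t, x))%:E)%E.
Proof.
move=> mh h0; pose F := (EFin \o h) \_ (slab T).
have mF : measurable_fun [set: mspacetime R] F.
  apply/(measurable_restrictT _ (measurable_slab T)); exact/measurable_EFinP.
have F0 p : (0%R <= F p)%E.
  by rewrite /F patchE; case: ifPn => // /set_mem/h0; rewrite lee_fin.
have FE t : t \in `]0, T[%classic -> (fun x => F (t, x)) = (fun x => (h (t, x))%:E).
  move=> tT; apply/funext => x; rewrite /F patchE ifT// inE slabE /=.
  by move/set_mem : tT; rewrite /= in_itv.
split.
  rewrite integral_mkcond (@fubini_tonelli1 _ _ _ _ _ lebesgue_measure mu3)//.
  rewrite [RHS]integral_mkcond; apply: eq_integral => t _.
  rewrite /fubini_F !patchE; case: ifPn => tT; first by rewrite FE.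
  rewrite integral0_eq// => x _; rewrite /F patchE ifF//.
  apply/negP => /set_mem; rewrite slabE /= => tT'.
  by move/negP : tT; apply; rewrite inE /= in_itv.
have := @measurable_fun_fubini_tonelli_F _ _ (measurableTypeR R) _ _ mu3 F mF F0.
move=> /(@measurable_funTS _ _ _ _ `]0, T[%classic).
apply: eq_measurable_fun => t tT.
by rewrite /fubini_F FE.
Qed.

Definition L1loc (g : spacetime R -> R) := forall r, intg mu4 (box r) g.
Definition L2loc (g : spacetime R -> R) := forall r,
  measurable_fun (box r : set (mspacetime R)) g /\
  intg mu4 (box r) (fun p => g p ^+ 2).

Lemma L2locM g h : L2loc g -> L2loc h -> L1loc (fun p => g p * h p).
Proof.
move=> lg lh r; have [mg gi] := lg r; have [mh hi] := lh r.
by apply: intg_mul => //; exact: measurable_box.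
Qed.

Lemma L2loc_cst c : L2loc (cst c).
Proof. by move=> r; split; [exact: measurable_cst|exact: (intg_cst_box r (c ^+ 2))]. Qed.

Lemma L2loc_L1loc g : L2loc g -> L1loc g.
Proof.
move=> lg r; have := L2locM lg (L2loc_cst 1) r.
by apply: intg_eq => [|p _]; [exact: measurable_box|rewrite /= mulr1].
Qed.

Lemma L1locD g h : L1loc g -> L1loc h -> L1loc (fun p => g p + h p).
Proof. by move=> lg lh r; apply: (intgD (measurable_box r)). Qed.

Lemma L1locN g : L1loc g -> L1loc (fun p => - g p).
Proof.
move=> lg r; have := intgZ (-1) (measurable_box r) (lg r).
by apply: intg_eq => [|p _]; [exact: measurable_box|rewrite /= mulN1r].
Qed.

Lemma L2_slab_measurable T (p : \bar R) (f : spacetime R -> R) :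
  f \_ (slab T) \in Lfun mu4 p -> measurable_fun (slab T : set (mspacetime R)) f.
Proof.
move=> /sub_Lfun_mfun /set_mem /= mf.
exact/(measurable_restrictT _ (measurable_slab T)).
Qed.

Lemma intg_sub_box (r : R) (f : spacetime R -> R) :
  intg mu4 (slab (r + 1)) f -> intg mu4 (box r) f.
Proof.
apply: intg_sub; [exact: measurable_slab|exact: measurable_box|].
by apply: box_slab; rewrite ltrDl.
Qed.

Lemma sub_box_measurable (r : R) (f : spacetime R -> R) :
  measurable_fun (slab (r + 1) : set (mspacetime R)) f ->
  measurable_fun (box r : set (mspacetime R)) f.
Proof.
apply: measurable_funS; first exact: measurable_slab.
by apply: box_slab; rewrite ltrDl.
Qed.

Lemma box_neg r (p : spacetime R) : r <= 0 -> ~ box r p.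
Proof.
move=> r0 [/=]; rewrite in_itv/= => /andP[p0 pr] _.
by have := lt_le_trans p0 (le_trans pr r0); rewrite ltxx.
Qed.

Lemma L2loc_slab (g : spacetime R -> R) :
  (forall T, 0 < T -> measurable_fun (slab T : set (mspacetime R)) g /\
    intg mu4 (slab T) (fun p => g p ^+ 2)) -> L2loc g.
Proof.
move=> H r; have [r0|r0] := leP r (-1).
  have -> : box r = set0 :> set (mspacetime R).
    by rewrite -subset0 => p; apply: box_neg; rewrite (le_trans r0).
  by split; [exact: measurable_fun_set0|exact: integrable_set0].
have [|mg gi] := H (r + 1); first by rewrite -ltrBlDr sub0r.
by split; [exact: sub_box_measurable|exact: intg_sub_box].
Qed.

Lemma L2_slab_intg T (F : spacetime R -> vec R) k : L2_slab T F ->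
  measurable_fun (slab T : set (mspacetime R)) (fun p => F p 0 k) /\
  intg mu4 (slab T) (fun p => F p 0 k ^+ 2).
Proof.
move=> /(_ k) FL; split; first exact: L2_slab_measurable FL.
have := Lfun2_integrable_sqr FL.
move=> H; apply/(integrable_mkcond _ (measurable_slab T)).
apply: eq_integrable H => // p _; rewrite /= !patchE.
by case: ifPn => //= _; rewrite expr0n.
Qed.

Lemma sqr_le_sqnorm (u : vec R) k : u 0 k ^+ 2 <= sqnorm u.
Proof.
rewrite /sqnorm /dot (bigD1 k)//= -expr2 lerDl sumr_ge0// => i _.
by rewrite -expr2 sqr_ge0.
Qed.

Lemma sqnorm_ge0 (u : vec R) : 0 <= sqnorm u.
Proof. by apply: sumr_ge0 => i _; rewrite -expr2 sqr_ge0. Qed.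

Lemma measurable_sqnorm (A : set (mspacetime R)) (F : spacetime R -> vec R) :
  (forall k, measurable_fun A (fun p => F p 0 k)) ->
  measurable_fun A (fun p => sqnorm (F p)).
Proof. by move=> mF; apply: measurable_sum => k; exact: measurable_funM. Qed.

(** Tonelli integrates over ]0, T[ the bound that holds on almost every time
    slice. *)
Lemma LinftyL2_intg T (F : spacetime R -> vec R) k : 0 < T -> LinftyL2 T F ->
  measurable_fun (slab T : set (mspacetime R)) (fun p => F p 0 k) /\
  intg mu4 (slab T) (fun p => F p 0 k ^+ 2).
Proof.
move=> T0 [mF [C FC]]; split => //; apply: intgP.
  exact: measurable_funX.
have mS := measurable_sqnorm mF.
have [E mI] := tonelli_slab mS (fun p _ => sqnorm_ge0 (F p)).
apply: (@le_lt_trans _ _ (\int[mu4]_(p in slab T) (sqnorm (F p))%:E)%E).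
  apply: ge0_le_integral => //.
  - exact: measurable_slab.
  - by apply/measurable_EFinP; apply: measurableT_comp => //; exact: measurable_funX.
  - by apply/measurable_EFinP; exact: mS.
  - by move=> p _; rewrite lee_fin ger0_norm ?sqr_ge0// sqr_le_sqnorm.
rewrite E; apply: (@le_lt_trans _ _
  (\int[lebesgue_measure]_(t in `]0%R, T[) (`|C|)%:E)%E); last first.
  have L : (lebesgue_measure (`]0%R, T[%classic : set R) < +oo)%E.
    by apply: leb_itv_lty; rewrite /= ?ltry ?ltNyr.
  rewrite (_ : (fun=> _) = cst (`|C|)%:E)// integral_cst; last exact: measurable_itv.
  by rewrite lte_mul_pinfty//; exact: L.
apply: ae_ge0_le_integral.
- exact: measurable_itv.
- by move=> t _; apply: integral_ge0 => x _; rewrite lee_fin sqnorm_ge0.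
- exact: mI.
- by move=> t _; rewrite lee_fin.
- exact: measurable_cst.
- apply: (@filterS _ _ (ae_filter_ringOfSetsType (@lebesgue_measure R))) FC => t tC; rewrite /= in_itv/= => /tC /le_trans; apply.
  by rewrite lee_fin ler_norm.
Qed.

End Domains.

(** * Test functions from a cutoff and a function given for positive times *)

Section CompactBound.
Context {R : realType} {V : normedModType R}.

Lemma continuous_compact_bound (f : V -> R) (K : set V) : compact K ->
  continuous f -> exists2 C, 0 <= C & forall x, K x -> `|f x| <= C.
Proof.
move=> cK cf.
have cfK : compact (f @` K).
  by apply: continuous_compact => //; exact: continuous_subspaceT.
have [M [_ HM]] := compact_bounded cfK.
exists (`|M| + 1) => [|x Kx]; first by rewrite addr_ge0.
by apply: HM; [rewrite (le_lt_trans (ler_norm _))// ltrDl|exists x].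
Qed.

Lemma smooth_sub (A B : set V) (f : V -> R) : B `<=` A -> smooth A f -> smooth B f.
Proof. by move=> BA sf vs x /BA; exact: sf. Qed.

Lemma smoothU (A B C : set V) (f : V -> R) : C `<=` A `|` B ->
  smooth A f -> smooth B f -> smooth C f.
Proof. by move=> CAB sA sB vs x /CAB[|]; [exact: sA|exact: sB]. Qed.

Lemma smooth_continuous (f : V -> R) : smooth setT f -> continuous f.
Proof. by move=> sf x; apply: differentiable_continuous; exact: (sf [::]). Qed.

End CompactBound.

Section Cutoff.
Context {R : realType}.
Implicit Types (T r : R) (theta f : spacetime R -> R).

(** No condition is imposed at t <= 0: the values at t = 0 are what sees the
    initial data. *)
Definition cutoff T1 r theta := smooth setT theta /\
  forall p, ~ (p.1 <= T1 /\ cube r p.2) -> theta p = 0.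

Lemma compact_slice (a b : R) r :
  compact (`[a, b]%classic `*` cube r : set (spacetime R)).
Proof.
exact: (@compact_setX R (space3 R) _ _ (@segment_compact R _ _) (@cube_compact R r)).
Qed.

Lemma open_fst_gt (a : R) : open [set p : spacetime R | a < p.1].
Proof.
apply: (@open_comp _ _ (fst : spacetime R -> R) [set t : R | a < t]) => [q _|].
  exact: cvg_fst.
exact: open_gt.
Qed.

Lemma open_half : open (halfspace : set (spacetime R)).
Proof.
have -> : halfspace = [set p : spacetime R | 0 < p.1].
  by apply/seteqP; split => q; rewrite halfE.
exact: open_fst_gt.
Qed.

Lemma closed_cube r : closed (cube r : set (space3 R)).
Proof.
apply: compact_closed; [|exact: cube_compact].
exact: norm_hausdorff.
Qed.

Lemma cutoff_derive T1 r theta v : cutoff T1 r theta ->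
  cutoff T1 r ('D_v theta).
Proof.
move=> [st t0]; split => [|p np]; first exact: smooth_derive.
rewrite (@near_eq_derive _ _ _ _ (cst 0)); first by rewrite derive_cst.
have oC : open [set p : spacetime R | ~ (p.1 <= T1 /\ cube r p.2)].
  rewrite (_ : [set p | _] = fst @^-1` [set t | T1 < t] `|` snd @^-1` (~` cube r)).
    apply: openU; apply: open_comp.
    - by move=> q _; exact: cvg_fst.
    - exact: open_gt.
    - by move=> q _; exact: cvg_snd.
    - by apply: closed_openC; exact: closed_cube.
  apply/seteqP; split => q /=.
    by move=> /not_andP[/negP|]; [rewrite -ltNge; left|right].
  by move=> [qT|qC] [qT' qC'//]; move: qT; rewrite ltNge qT'.
by apply: (open_near_eq oC) => // q /set_mem /t0.
Qed.

Lemma cutoff_bound T1 r theta : cutoff T1 r theta ->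
  exists2 C, 0 <= C & forall p, halfspace p -> `|theta p| <= C.
Proof.
move=> [st t0].
have cK : compact (`[0, T1]%classic `*` cube r : set (spacetime R)).
  exact: compact_slice.
have [C C0 HC] := continuous_compact_bound cK (smooth_continuous st).
exists C => // p; rewrite halfE => p0.
have [[pT pc]|np] := pselect (p.1 <= T1 /\ cube r p.2); last by rewrite t0// normr0.
by apply: HC; split => //=; rewrite in_itv/= pT ltW.
Qed.

Lemma smooth_fst : smooth setT (fst : spacetime R -> R).
Proof. by apply: (@smooth_linear _ _ _ fst) => p; exact: cvg_fst. Qed.

End Cutoff.

Section ShiftedTests.
Context {R : realType}.
Variables (T T1 r : R) (theta f : spacetime R -> R).
Hypotheses (T10 : 0 < T1) (T1T : T1 < T) (Tr : T <= r).
Hypotheses (ct : cutoff T1 r theta) (tf : tame T f).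

Let a : R := T - T1.
Let eps (n : nat) : R := a / n.+2%:R.
Let c (n : nat) : spacetime R := (eps n, 0).

Let a0 : 0 < a. Proof. by rewrite subr_gt0. Qed.
Let eps0 n : 0 < eps n. Proof. by rewrite divr_gt0. Qed.
Let epsa n : eps n <= a / 2.
Proof. by rewrite ler_pM2l// lef_pV2 ?posrE// ler_nat. Qed.

Let cE n (p : spacetime R) : p + c n = (p.1 + eps n, p.2).
Proof.
case: p => t x; transitivity ((t + eps n, x + 0) : spacetime R); first by [].
by rewrite addr0.
Qed.

(** The shift in time by eps n makes f available for slightly negative t, and
    the step, which is 1 for t >= 0 and 0 for t <= - eps n / 2, switches these
    functions off before the shifted point leaves the slab: they are test
    functions on the whole space-time. *)
Definition shifted_test (n : nat) (p : spacetime R) : R :=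
  plateau (2 / eps n * p.1 + 1) * (theta p * f (p + c n)).

Let phi := shifted_test.

Let T2 : R := T1 + 3 / 4 * a.
Let T2T : T2 < T.
Proof. by rewrite /T2 /a; move: T1T => ?; lra. Qed.

Let shift_slab n p : halfspace p -> p.1 <= T1 -> slab T2 (p + c n).
Proof.
rewrite halfE slabE cE /= => p0 pT; rewrite addr_gt0//= /T2.
have := epsa n; have := a0; lra.
Qed.

Let open_shift n : open [set p : spacetime R | slab T (p + c n)].
Proof.
rewrite (_ : [set p | _] = fst @^-1` `]- eps n, T - eps n[%classic).
  by apply: open_comp => [p _|]; [exact: cvg_fst|exact: interval_open].
apply/seteqP; split => p /=; rewrite slabE cE /= in_itv /=.
  by move=> /andP[h1 h2]; apply/andP; split; lra.
by move=> /andP[h1 h2]; apply/andP; split; lra.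
Qed.

Lemma shifted_test_smooth n : smooth setT (phi n).
Proof.
have epsn := eps0 n.
pose B : set (spacetime R) := fst @^-1` `]-oo, - eps n / 2[%classic
  `|` fst @^-1` `]T1, +oo[%classic.
have oB : open B.
  by apply: openU; apply: open_comp => [p _|];
    [exact: cvg_fst|exact: interval_open|exact: cvg_fst|exact: interval_open].
apply: (smoothU (A := [set p : spacetime R | slab T (p + c n)]) (B := B)).
- move=> p _; rewrite /= slabE cE /= /B /= !in_itv /= andbT.
  have [h|h] := ltP p.1 (- eps n / 2); first by right; left.
  have [h'|h'] := ltP T1 p.1; first by right; right.
  left; have := epsa n; have := a0; rewrite /a => *.
  by apply/andP; split; lra.
- have oA := @open_shift n.
  apply: smoothM => //.
    apply: (smooth_sub (A := setT)) => //.
    apply: (@smooth_comp _ _ setT plateau (fun p : spacetime R => 2 / eps n * p.1 + 1)).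
    + exact: openT.
    + exact: smooth_plateau.
    + apply: (@smooth_comp _ _ setT (fun s => 2 / eps n * s + 1) fst).
      * exact: openT.
      * exact: smooth_affine.
      * exact: smooth_fst.
  apply: smoothM => //; first by apply: (smooth_sub (A := setT)) => //; case: ct.
  by apply: smooth_shift; case: tf.
- apply: (@smooth_in _ _ _ B (cst 0)) => //; last exact: smooth_cst.
  move=> p /set_mem [] /=; rewrite in_itv/=.
    move=> h; rewrite /phi /shifted_test plateau0 ?mul0r//.
    have : 2 / eps n * p.1 <= 2 / eps n * (- eps n / 2).
      by rewrite ler_pM2l ?divr_gt0// ltW.
    have -> : 2 / eps n * (- eps n / 2) = -1 by field; rewrite gt_eqF.
    lra.
  rewrite andbT => h; rewrite /phi /shifted_test (ct.2 p) ?mul0r ?mulr0// => -[].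
  by rewrite leNgt h.
Qed.

Lemma shifted_test_test n : test_fun setT (phi n).
Proof.
split; first exact: shifted_test_smooth.
exists (`[- eps n, T1]%classic `*` cube r); split => //.
  exact: compact_slice.
move=> p np; rewrite /phi /shifted_test; have epsn := eps0 n.
have [h|h] := ltP p.1 (- eps n).
  rewrite plateau0 ?mul0r//.
  have : 2 / eps n * p.1 <= 2 / eps n * (- eps n).
    by rewrite ler_pM2l ?divr_gt0// ltW.
  have -> : 2 / eps n * (- eps n) = -2 by field; rewrite gt_eqF.
  lra.
rewrite (ct.2 p) ?mul0r ?mulr0// => -[pT pc]; apply: np; split => //=.
by rewrite in_itv/= h.
Qed.

Let phi_near n p : halfspace p -> \near p, phi n p = theta p * f (p + c n).
Proof.
move=> hp; have oH := @open_half R.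
have := open_nbhs_nbhs (conj oH hp); apply: filterS => q; rewrite halfE => q0.
rewrite /phi /shifted_test plateau1 ?mul1r// lerDr.
by rewrite mulr_ge0// ?ltW// divr_gt0.
Qed.

Lemma shifted_testE n p : halfspace p -> phi n p = theta p * f (p + c n).
Proof. by move=> hp; have := nbhs_singleton (phi_near n hp). Qed.

Lemma shifted_test_derive n v p : halfspace p ->
  'D_v (phi n) p = 'D_v theta p * f (p + c n) + theta p * 'D_v f (p + c n).
Proof.
move=> hp; have [pT|pT] := leP p.1 T1; last first.
  have np : ~ (p.1 <= T1 /\ cube r p.2) by move=> []; rewrite leNgt pT.
  rewrite ((cutoff_derive v ct).2 p)// (ct.2 p)// !mul0r addr0.
  have oC := @open_fst_gt R T1.
  rewrite (@near_eq_derive _ _ _ _ (cst 0)); first by rewrite derive_cst.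
  apply: (open_near_eq oC) => // q /set_mem /= qT.
  by rewrite /phi /shifted_test (ct.2 q) ?mul0r ?mulr0// => -[]; rewrite leNgt qT.
rewrite (near_eq_derive _ (phi_near n hp)).
have D1 := derivableP (@smooth_derivable _ _ _ _ _ v p ct.1 I).
have inT : slab T (p + c n).
  by apply: sub_slab (ltW T2T) _ _; exact: shift_slab.
have D2 := is_derive_shift_fun (derivableP (@tame_derivable R T f v _ tf inT)).
have [_ ->] := is_deriveM D1 D2.
by rewrite /GRing.scale /= addrC [f _ * _]mulrC.
Qed.

Lemma shifted_test_out n v p : halfspace p -> ~ box r p ->
  phi n p = 0 /\ 'D_v (phi n) p = 0.
Proof.
move=> hp np.
have np' : ~ (p.1 <= T1 /\ cube r p.2).
  move=> [pT pc]; apply: np; split => //=; move: hp; rewrite halfE in_itv/= => ->/=.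
  by rewrite (le_trans pT)// (le_trans _ Tr)// ltW.
by rewrite shifted_testE// shifted_test_derive// ((cutoff_derive v ct).2 p)// (ct.2 p)// !mul0r addr0.
Qed.

Let eps_cvg : eps n @[n --> \oo] --> 0.
Proof.
rewrite -(mulr0 a); apply: cvgM; first exact: cvg_cst.
by have := @cvg_harmonic R; rewrite -cvg_shiftS.
Qed.

Let cvg_shift (g : spacetime R -> R) p : tame T g -> halfspace p -> p.1 <= T1 ->
  g (p + c n) @[n --> \oo] --> g p.
Proof.
move=> tg hp pT; have inT : slab T p.
  by rewrite slabE; move: hp; rewrite halfE => -> /=; rewrite (le_lt_trans pT).
have cg := tame_continuous tg inT.
have cp : p + c n @[n --> \oo] --> p.
  rewrite -[X in _ --> X]addr0; apply: cvgD; first exact: cvg_cst.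
  exact: (@cvg_pair _ _ _ _ (nbhs (0 : R)) (nbhs (0 : space3 R)) _ _ _ eps
    (fun=> 0) eps_cvg (@cvg_cst _ _ _ _ _)).
exact: (cvg_comp _ _ cp cg).
Qed.

Lemma shifted_test_cvg p : halfspace p -> phi n p @[n --> \oo] --> theta p * f p.
Proof.
move=> hp; under eq_fun do rewrite shifted_testE//.
have [pT|pT] := leP p.1 T1.
  by apply: cvgM; [exact: cvg_cst|exact: cvg_shift].
rewrite (ct.2 p); last by move=> []; rewrite leNgt pT.
by under eq_fun do rewrite mul0r; rewrite mul0r; exact: cvg_cst.
Qed.

Lemma shifted_test_derive_cvg v p : halfspace p ->
  'D_v (phi n) p @[n --> \oo] --> 'D_v theta p * f p + theta p * 'D_v f p.
Proof.
move=> hp; under eq_fun do rewrite shifted_test_derive//.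
have [pT|pT] := leP p.1 T1.
  apply: cvgD; apply: cvgM; first exact: cvg_cst.
  - exact: cvg_shift.
  - exact: cvg_cst.
  - exact: (cvg_shift (tame_derive v tf) hp pT).
have np' : ~ (p.1 <= T1 /\ cube r p.2) by move=> []; rewrite leNgt pT.
rewrite ((cutoff_derive v ct).2 p)// (ct.2 p)//.
by under eq_fun do rewrite !mul0r addr0; rewrite !mul0r addr0; exact: cvg_cst.
Qed.

Let bound_shift (g : spacetime R -> R) (th : spacetime R -> R) :
  tame T g -> cutoff T1 r th ->
  exists2 C, 0 <= C & forall n p, halfspace p -> `|th p * g (p + c n)| <= C.
Proof.
move=> tg cth; have [C C0 HC] := tame_bounded tg T2T.
have [D D0 HD] := cutoff_bound cth; exists (D * C); first exact: mulr_ge0.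
move=> n p hp; have [pT|pT] := leP p.1 T1; last first.
  rewrite (cth.2 p) ?mul0r ?normr0 ?mulr_ge0// => -[].
  by rewrite leNgt pT.
by rewrite normrM ler_pM ?HD ?HC//; exact: shift_slab.
Qed.

Lemma shifted_test_bound : exists2 C, 0 <= C &
  forall n p, halfspace p -> `|phi n p| <= C.
Proof.
have [C C0 HC] := bound_shift tf ct; exists C => // n p hp.
by rewrite shifted_testE//; exact: HC.
Qed.

Lemma shifted_test_derive_bound v : exists2 C, 0 <= C &
  forall n p, halfspace p -> `|'D_v (phi n) p| <= C.
Proof.
have [C C0 HC] := bound_shift tf (cutoff_derive v ct).
have [D D0 HD] := bound_shift (tame_derive v tf) ct.
exists (C + D) => [|n p hp]; first exact: addr_ge0.
rewrite shifted_test_derive// (le_trans (ler_normD _ _))// lerD//.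
  exact: HC.
exact: HD.
Qed.

Lemma shifted_test_initial n x : phi n (0, x) = theta (0, x) * f (eps n, x).
Proof.
rewrite /phi /shifted_test cE /= mulr0 add0r plateau1// mul1r.
by rewrite add0r.
Qed.

Lemma shifted_test_initial_cvg (f0 : space3 R -> R) x :
  (f (t, x) @[t --> 0^'+] --> f0 x) ->
  phi n (0, x) @[n --> \oo] --> theta (0, x) * f0 x.
Proof.
move=> ff0; under eq_fun do rewrite shifted_test_initial.
apply: cvgM; first exact: cvg_cst.
have := cvg_at_rightP; move=> H.
have [+ _] := H _ (fun t => f (t, x)) 0 (f0 x); move/(_ ff0 eps); apply; split => //.
Qed.

Lemma shifted_test_initial_bound : exists2 C, 0 <= C &
  forall n x, `|phi n (0, x)| <= C.
Proof.
have cK : compact (`[0, 0]%classic `*` cube r : set (spacetime R)).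
  exact: compact_slice.
have [D D0 HD] := continuous_compact_bound cK (smooth_continuous ct.1).
have [C C0 HC] := tame_bounded tf T2T.
exists (D * C) => [|n x]; first exact: mulr_ge0.
rewrite shifted_test_initial; have [xc|xc] := pselect (cube r x); last first.
  by rewrite (ct.2 (0, x)) ?mul0r ?normr0 ?mulr_ge0// => -[].
rewrite normrM ler_pM//; first by apply: HD; split => //=; rewrite in_itv/= lexx.
apply: HC; rewrite slabE /= eps0/=.
have := epsa n; have := a0; have := T10; rewrite /T2; lra.
Qed.

Lemma shifted_test_initial_out n x : ~ cube r x -> phi n (0, x) = 0.
Proof.
by move=> xc; rewrite shifted_test_initial (ct.2 (0, x)) ?mul0r// => -[].
Qed.

End ShiftedTests.

(** * Weak equations tested with a cutoff times a tame function *)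

Section TestFunctions.
Context {R : realType}.
Implicit Types (phi theta : spacetime R -> R).
Notation mu3 := (@leb3 R).
Notation mu4 := (@leb4 R).

Lemma test_cutoff phi D : test_fun D phi -> exists r, cutoff r r phi.
Proof.
move=> [sp [K [cK _ K0]]].
have [C1 C10 H1] := @continuous_compact_bound _ _ (fst : spacetime R -> R) K cK
  (fun p => cvg_fst).
have s4 : continuous (snd : spacetime R -> space3 R) by move=> p; exact: cvg_snd.
have f3 : continuous (fst : space3 R -> R * R) by move=> p; exact: cvg_fst.
have s3 : continuous (snd : space3 R -> R) by move=> p; exact: cvg_snd.
have f2 : continuous (fst : R * R -> R) by move=> p; exact: cvg_fst.
have s2 : continuous (snd : R * R -> R) by move=> p; exact: cvg_snd.
have c2 : continuous (fst \o (fst \o (snd : spacetime R -> space3 R))).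
  move=> p; apply: continuous_comp; last exact: f2.
  by apply: continuous_comp; [exact: s4|exact: f3].
have c3 : continuous (snd \o (fst \o (snd : spacetime R -> space3 R))).
  move=> p; apply: continuous_comp; last exact: s2.
  by apply: continuous_comp; [exact: s4|exact: f3].
have c4 : continuous (snd \o (snd : spacetime R -> space3 R)).
  by move=> p; apply: continuous_comp; [exact: s4|exact: s3].
have [C2 C20 H2] := continuous_compact_bound cK c2.
have [C3 C30 H3] := continuous_compact_bound cK c3.
have [C4 C40 H4] := continuous_compact_bound cK c4.
exists (C1 + C2 + C3 + C4); split => // p np; apply: K0 => Kp; apply: np.
have /ler_normlP[? ?] := H1 p Kp; have /ler_normlP[? ?] := H2 p Kp.
have /ler_normlP[? ?] := H3 p Kp; have /ler_normlP[? ?] := H4 p Kp.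
rewrite /cube /setX /= !in_itv/=.
by do ![split]; try (apply/andP; split); lra.
Qed.

Lemma cutoff_test phi r : cutoff r r phi ->
  (exists2 e : R, 0 < e & forall p, p.1 < e -> phi p = 0) -> test_fun halfspace phi.
Proof.
move=> cp [e e0 p0]; split; first by case: cp.
exists (`[e, r]%classic `*` cube r); split; first exact: compact_slice.
  move=> p [/=]; rewrite in_itv/= => /andP[ep _] _.
  by rewrite halfE (lt_le_trans e0).
move=> p np; have [|ep] := ltP p.1 e; first exact: p0.
apply: cp.2 => -[pr pc]; apply: np; split => //=.
by rewrite in_itv/= ep.
Qed.

Lemma smooth_measurable phi (A : set (spacetime R)) : smooth setT phi ->
  measurable (A : set (mspacetime R)) ->
  measurable_fun (A : set (mspacetime R)) phi.
Proof.
move=> sp mA; apply: (@measurable_funS _ _ _ _ setT) => //.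
by apply: (@continuous_measurable4 R setT) => [|x _]; [exact: openT|exact: smooth_continuous].
Qed.

Lemma cutoff_box T1 r phi p : T1 <= r -> cutoff T1 r phi -> halfspace p -> ~ box r p -> phi p = 0.
Proof.
move=> Tr cp hp np; apply: cp.2 => -[pT pc]; apply: np; split => //=.
by move: hp; rewrite halfE in_itv/= => -> /=; exact: le_trans Tr.
Qed.

Lemma cutoff_intg T1 r theta (g : spacetime R -> R) : L1loc g -> cutoff T1 r theta -> T1 <= r ->
  intg mu4 halfspace (fun p => g p * theta p).
Proof.
move=> lg ct Tr; have [C C0 HC] := cutoff_bound ct.
have mB := @measurable_box R r.
apply: (intg_ext mB (@measurable_half R) (@box_half R r)).
  by move=> p hp np; rewrite (cutoff_box Tr ct hp np) mulr0.
have ig : intg mu4 (box r) (fun p => C * `|g p|).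
  apply: intgZ => //; have := integrable_norm (lg r).
  by apply: intg_eq => //.
apply: intg_le ig _ => //.
  apply: measurable_funM; first exact: intg_measurable (lg r).
  by apply: smooth_measurable => //; case: ct.
move=> p bp; rewrite normrM mulrC ler_wpM2r// HC//.
exact: box_half bp.
Qed.

(** Dominated convergence on a box, with the dominating function C |g|. *)
Lemma test_limit (T r : R) (g : spacetime R -> R) (psi_ : (spacetime R -> R)^nat) (psi : spacetime R -> R) C :
  L1loc g -> 0 <= C ->
  (forall n p, halfspace p -> ~ box r p -> psi_ n p = 0) ->
  (forall n, measurable_fun (box r : set (mspacetime R)) (psi_ n)) ->
  (forall n p, halfspace p -> `|psi_ n p| <= C) ->
  (forall p, halfspace p -> psi_ n p @[n --> \oo] --> psi p) ->
  (forall p, halfspace p -> ~ slab T p -> psi p = 0) ->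
  intg mu4 (slab T) (fun p => g p * psi p) /\
  \int[mu4]_(p in halfspace) (g p * psi_ n p) @[n --> \oo] -->
  \int[mu4]_(p in slab T) (g p * psi p).
Proof.
move=> lg C0 out mpsi bpsi cpsi zpsi.
have mB := @measurable_box R r; have mH := @measurable_half R; have mS := @measurable_slab R T.
have BH := @box_half R r.
have psi0 p : halfspace p -> ~ box r p -> psi p = 0.
  move=> hp np; have := cpsi p hp; under eq_fun do rewrite out//.
  by move=> /cvg_lim <-//; rewrite lim_cst.
have ig : intg mu4 (box r) (fun p => C * `|g p|).
  apply: intgZ => //; have := integrable_norm (lg r).
  by apply: intg_eq => //.
have [ip cp] := @cvg_Rintegral _ _ R mu4 (box r) (fun n p => g p * psi_ n p)
  (fun p => g p * psi p) (fun p => C * `|g p|) mB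
  (fun n => measurable_funM (intg_measurable (lg r)) (mpsi n))
  (fun p bp => cvgM (@cvg_cst _ _ _ _ _) (cpsi p (BH p bp))) ig
  (fun n p bp => ltac:(by rewrite normrM mulrC; apply: ler_wpM2r => //; exact: bpsi (BH p bp))).
have ih : intg mu4 halfspace (fun p => g p * psi p).
  apply: (intg_ext mB mH BH) ip => p hp np; by rewrite psi0// mulr0.
split; first exact: (intg_sub mH mS (@slab_half R T)).
rewrite -(@Rintegral_ext _ _ _ mu4 (slab T) halfspace); last 2 first.
- exact: slab_half.
- by move=> p hp np; rewrite zpsi// mulr0.
rewrite (@Rintegral_ext _ _ _ mu4 (box r) halfspace) => [|//|p hp np]; last by rewrite psi0// mulr0.
rewrite (_ : (fun n => _) = (fun n => \int[mu4]_(p in box r) (g p * psi_ n p)))//.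
apply/funext => n; apply: Rintegral_ext => // p hp np.
by rewrite out// mulr0.
Qed.

End TestFunctions.

Lemma cvg_sum_ord {R : realType} n (u : 'I_n -> nat -> R) (l : 'I_n -> R) :
  (forall i, u i k @[k --> \oo] --> l i) ->
  \sum_(i < n) u i k @[k --> \oo] --> \sum_(i < n) l i.
Proof.
elim: n u l => [|n ih] u l ul.
  by under eq_fun do rewrite big_ord0; rewrite big_ord0; exact: cvg_cst.
under eq_fun do rewrite big_ord_recr; rewrite big_ord_recr /=.
apply: cvgD; last exact: ul.
exact: (ih (fun i => u (widen_ord (leqnSn n) i))).
Qed.

Section WeakForms.
Context {R : realType}.
Implicit Types (phi theta f a bt : spacetime R -> R) (bx : 'I_3 -> spacetime R -> R)
  (w : space3 R -> R).
Notation mu3 := (@leb3 R).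
Notation mu4 := (@leb4 R).

(** The evolution equations and the relations defining the weak derivatives
    have this shape component by component; w is the initial value, or 0 if
    none enters. *)
Definition weak_form a bt bx w := forall phi, test_fun setT phi ->
  \int[mu4]_(p in halfspace) (a p * phi p + bt p * 'D_dirt phi p
    + \sum_(i < 3) bx i p * 'D_(dirx i) phi p) =
  - (\int[mu3]_x (w x * phi (0, x))).

Definition coef_loc a bt bx := [/\ L1loc a, L1loc bt & forall i, L1loc (bx i)].

Lemma coef_intg a bt bx T1 r theta : coef_loc a bt bx -> cutoff T1 r theta -> T1 <= r ->
  [/\ intg mu4 halfspace (fun p => a p * theta p),
      intg mu4 halfspace (fun p => bt p * 'D_dirt theta p) &
      forall i, intg mu4 halfspace (fun p => bx i p * 'D_(dirx i) theta p)].
Proof.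
move=> [la lt lx] ct Tr; split => [||i]; apply: cutoff_intg Tr => //; exact: cutoff_derive.
Qed.

Lemma weak_form_split a bt bx T1 r theta : coef_loc a bt bx -> cutoff T1 r theta -> T1 <= r ->
  \int[mu4]_(p in halfspace) (a p * theta p + bt p * 'D_dirt theta p
    + \sum_(i < 3) bx i p * 'D_(dirx i) theta p) =
  \int[mu4]_(p in halfspace) (a p * theta p) +
  \int[mu4]_(p in halfspace) (bt p * 'D_dirt theta p) +
  \sum_(i < 3) \int[mu4]_(p in halfspace) (bx i p * 'D_(dirx i) theta p).
Proof.
move=> cl ct Tr; have [ia it ix] := coef_intg cl ct Tr.
have mH := @measurable_half R.
have H := has_intD mH (has_intD mH (conj ia erefl) (conj it erefl))
  (has_int_sum mH (fun i => conj (ix i) erefl)).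
by case: H.
Qed.

(** The integrand of a weak form for the test function theta * f, with its
    derivatives expanded by the product rule. *)
Definition tested a bt bx theta f (p : spacetime R) : R :=
  a p * (theta p * f p)
  + bt p * ('D_dirt theta p * f p + theta p * 'D_dirt f p)
  + \sum_(i < 3) bx i p * ('D_(dirx i) theta p * f p + theta p * 'D_(dirx i) f p).

(** The product theta * f is defined for positive times only, so it is reached
    as the limit of the shifted test functions; their values at t = 0 converge
    to theta (0, .) * f0. *)
Lemma weak_form_tested a bt bx w (T T1 r : R) theta f (f0 : space3 R -> R) :
  0 < T1 -> T1 < T -> T <= r -> cutoff T1 r theta -> tame T f ->
  coef_loc a bt bx -> (w = cst 0 \/ (forall r, intg mu3 (cube r) w) /\
    forall x, f (t, x) @[t --> 0^'+] --> f0 x) ->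
  weak_form a bt bx w ->
  has_int mu4 (slab T) (tested a bt bx theta f)
    (- \int[mu3]_x (w x * (theta (0, x) * f0 x))).
Proof.
move=> T10 T1T Tr ct tf cl w0 wf.
have T1r : T1 <= r by rewrite (le_trans (ltW T1T)).
have [la lt lx] := cl.
pose phi := shifted_test T T1 theta f.
have tphi n : test_fun setT (phi n) by exact: (shifted_test_test T1T ct tf).
have mB := @measurable_box R r.
have mS := @measurable_slab R T.
have th0 th p : cutoff T1 r th -> halfspace p -> ~ slab T p -> th p = 0.
  move=> cth; rewrite halfE slabE => p0 pT; apply: cth.2 => -[pT1 _]; apply: pT.
  by rewrite p0 (le_lt_trans pT1).
have z0 p : halfspace p -> ~ slab T p -> theta p * f p = 0.
  by move=> hp np; rewrite (th0 theta p ct hp np) mul0r.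
have z1 v p : halfspace p -> ~ slab T p ->
    'D_v theta p * f p + theta p * 'D_v f p = 0.
  move=> hp np.
  by rewrite (th0 _ p ct hp np) (th0 _ p (cutoff_derive v ct) hp np) !mul0r addr0.
have [C0 C00 HC0] := shifted_test_bound T1T ct tf.
have [ia ca] := @test_limit R T r a phi (fun p => theta p * f p) C0 la C00
  (fun n p hp np => (shifted_test_out T1T Tr ct tf n 0 hp np).1)
  (fun n => smooth_measurable (tphi n).1 mB) HC0
  (fun p hp => shifted_test_cvg T1T ct tf hp)
  z0.
have lim1 (v : spacetime R) (g : spacetime R -> R) : L1loc g ->
   intg mu4 (slab T) (fun p => g p * ('D_v theta p * f p + theta p * 'D_v f p)) /\
  \int[mu4]_(p in halfspace) (g p * 'D_v (phi n) p) @[n --> \oo] -->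
  \int[mu4]_(p in slab T) (g p * ('D_v theta p * f p + theta p * 'D_v f p)).
  move=> lg; have [C1 C10 HC1] := shifted_test_derive_bound T1T ct tf v.
  exact: (@test_limit R T r g (fun n => 'D_v (phi n)) _ C1 lg C10
  (fun n p hp np => (shifted_test_out T1T Tr ct tf n v hp np).2)
  (fun n => smooth_measurable (smooth_derive v (tphi n).1) mB) HC1
  (fun p hp => shifted_test_derive_cvg T1T ct tf hp)
  (z1 v)).
have [it ctt] := lim1 dirt bt lt.
have ix i := (lim1 (dirx i) (bx i) (lx i)).1.
have cx i := (lim1 (dirx i) (bx i) (lx i)).2.
have H := has_intD mS (has_intD mS (conj ia erefl) (conj it erefl))
  (has_int_sum mS (fun i => conj (ix i) erefl)).
apply: (has_int_eq mS H) => //.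
have cL := cvgD (cvgD ca ctt) (cvg_sum_ord cx).
have cR : \int[mu3]_x (w x * phi n (0, x)) @[n --> \oo] -->
    \int[mu3]_x (w x * (theta (0, x) * f0 x)).
  case: w0 => [->|[w0 ff0]].
    rewrite /Rintegral.
    under eq_fun do (under eq_integral do rewrite /= mul0r).
    by under eq_integral do rewrite /= mul0r; exact: cvg_cst.
  have [C2 C20 HC2] := shifted_test_initial_bound T10 T1T ct tf.
  have cphi (x : space3 R) : phi n (0, x) @[n --> \oo] --> theta (0, x) * f0 x.
    have := @shifted_test_initial_cvg R T T1 theta f T1T f0 x (ff0 x); exact.
  have mC := @measurable_cube R r.
  have cc : forall x, cube r x -> w x * phi n (0, x) @[n --> \oo] --> w x * (theta (0, x) * f0 x).
    by move=> x _; apply: cvgM; [exact: cvg_cst|exact: cphi].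
  have ig : intg mu3 (cube r) (fun x => C2 * `|w x|).
    apply: intgZ => //; have := integrable_norm (w0 r).
    by apply: intg_eq => //.
  have ext (h : space3 R -> R) : (forall x, ~ cube r x -> h x = 0) ->
     \int[mu3]_x h x = \int[mu3]_(x in cube r) h x.
    by move=> h0; apply: Rintegral_ext => // x _ /h0.
  rewrite (ext (fun x => w x * (theta (0, x) * f0 x))); last first.
    by move=> x xc; rewrite (ct.2 (0, x)) ?mul0r ?mulr0// => -[].
  rewrite (_ : (fun n => _) = (fun n => \int[mu3]_(x in cube r) (w x * phi n (0, x)))); last first.
    apply/funext => n; apply: ext => x xc.
    by rewrite /phi (shifted_test_initial_out T f ct n xc) mulr0.
  have mm n : measurable_fun (cube r : set (mspace R)) (fun x => w x * phi n (0, x)).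
    apply: measurable_funM; first exact: intg_measurable (w0 r).
    apply: measurable_funTS; apply: continuous_measurable3 => x.
    have cp : {for x, continuous (fun y : space3 R => (0, y) : spacetime R)}.
      by apply: (@cvg_pair _ _ _ _ (nbhs (0 : R)) (nbhs x)); [exact: cvg_cst|exact: cvg_id].
    have cphin : {for ((0, x) : spacetime R), continuous (phi n)}.
      exact: (smooth_continuous (tphi n).1).
    exact: (continuous_comp cp cphin).
  have bb n x : cube r x -> `|w x * phi n (0, x)| <= C2 * `|w x|.
    by move=> xc; rewrite normrM mulrC; apply: ler_wpM2r => //; exact: HC2.
  exact: (@cvg_Rintegral _ _ R mu3 (cube r) _ _ _ mC mm cc ig bb).2.
rewrite -(cvg_lim (@norm_hausdorff _ _) (cvgN cR)); apply/esym/cvg_lim => //.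
have E : - (fun n => \int[mu3]_x (w x * phi n (0, x))) = (fun n =>
    \int[mu4]_(p in halfspace) (a p * phi n p) +
    \int[mu4]_(p in halfspace) (bt p * 'D_dirt (phi n) p) +
    \sum_(i < 3) \int[mu4]_(p in halfspace) (bx i p * 'D_(dirx i) (phi n) p)).
  apply/funext => n; rewrite fctE; have [rn cn] := test_cutoff (tphi n).
  by rewrite -(wf _ (tphi n)) (weak_form_split cl cn (lexx _)).
rewrite E; exact: cL.
Qed.

End WeakForms.

(** * From test functions on the half-space to test functions up to the initial time *)

Section HalfToAll.
Context {R : realType}.
Implicit Types (phi theta f a bt : spacetime R -> R) (bx : 'I_3 -> spacetime R -> R).
Notation mu3 := (@leb3 R).
Notation mu4 := (@leb4 R).

Lemma derive_fst_dirx (g : R -> R) i (p : spacetime R) :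
  'D_(dirx i) (fun q : spacetime R => g q.1) p = 0.
Proof.
rewrite /derive (_ : (fun h : R => _) = cst 0) ?lim_cst//.
apply/funext => h.
transitivity (h^-1 *: (g (h *: 0 + p.1) - g p.1)); first by [].
by rewrite scaler0 add0r subrr scaler0.
Qed.

(** A test function phi is multiplied by a smooth step in n t, which does not
    affect the space derivatives. Since no time derivative of phi occurs, the
    limit n --> oo produces no boundary term at t = 0. *)
Lemma weak_form_half a bx : L1loc a -> (forall i, L1loc (bx i)) ->
  (forall phi, test_fun halfspace phi ->
    \int[mu4]_(p in halfspace) (a p * phi p) +
    \sum_(i < 3) \int[mu4]_(p in halfspace) (bx i p * 'D_(dirx i) phi p) = 0) ->
  weak_form a (cst 0) bx (cst 0).
Proof.
move=> la lx H phi tphi; have [r cphi] := test_cutoff tphi.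
have lt : L1loc (cst 0 : spacetime R -> R) by exact/L2loc_L1loc/L2loc_cst.
rewrite (weak_form_split (And3 la lt lx) cphi (lexx _)).
pose q (n : nat) (p : spacetime R) : R := plateau (n.+1%:R * p.1 + -1).
have sq n : smooth setT (q n).
  apply: (@smooth_comp _ _ setT plateau (fun p : spacetime R => n.+1%:R * p.1 + -1)).
  - exact: openT.
  - exact: smooth_plateau.
  - apply: (@smooth_comp _ _ setT (fun s => n.+1%:R * s + -1) fst).
    + exact: openT.
    + exact: smooth_affine.
    + exact: smooth_fst.
have sphi : smooth setT phi by case: tphi.
pose psi n := q n * phi.
have cpsi n : cutoff r r (psi n).
  split; first by apply: smoothM => //; exact: openT.
  by move=> p np; rewrite /psi fctE cphi.2// mulr0.
have tpsi n : test_fun halfspace (psi n).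
  apply: cutoff_test (cpsi n) _; exists (n.+1%:R^-1); first by rewrite invr_gt0.
  move=> p pn; rewrite /psi fctE /q plateau0 ?mul0r//.
  rewrite subr_le0 -ler_pdivlMl ?mulr1 ?ltW// ltr0n//.
have dpsi n i p : 'D_(dirx i) (psi n) p = q n p * 'D_(dirx i) phi p.
  rewrite deriveM; [|exact: smooth_derivable (sq n) I|exact: smooth_derivable sphi I].
  by rewrite (derive_fst_dirx (fun s => plateau (n.+1%:R * s + -1))) scaler0 addr0.
have q1 n p : `|q n p| <= 1.
  by have /andP[q0 q1] := plateau_itv (n.+1%:R * p.1 + -1); rewrite ger0_norm.
have cq p : halfspace p -> q n p @[n --> \oo] --> (1 : R).
  rewrite halfE => p0; apply: cvg_near_cst; near=> n.
  apply/eqP; rewrite /q plateau1// lerBrDr.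
  rewrite -ler_pdivrMr//.
  have : 2 / p.1 <= n%:R by near: n; exact: nbhs_infty_ger.
  move=> h; rewrite (le_trans _ (le_trans h _)) ?ler_nat//.
have lim (g th : spacetime R -> R) : L1loc g -> cutoff r r th ->
   \int[mu4]_(p in halfspace) (g p * (q n p * th p)) @[n --> \oo] -->
   \int[mu4]_(p in halfspace) (g p * th p).
  move=> lg cth; have [C C0 HC] := cutoff_bound cth.
  have [|||||_ cv] := @test_limit R (r + 1) r g (fun n p => q n p * th p) th C lg C0.
  - by move=> n p hp np; rewrite (cutoff_box (lexx _) cth hp np) mulr0.
  - move=> n; apply: measurable_funM; apply: smooth_measurable => //.
    + exact: measurable_box.
    + by case: cth.
    + exact: measurable_box.
  - move=> n p hp; rewrite normrM -[leRHS]mul1r; apply: ler_pM => //; exact: HC.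
  - move=> p hp; rewrite -[X in _ --> X]mul1r; apply: cvgM; first exact: cq.
    exact: cvg_cst.
  - move=> p; rewrite halfE slabE => p0 np; apply: cth.2 => -[pr _]; apply: np.
    by rewrite p0 (le_lt_trans pr)// ltrDl.
  - rewrite (@Rintegral_ext _ _ _ mu4 (slab (r + 1)) halfspace)//.
      exact: slab_half.
    move=> p; rewrite halfE slabE => p0 np; rewrite cth.2 ?mulr0// => -[pr _]; apply: np.
    by rewrite p0 (le_lt_trans pr)// ltrDl.
have c1 := lim a phi la cphi.
have cx i := lim (bx i) ('D_(dirx i) phi) (lx i) (cutoff_derive _ cphi).
have L0 : \int[mu4]_(p in halfspace) (a p * phi p) +
    \sum_(i < 3) \int[mu4]_(p in halfspace) (bx i p * 'D_(dirx i) phi p) = 0.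
  move: c1 (cvg_sum_ord cx).
  set u := (X in X @ _ --> _ -> _); set v := (X in _ -> X @ _ --> _ -> _).
  move=> cu cv.
  have E0 : u \+ v = cst 0.
    apply/funext => n; rewrite -[RHS](H _ (tpsi n)) /u /v; congr (_ + _).
    by apply: eq_bigr => i _; apply: eq_Rintegral => p _; rewrite dpsi.
  have : (u \+ v) n @[n --> \oo] --> (\int[mu4]_(p in halfspace) (a p * phi p) +
    \sum_(i < 3) \int[mu4]_(p in halfspace) (bx i p * 'D_(dirx i) phi p)).
    exact: cvgD.
  by rewrite E0 => /(cvg_lim (@norm_hausdorff _ _)) <-; rewrite lim_cst.
have Z1 : \int[mu4]_(p in halfspace) (cst 0 p * 'D_dirt phi p) = 0.
  rewrite /Rintegral; under eq_integral do rewrite /= mul0r.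
  by rewrite integral0.
have Z2 : - (\int[mu3]_x (cst 0 x * phi (0, x))) = 0.
  rewrite /Rintegral; under eq_integral do rewrite /= mul0r.
  by rewrite integral0 oppr0.
have add3 (x y z u : R) : x + z = 0 -> y = 0 -> u = 0 -> x + y + z = u.
  by move=> xz -> ->; rewrite addr0.
exact: add3 L0 Z1 Z2.
Unshelve. all: by end_near. Qed.

End HalfToAll.

(** * Algebra of vectors with three components *)

Section VectorAlgebra.
Context {R : realType}.
Notation V := ('I_3 -> R).
Implicit Types (a b c w u p : V).

(** The components of a row vector v are the function v 0, so that dot and
    cross become d3 and c3 without any conversion. *)
Definition d3 a b : R := \sum_(k < 3) a k * b k.
Definition c3 a b : V := fun k => a (k + 1) * b (k + 2%:R) - a (k + 2%:R) * b (k + 1).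
Definition curl3 (D : 'I_3 -> V) : V := fun k => D (k + 1) (k + 2%:R) - D (k + 2%:R) (k + 1).

Definition i0 : 'I_3 := @Ordinal 3 0 isT.
Definition i1 : 'I_3 := @Ordinal 3 1 isT.
Definition i2 : 'I_3 := @Ordinal 3 2 isT.

Lemma sum3E (f : 'I_3 -> R) : \sum_(k < 3) f k = f i0 + f i1 + f i2.
Proof.
rewrite !big_ord_recl big_ord0 addr0 addrA.
by congr (f _ + f _ + f _); exact/val_inj.
Qed.

Lemma d3E a b : d3 a b = a i0 * b i0 + a i1 * b i1 + a i2 * b i2.
Proof. exact: sum3E. Qed.

Lemma ord3_add : (i0 + 1 = i1) * (i1 + 1 = i2) * (i2 + 1 = i0) *
  (i0 + 2%:R = i2) * (i1 + 2%:R = i0) * (i2 + 2%:R = i1).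
Proof. by do !split; exact/val_inj. Qed.

Lemma c3E a b : (c3 a b i0 = a i1 * b i2 - a i2 * b i1) *
  (c3 a b i1 = a i2 * b i0 - a i0 * b i2) * (c3 a b i2 = a i0 * b i1 - a i1 * b i0).
Proof. by rewrite /c3 !ord3_add. Qed.

Lemma curl3E D : (curl3 D i0 = D i1 i2 - D i2 i1) *
  (curl3 D i1 = D i2 i0 - D i0 i2) * (curl3 D i2 = D i0 i1 - D i1 i0).
Proof. by rewrite /curl3 !ord3_add. Qed.

Lemma d3_ge0 a : 0 <= d3 a a.
Proof. by apply: sumr_ge0 => k _; rewrite -expr2 sqr_ge0. Qed.

Lemma d3_cross_le a b : d3 (c3 a b) (c3 a b) <= d3 a a * d3 b b.
Proof.
rewrite !d3E !c3E -subr_ge0.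
have -> : forall x1 x2 x3 y1 y2 y3 : R,
  (x1 * x1 + x2 * x2 + x3 * x3) * (y1 * y1 + y2 * y2 + y3 * y3) -
  ((x2 * y3 - x3 * y2) * (x2 * y3 - x3 * y2) +
   (x3 * y1 - x1 * y3) * (x3 * y1 - x1 * y3) +
   (x1 * y2 - x2 * y1) * (x1 * y2 - x2 * y1)) = (x1 * y1 + x2 * y2 + x3 * y3) ^+ 2.
  by move=> *; ring.
exact: sqr_ge0.
Qed.

Lemma d3_young a b : - (d3 a a + d3 b b) <= 2 * d3 a b.
Proof.
rewrite !d3E.
have := sqr_ge0 (a i0 + b i0); have := sqr_ge0 (a i1 + b i1); have := sqr_ge0 (a i2 + b i2).
rewrite !expr2; lra.
Qed.

Lemma d3_young_cross (s : R) a b c (P : R) : 0 < s -> d3 b b <= P ->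
  - (s * d3 a a + s^-1 * (P * d3 c c)) <= 2 * d3 a (c3 b c).
Proof.
move=> s0 bP.
have h := d3_young (fun k => s * a k) (c3 b c).
have h2 := d3_cross_le b c.
have h3 : d3 b b * d3 c c <= P * d3 c c by rewrite ler_wpM2r// d3_ge0.
have e1 : d3 (fun k => s * a k) (fun k => s * a k) = s ^+ 2 * d3 a a by rewrite !d3E; ring.
have e2 : d3 (fun k => s * a k) (c3 b c) = s * d3 a (c3 b c) by rewrite !d3E; ring.
rewrite e1 e2 in h.
have h4 : - (s ^+ 2 * d3 a a + P * d3 c c) <= 2 * (s * d3 a (c3 b c)).
  by apply: le_trans h; rewrite lerN2 lerD2l (le_trans h2).
rewrite -(ler_pM2l s0).
have -> : s * - (s * d3 a a + s^-1 * (P * d3 c c)) = - (s ^+ 2 * d3 a a + P * d3 c c).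
  by field; rewrite gt_eqF.
by rewrite mulrCA in h4.
Qed.

(** The next four identities collect the coefficients of the weight in the
    tested equations; dl is the difference of the magnetizations. Everything
    of first order in the difference of the solutions cancels, and what
    remains is quadratic in it. *)
Lemma relative_space w u p dl Wi ui uii pi uti :
  (forall k, dl k = w k - u k) -> (forall k, uti k = c3 pi u k + c3 p ui k) ->
  d3 Wi uti - d3 (c3 w Wi) pi - d3 Wi (c3 p ui)
   - (d3 dl (c3 pi ui) + d3 dl (c3 p uii))
  = - d3 (fun k => Wi k - ui k) (c3 pi dl) - d3 dl (c3 p uii).
Proof. by move=> hd hu; rewrite !d3E !hu !c3E !hd; ring. Qed.

Lemma relative_time w u p dl L ut H1 Wt H2 : (forall k, dl k = w k - u k) ->
  (forall k, ut k = c3 p u k) -> (forall k, H1 k = (ut k - p k) / 2 - L k) ->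
  - d3 H2 ut - d3 Wt H1 - d3 Wt L + d3 ut Wt
   - 2^-1 * (d3 Wt p + d3 (c3 w Wt) p) + d3 (c3 w H2) p - d3 dl (c3 p L)
  = - 2^-1 * d3 (fun k => Wt k - ut k) (c3 p dl) +
    d3 (fun k => H2 k - H1 k) (c3 p dl).
Proof. by move=> hd hu hH; rewrite !d3E !hH !hu !c3E !hd; field. Qed.

Lemma distance_time w u p dl L ut H1 Wt H2 : (forall k, dl k = w k - u k) ->
  (forall k, ut k = c3 p u k) -> (forall k, H1 k = (ut k - p k) / 2 - L k) ->
  d3 w ut - d3 (c3 w Wt) u + 2 * d3 (c3 w H2) u + 2 * d3 w (c3 L u)
  = - d3 (fun k => Wt k - ut k) (c3 u dl) +
    2 * d3 (fun k => H2 k - H1 k) (c3 u dl).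
Proof. by move=> hd hu hH; rewrite !d3E !hH !hu !c3E !hd; field. Qed.

Lemma distance_space w u dl Wi ui : (forall k, dl k = w k - u k) ->
  - d3 (c3 w Wi) ui + d3 Wi (c3 ui u) = - d3 (fun k => Wi k - ui k) (c3 ui dl).
Proof. by move=> hd; rewrite !d3E !c3E !hd; ring. Qed.

Definition dcurl (F : V) (k i : 'I_3) : R :=
  (i == k + 1)%:R * F (k + 2%:R) - (i == k + 2%:R)%:R * F (k + 1).

Lemma sum_delta3 (j : 'I_3) (x : V) : \sum_(i < 3) (i == j)%:R * x i = x j.
Proof.
rewrite (bigD1 j)//= eqxx mul1r big1 ?addr0// => i /negbTE ->.
by rewrite mul0r.
Qed.

Lemma sum_dcurl (F g : V) k : \sum_(i < 3) dcurl F k i * g i =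
  g (k + 1) * F (k + 2%:R) - g (k + 2%:R) * F (k + 1).
Proof.
rewrite /dcurl; under eq_bigr do rewrite mulrBl.
rewrite sumrB; under eq_bigr do rewrite -mulrA.
rewrite (sum_delta3 _ (fun i => F (k + 2%:R) * g i)).
under eq_bigr do rewrite -mulrA.
rewrite (sum_delta3 _ (fun i => F (k + 1) * g i)); ring.
Qed.

Lemma faraday_sum (M H E f ft thx : V) (fx : 'I_3 -> V) (th tht : R) :
  \sum_(k < 3) (- M k * (th * f k) + H k * (tht * f k + th * ft k)
    + \sum_(i < 3) dcurl E k i * (thx i * f k + th * fx i k)) =
  d3 H (fun k => tht * f k + th * ft k)
     - d3 E (fun k => th * curl3 fx k + c3 thx f k) - th * d3 M f.
Proof.
rewrite sum3E !(sum_dcurl _ (fun i => thx i * f _ + th * fx i _)).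
by rewrite !ord3_add !d3E !c3E !curl3E; ring.
Qed.

Lemma ampere_sum (H E f ft thx : V) (fx : 'I_3 -> V) (th tht : R) :
  \sum_(k < 3) (0 * (th * f k) + E k * (tht * f k + th * ft k)
    + \sum_(i < 3) - dcurl H k i * (thx i * f k + th * fx i k)) =
  d3 E (fun k => tht * f k + th * ft k)
     + d3 H (fun k => th * curl3 fx k + c3 thx f k).
Proof.
under eq_bigr do under eq_bigr do rewrite mulNr.
under eq_bigr do rewrite sumrN.
rewrite sum3E !(sum_dcurl _ (fun i => thx i * f _ + th * fx i _)).
by rewrite !ord3_add !d3E !c3E !curl3E; ring.
Qed.

Lemma landau_sum (w M H f thx : V) (W fx : 'I_3 -> V) (th : R) :
  \sum_(k < 3) ((M k + c3 w M k - 2 * c3 w H k) * (th * f k)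
    + \sum_(i < 3) 2 * c3 w (W i) k * (thx i * f k + th * fx i k)) =
  th * (d3 M f + d3 (c3 w M) f - 2 * d3 (c3 w H) f
      + \sum_(i < 3) 2 * d3 (c3 w (W i)) (fx i))
    + \sum_(i < 3) 2 * thx i * d3 (c3 w (W i)) f.
Proof. by rewrite !sum3E !d3E; ring. Qed.

Lemma gradm_sum (W w f fx : V) (th thi : R) :
  \sum_(k < 3) (W k * (th * f k) + w k * (thi * f k + th * fx k)) =
  th * (d3 W f + d3 w fx) + thi * d3 w f.
Proof. by rewrite sum3E !d3E; ring. Qed.

Lemma trace_sum (M w f ft : V) (th tht : R) :
  \sum_(k < 3) (M k * (th * f k) + w k * (tht * f k + th * ft k)) =
  tht * d3 w f + th * (d3 w ft + d3 M f).
Proof. by rewrite sum3E !d3E; ring. Qed.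

Lemma mixed_sum (W w M f ft fi fti fit th tht thi thti thit : R) :
  thit = thti -> fit = fti ->
  W * (tht * f) + w * (thit * f + tht * fi) +
  (W * (th * ft) + w * (thi * ft + th * fit)) +
  - (M * (thi * f) + w * (thti * f + thi * ft) +
     (M * (th * fi) + w * (tht * fi + th * fti))) =
  W * (tht * f + th * ft) - M * (thi * f + th * fi).
Proof. by move=> -> ->; ring. Qed.

End VectorAlgebra.

(** * The equations satisfied by a weak solution *)

Section WeakSolution.
Context {R : realType}.
Notation mu3 := (@leb3 R).
Notation mu4 := (@leb4 R).
Variables (m E H : spacetime R -> vec R) (Dm : 'I_3 -> spacetime R -> vec R)
  (mt : spacetime R -> vec R) (m0 E0 H0 : space3 R -> vec R).
Hypothesis ws : weak_solution_with m E H Dm mt m0 E0 H0.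

Lemma weak_mt_L2loc k : L2loc (fun p => mt p 0 k).
Proof.
by apply: L2loc_slab => T T0; apply: L2_slab_intg; exact: (weak_dtm_L2 ws).
Qed.

Lemma weak_Dm_L2loc i k : L2loc (fun p => Dm i p 0 k).
Proof.
apply: L2loc_slab => T T0; apply: LinftyL2_intg => //.
exact: (weak_gradm_LinftyL2 ws).
Qed.

Lemma weak_E_L2loc k : L2loc (fun p => E p 0 k).
Proof.
apply: L2loc_slab => T T0; apply: LinftyL2_intg => //.
exact: (weak_E_LinftyL2 ws).
Qed.

Lemma weak_H_L2loc k : L2loc (fun p => H p 0 k).
Proof.
apply: L2loc_slab => T T0; apply: LinftyL2_intg => //.
exact: (weak_H_LinftyL2 ws).
Qed.

Lemma weak_m_measurable T k : 0 < T ->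
  measurable_fun (slab T : set (mspacetime R)) (fun p => m p 0 k).
Proof.
move=> T0; have := weak_m_Linfty ws T0 => /(_ k); exact: L2_slab_measurable.
Qed.

Lemma weak_m_L2loc k : L2loc (fun p => m p 0 k).
Proof.
move=> r; have [r0|r0] := leP r (-1).
  have -> : box r = set0 :> set (mspacetime R).
    by rewrite -subset0 => p; apply: box_neg; rewrite (le_trans r0).
  by split; [exact: measurable_fun_set0|exact: integrable_set0].
have mm : measurable_fun (box r : set (mspacetime R)) (fun p => m p 0 k).
  by apply: sub_box_measurable; apply: weak_m_measurable; rewrite -ltrBlDr sub0r.
split => //; apply: intg_le_ae (intg_cst_box r 1) _ => //.
- exact: measurable_box.
- exact: measurable_funX.
- apply: (@filterS _ _ (ae_filter_ringOfSetsType mu4)) (weak_m_unit ws) => p up bp.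
  by rewrite ger0_norm ?sqr_ge0//= -(up (box_half bp)) sqr_le_sqnorm.
Qed.

Lemma L1loc0 : L1loc (cst 0 : spacetime R -> R).
Proof. exact/L2loc_L1loc/L2loc_cst. Qed.

Lemma crossE (u v : vec R) k : cross u v 0 k =
  u 0 (k + 1) * v 0 (k + 2%:R) - u 0 (k + 2%:R) * v 0 (k + 1).
Proof. by rewrite mxE. Qed.

Lemma L1loc_cross (u v : spacetime R -> vec R) k :
  (forall j, L2loc (fun p => u p 0 j)) -> (forall j, L2loc (fun p => v p 0 j)) ->
  L1loc (fun p => cross (u p) (v p) 0 k).
Proof.
move=> lu lv; under eq_fun do rewrite crossE.
by apply: L1locD; [exact: L2locM|apply: L1locN; exact: L2locM].
Qed.

(** The coefficient of the i-th derivative of phi in the k-th component of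
    grad phi x F. *)
Definition curl_coef (F : spacetime R -> vec R) (k i : 'I_3) (p : spacetime R) : R :=
  dcurl (F p 0) k i.

Lemma L1locZ c (f : spacetime R -> R) : L1loc f -> L1loc (fun p => c * f p).
Proof. by move=> lf r; apply: intgZ; [exact: measurable_box|exact: lf]. Qed.

Lemma L1loc_curl_coef (F : spacetime R -> vec R) k i : (forall j, L2loc (fun p => F p 0 j)) ->
  L1loc (curl_coef F k i).
Proof.
move=> lF; apply: L1locD; first exact: (L1locZ _ (L2loc_L1loc (lF _))).
exact: (L1locN (L1locZ _ (L2loc_L1loc (lF _)))).
Qed.

Lemma curl_coefE (F : spacetime R -> vec R) k phi p :
  \sum_(i < 3) curl_coef F k i p * 'D_(dirx i) phi p =
  cross (grad dirx phi p) (F p) 0 k.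
Proof. by rewrite crossE !mxE; exact: (sum_dcurl (F p 0) (fun i => 'D_(dirx i) phi p)). Qed.

Lemma coef_cross_intg (F : spacetime R -> vec R) k phi : test_fun setT phi ->
  (forall j, L2loc (fun p => F p 0 j)) ->
  intg mu4 halfspace (fun p => cross (grad dirx phi p) (F p) 0 k).
Proof.
move=> /test_cutoff[r cphi] lF.
have mH := @measurable_half R.
have H1 := has_int_sum mH (fun i => conj (cutoff_intg (L1loc_curl_coef k i lF) (cutoff_derive (dirx i) cphi) (lexx _)) erefl).
apply: intg_eq H1.1 => // p _; exact: curl_coefE.
Qed.

Lemma weak_form_gradm i k : weak_form (fun p => Dm i p 0 k) (cst 0)
  (fun j p => (j == i)%:R * m p 0 k) (cst 0).
Proof.
apply: weak_form_half => [|j|phi tphi].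
- exact/L2loc_L1loc/weak_Dm_L2loc.
- by apply: L1locZ; exact/L2loc_L1loc/weak_m_L2loc.
rewrite (bigD1 i)//= big1 ?addr0 => [|j ji]; last first.
  rewrite (negbTE ji) /Rintegral.
  by under eq_integral do rewrite /= !mul0r; rewrite integral0.
have W := weak_gradm ws i k tphi.
under [X in _ + X]eq_Rintegral do rewrite eqxx mul1r.
by rewrite W subrr.
Qed.

Lemma Rintegral_zero d (X : measurableType d) (mu : {measure set X -> \bar R}) A (g h : X -> R) :
  (forall x, g x = 0) -> \int[mu]_(x in A) (g x * h x) = 0.
Proof.
move=> g0; rewrite /Rintegral; under eq_integral do rewrite g0 mul0r.
by rewrite integral0.
Qed.

Lemma weak_form_trace k : weak_form (fun p => mt p 0 k) (fun p => m p 0 k)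
  (fun _ => cst 0) (fun x => m0 x 0 k).
Proof.
move=> phi tphi; have [r cphi] := test_cutoff tphi.
have cl : coef_loc (fun p => mt p 0 k) (fun p => m p 0 k) (fun _ => cst 0).
  by split => [||i]; [exact/L2loc_L1loc/weak_mt_L2loc|exact/L2loc_L1loc/weak_m_L2loc|exact: L1loc0].
rewrite (weak_form_split cl cphi (lexx _)).
have Z : \sum_(i < 3) \int[mu4]_(p in halfspace) (cst 0 p * 'D_(dirx i) phi p) = 0.
  by rewrite big1// => i _; exact: Rintegral_zero.
have W := weak_m_initial ws k tphi.
have alg (x y z c u : R) : y = - x - u -> z = 0 -> x + y + z = - u.
  by move=> -> ->; ring.
exact: alg W Z.
Qed.

Lemma weak_form_faraday k : weak_form (fun p => - mt p 0 k) (fun p => H p 0 k)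
  (curl_coef E k) (fun x => H0 x 0 k).
Proof.
move=> phi tphi; have [r cphi] := test_cutoff tphi.
have mH := @measurable_half R.
have i1 := cutoff_intg (L2loc_L1loc (weak_mt_L2loc k)) cphi (lexx _).
have i2 := cutoff_intg (L2loc_L1loc (weak_H_L2loc k)) (cutoff_derive dirt cphi) (lexx _).
have i3 := coef_cross_intg k tphi weak_E_L2loc.
have [_ I] := has_intD mH (has_intD mH (has_intN mH (conj i1 erefl)) (conj i2 erefl)) (conj i3 erefl).
have W := weak_faraday ws k tphi.
transitivity (\int[mu4]_(p in halfspace) (- (mt p 0 k * phi p) + H p 0 k * 'D_dirt phi p +
  cross (grad dirx phi p) (E p) 0 k)).
  by apply: eq_Rintegral => p _; rewrite curl_coefE mulNr.
have alg (x y z u : R) : - x - u - y = - z -> - z + x + y = - u.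
  by move=> h; rewrite -h; ring.
by rewrite I; exact: alg W.
Qed.

Lemma weak_form_ampere k : weak_form (cst 0) (fun p => E p 0 k)
  (fun i p => - curl_coef H k i p) (fun x => E0 x 0 k).
Proof.
move=> phi tphi; have [r cphi] := test_cutoff tphi.
have mH := @measurable_half R.
have i2 := cutoff_intg (L2loc_L1loc (weak_E_L2loc k)) (cutoff_derive dirt cphi) (lexx _).
have i3 := coef_cross_intg k tphi weak_H_L2loc.
have [_ I] := has_intD mH (conj i2 erefl) (has_intN mH (conj i3 erefl)).
have W := weak_ampere ws k tphi.
transitivity (\int[mu4]_(p in halfspace) (E p 0 k * 'D_dirt phi p +
  - cross (grad dirx phi p) (H p) 0 k)).
  apply: eq_Rintegral => p _; under eq_bigr do rewrite mulNr.
  by rewrite sumrN curl_coefE mul0r add0r.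
have alg (x y u : R) : - x - u + y = 0 -> x + - y = - u.
  by move=> h; apply/eqP; rewrite -subr_eq0 -oppr_eq0 -h; apply/eqP; ring.
by rewrite I; exact: alg W.
Qed.

Lemma weak_form_landau_lifshitz k : weak_form
  (fun p => (mt p + cross (m p) (mt p)) 0 k - 2 * cross (m p) (H p) 0 k) (cst 0)
  (fun i p => 2 * cross (m p) (Dm i p) 0 k) (cst 0).
Proof.
have l1 : L1loc (fun p => (mt p + cross (m p) (mt p)) 0 k).
  under eq_fun do rewrite mxE; apply: L1locD.
    exact/L2loc_L1loc/weak_mt_L2loc.
  by apply: L1loc_cross => j; [exact: weak_m_L2loc|exact: weak_mt_L2loc].
have l2 : L1loc (fun p => cross (m p) (H p) 0 k).
  by apply: L1loc_cross => j; [exact: weak_m_L2loc|exact: weak_H_L2loc].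
have l3 i : L1loc (fun p => cross (m p) (Dm i p) 0 k).
  by apply: L1loc_cross => j; [exact: weak_m_L2loc|exact: weak_Dm_L2loc].
apply: weak_form_half => [|j|phi tphi].
- by apply: L1locD l1 _; apply: L1locN; exact: L1locZ.
- exact: L1locZ.
have mH := @measurable_half R; have [r cphi] := test_cutoff tphi.
have i1 := cutoff_intg l1 cphi (lexx _).
have i2 := cutoff_intg l2 cphi (lexx _).
have i3 i := cutoff_intg (l3 i) (cutoff_derive (dirx i) cphi) (lexx _).
have [_ I] := has_intD mH (conj i1 erefl) (has_intN mH (has_intZ 2 mH (conj i2 erefl))).
have I3 i := (has_intZ 2 mH (conj (i3 i) erefl)).2.
have W := weak_landau_lifshitz ws k tphi.
rewrite [X in X + _](_ : _ = \int[mu4]_(p in halfspace) ((mt p + cross (m p) (mt p)) 0 k * phi p)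
   - 2 * \int[mu4]_(p in halfspace) (cross (m p) (H p) 0 k * phi p)); last first.
  by rewrite -I; apply: eq_Rintegral => p _; rewrite mulrBl mulrA.
rewrite [X in _ + X](_ : _ = 2 * \sum_(i < 3)
   \int[mu4]_(p in halfspace) (cross (m p) (Dm i p) 0 k * 'D_(dirx i) phi p)); last first.
  rewrite mulr_sumr; apply: eq_bigr => i _; rewrite -I3.
  by apply: eq_Rintegral => p _; rewrite mulrA.
by rewrite W; ring.
Qed.

End WeakSolution.

(** * Green's formulas for the constant function *)

Section LineIntegrals.
Context {R : realType}.
Notation leb := (@lebesgue_measure R).

Lemma integral_derive_tail (g g' : R -> R) (a b : R) : a < b ->
  (forall s : R, is_derive s 1 g (g' s)) -> continuous g' ->
  (forall s, b <= s -> g s = 0) -> (forall s, b <= s -> g' s = 0) ->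
  (\int[leb]_(s in `]a, +oo[) (g' s)%:E = (- g a)%:E)%E.
Proof.
move=> ab dg cg' gb gb'.
have mg' : measurable_fun setT g' by exact: continuous_measurable_fun.
have E : (\int[leb]_(s in `]a, +oo[) (g' s)%:E = \int[leb]_(s in `]a, b]) (g' s)%:E)%E.
  rewrite [LHS]integral_mkcond [RHS]integral_mkcond; apply: eq_integral => s _.
  rewrite !patchE !mem_setE !in_itv/= andbT; case: ltP => //= sa.
  by case: leP => // /ltW/gb' ->.
have cg : continuous g.
  move=> s; apply: differentiable_continuous; apply/derivable1_diffP.
  by have [] := dg s.
rewrite E integral_itv_obnd_cbnd; last first.
  by apply/measurable_EFinP; exact: measurable_funTS.
rewrite (@continuous_FTC2 _ _ g)//.
- by rewrite gb// sub0e.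
- exact: continuous_subspaceT.
- split => [s _||].
  + by have [] := dg s.
  + by apply: cvg_at_right_filter; exact: cg.
  + by apply: cvg_at_left_filter; exact: cg.
- by move=> s _; rewrite derive1E; have [_ ->] := dg s.
Qed.

Lemma integral_derive_line (g g' : R -> R) (b : R) : 0 < b ->
  (forall s : R, is_derive s 1 g (g' s)) -> continuous g' ->
  (forall s, b <= `|s| -> g s = 0) -> (forall s, b <= `|s| -> g' s = 0) ->
  (\int[leb]_s (g' s)%:E = 0)%E.
Proof.
move=> b0 dg cg' gb gb'.
have bN : - b < b by rewrite gtrN.
have H : (\int[leb]_(s in `](- b)%R, +oo[) (g' s)%:E = (- g (- b))%:E)%E.
  apply: (integral_derive_tail bN dg cg') => s bs.
    by apply: gb; rewrite (le_trans bs)// ler_norm.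
  by apply: gb'; rewrite (le_trans bs)// ler_norm.
rewrite (gb (- b)) ?normrN ?ler_norm// oppr0 in H.
rewrite -[RHS]H [RHS]integral_mkcond; apply: eq_integral => s _.
rewrite patchE mem_setE in_itv/= andbT; case: ltP => // sb.
by rewrite gb'// -normrN (le_trans _ (ler_norm _))// lerNr.
Qed.

Lemma fubini_zero2 d1 d2 (X1 : measurableType d1) (X2 : measurableType d2)
    (m1 : {sigma_finite_measure set X1 -> \bar R})
    (m2 : {sigma_finite_measure set X2 -> \bar R}) (F : X1 * X2 -> R) :
  intg (sfprod m1 m2) setT F -> (forall x, \int[m2]_y (F (x, y))%:E = 0)%E ->
  (\int[sfprod m1 m2]_z (F z)%:E = 0)%E.
Proof.
move=> iF F0; rewrite -(@integral12_prod_meas1 _ _ _ _ _ m1 m2 (EFin \o F) iF).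
by rewrite integral0_eq// => x _; exact: F0.
Qed.

Lemma fubini_zero1 d1 d2 (X1 : measurableType d1) (X2 : measurableType d2)
    (m1 : {sigma_finite_measure set X1 -> \bar R})
    (m2 : {sigma_finite_measure set X2 -> \bar R}) (F : X1 * X2 -> R) :
  intg (sfprod m1 m2) setT F -> (forall y, \int[m1]_x (F (x, y))%:E = 0)%E ->
  (\int[sfprod m1 m2]_z (F z)%:E = 0)%E.
Proof.
move=> iF F0; rewrite -(@integral21_prod_meas1 _ _ _ _ _ m1 m2 (EFin \o F) iF).
by rewrite integral0_eq// => x _; exact: F0.
Qed.

Lemma intg_bounded d (X : measurableType d) (mu : {measure set X -> \bar R})
    (A : set X) (F : X -> R) (C : R) : measurable A -> (mu A < +oo)%E ->
  measurable_fun setT F -> (forall x, ~ A x -> F x = 0) ->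
  (forall x, `|F x| <= C) -> intg mu setT F.
Proof.
move=> mA fA mF F0 FC.
have ic : intg mu A (cst C).
  apply: intgP; first exact: measurable_cst.
  rewrite (_ : (fun x => _) = cst (`|C|)%:E)// integral_cst//.
  by rewrite lte_mul_pinfty.
apply: (intg_ext mA measurableT) => // [x _ /F0//|].
by apply: intg_le ic _ => //; exact: measurable_funTS.
Qed.

End LineIntegrals.

Section Divergence.
Context {R : realType}.
Notation mu3 := (@leb3 R).
Notation mu4 := (@leb4 R).
Notation leb := (@lebesgue_measure R).

Lemma ex_add0 (t a b c s : R) :
  ((t, ((0, b), c)) + s *: dirx 0 = (t, ((s, b), c)) :> spacetime R) *
  ((t, ((a, 0), c)) + s *: dirx 1 = (t, ((a, s), c)) :> spacetime R) *
  ((t, ((a, b), 0)) + s *: dirx 2%:R = (t, ((a, b), s)) :> spacetime R).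
Proof.
split; first split.
- transitivity ((t + s * 0, ((0 + s * 1, b + s * 0), c + s * 0)) : spacetime R); first by [].
  by rewrite !mulr0 mulr1 !addr0 add0r.
- transitivity ((t + s * 0, ((a + s * 0, 0 + s * 1), c + s * 0)) : spacetime R); first by [].
  by rewrite !mulr0 mulr1 !addr0 add0r.
- transitivity ((t + s * 0, ((a + s * 0, b + s * 0), 0 + s * 1)) : spacetime R); first by [].
  by rewrite !mulr0 mulr1 !addr0 add0r.
Qed.

Lemma dirt_add0 (x : space3 R) (s : R) : (0, x) + s *: dirt = (s, x) :> spacetime R.
Proof.
transitivity ((0 + s * 1, x + s *: 0) : spacetime R); first by [].
by rewrite mulr1 add0r scaler0 addr0.
Qed.

Lemma continuous_line (f : spacetime R -> R) p v : continuous f ->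
  continuous (fun s : R => f (p + s *: v)).
Proof.
move=> cf s; apply: (@cvg_comp _ _ _ (fun s : R => p + s *: v) f); last exact: cf.
by apply: cvgD; [exact: cvg_cst|apply: cvgZr_tmp; exact: cvg_id].
Qed.

Lemma integral_cutoff_line r phi (p v : spacetime R) (b : R) : cutoff r r phi -> 0 < b ->
  (forall s, b <= `|s| -> ~ ((p + s *: v).1 <= r /\ cube r (p + s *: v).2)) ->
  (\int[leb]_s ('D_v phi (p + s *: v))%:E = 0)%E.
Proof.
move=> cphi b0 out.
apply: (@integral_derive_line R (fun s : R => phi (p + s *: v))
  (fun s : R => 'D_v phi (p + s *: v)) b b0).
- move=> s; apply: is_derive_line; exact: (smooth_derivable cphi.1 I).
- exact: (@continuous_line ('D_v phi) p v (smooth_continuous (smooth_derive v cphi.1))).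
- by move=> s /out; exact: (cphi.2 (p + s *: v)).
- by move=> s /out; exact: ((cutoff_derive v cphi).2 (p + s *: v)).
Qed.

Lemma divergence_section r phi (t : R) (i : 'I_3) : cutoff r r phi -> 0 < t ->
  (\int[mu3]_x ('D_(dirx i) phi (t, x))%:E = 0)%E.
Proof.
move=> cphi t0; have cD := cutoff_derive (dirx i) cphi.
pose F (x : space3 R) := 'D_(dirx i) phi (t, x).
have [C C0 HC] := cutoff_bound cD.
have HF x : `|F x| <= C by apply: HC; rewrite halfE.
have mD : measurable_fun (setT : set (mspacetime R)) ('D_(dirx i) phi).
  by apply: smooth_measurable => //; exact: cD.1.
have mF : measurable_fun (setT : set (mspace R)) F.
  exact: (@measurable_fun_pair2 _ _ _ (measurableTypeR R) (mspace R) _ ('D_(dirx i) phi) t).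
have F0 x : ~ cube r x -> F x = 0 by move=> nx; apply: cD.2 => -[].
have iF : intg mu3 setT F.
  exact: intg_bounded (measurable_cube r) (cube_lty r) mF F0 HF.
have r1 : 0 < `|r| + 1 by rewrite ltr_wpDl.
have out s : `|r| + 1 <= `|s| -> ~ (s \in `[- r, r]).
  rewrite in_itv/= -ler_norml => h1 h2; have := ler_norm r; move: h1 h2; lra.
case: i @F cD HC HF mD mF F0 iF => -[|[|[|//]]] ilt F cD HC HF mD mF F0 iF.
- have i0 : Ordinal ilt = 0 by exact/val_inj.
  apply: fubini_zero1 iF _ => c.
  pose F2 (ab : R * R) := F (ab, c).
  have mF2 : measurable_fun (setT : set (measurableTypeR R * measurableTypeR R)) F2.
    exact: (@measurable_fun_pair1 _ _ _ (measurableTypeR R * measurableTypeR R)%type (measurableTypeR R) _ F c).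
  have iF2 : intg (sfprod leb leb) setT F2.
    apply: (@intg_bounded _ _ _ (sfprod leb leb) (`[- r, r]%classic `*` `[- r, r]%classic) F2 C _ _ mF2).
    + by apply: measurableX; exact: measurable_itv.
    + by apply: sfprod_lty; try exact: measurable_itv; exact: leb_segment_lty.
    + by move=> ab nab; apply: F0 => -[].
    + by move=> ab; exact: HF.
  apply: fubini_zero1 iF2 _ => b.
  rewrite -[RHS](@integral_cutoff_line r phi (t, ((0, b), c)) (dirx 0) _ cphi r1).
    apply: eq_integral => s _; rewrite (ex_add0 t 0 b c s).
    by rewrite /F2 /F i0.
  by move=> s /out ns; rewrite (ex_add0 t 0 b c s) => -[_ [[/=]]].
- have i1 : Ordinal ilt = 1 by exact/val_inj.
  apply: fubini_zero1 iF _ => c.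
  pose F2 (ab : R * R) := F (ab, c).
  have mF2 : measurable_fun (setT : set (measurableTypeR R * measurableTypeR R)) F2.
    exact: (@measurable_fun_pair1 _ _ _ (measurableTypeR R * measurableTypeR R)%type (measurableTypeR R) _ F c).
  have iF2 : intg (sfprod leb leb) setT F2.
    apply: (@intg_bounded _ _ _ (sfprod leb leb) (`[- r, r]%classic `*` `[- r, r]%classic) F2 C _ _ mF2).
    + by apply: measurableX; exact: measurable_itv.
    + by apply: sfprod_lty; try exact: measurable_itv; exact: leb_segment_lty.
    + by move=> ab nab; apply: F0 => -[].
    + by move=> ab; exact: HF.
  apply: fubini_zero2 iF2 _ => a.
  rewrite -[RHS](@integral_cutoff_line r phi (t, ((a, 0), c)) (dirx 1) _ cphi r1).
    apply: eq_integral => s _; rewrite (ex_add0 t a 0 c s).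
    by rewrite /F2 /F i1.
  by move=> s /out ns; rewrite (ex_add0 t a 0 c s) => -[_ [[/=]]].
- have i2 : Ordinal ilt = 2%:R by exact/val_inj.
  apply: fubini_zero2 iF _ => -[a b].
  rewrite -[RHS](@integral_cutoff_line r phi (t, ((a, b), 0)) (dirx 2%:R) _ cphi r1).
    apply: eq_integral => s _; rewrite (ex_add0 t a b 0 s).
    by rewrite /F i2.
  by move=> s /out ns; rewrite (ex_add0 t a b 0 s) => -[_ [/=]].
Qed.

(** The constant 1 satisfies the same identities as the components of m, with
    vanishing derivatives. Subtracting it from the tests of m turns w . u into
    w . u - 1 = - |w - u|^2 / 2 and w into w - u. *)
Lemma weak_form_gradm1 i : weak_form (cst 0) (cst 0)
  (fun j (_ : spacetime R) => (j == i)%:R) (cst 0).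
Proof.
apply: weak_form_half => [|j|phi tphi].
- exact: L1loc0.
- exact/L2loc_L1loc/L2loc_cst.
rewrite Rintegral_zero// add0r (bigD1 i)//= big1 ?addr0 => [|j ji]; last first.
  by apply: Rintegral_zero => p; rewrite (negbTE ji).
have [r cphi] := test_cutoff tphi; have cD := cutoff_derive (dirx i) cphi.
have i1 := cutoff_intg (L2loc_L1loc (L2loc_cst 1)) cD (lexx _).
rewrite Rintegral_mkcond.
have mH := @measurable_half R.
pose F := (fun p => cst 1 p * 'D_(dirx i) phi p) \_ (halfspace : set (mspacetime R)).
have iF : intg mu4 setT F.
  move: i1 => /(integrable_mkcond _ mH); apply: eq_integrable => // p _.
  by rewrite /F /= !patchE; case: ifPn.
have Z : (\int[mu4]_p (F p)%:E = 0)%E.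
  apply: fubini_zero2 iF _ => t; have [t0|t0] := ltP 0 t; last first.
    rewrite integral0_eq// => x _; rewrite /F patchE ifF//.
    by apply/negP => /set_mem; rewrite halfE /= ltNge t0.
  rewrite -[RHS](@divergence_section r phi t i cphi t0); apply: eq_integral => x _.
  by rewrite /F patchE ifT ?mul1r// inE halfE.
rewrite /Rintegral -[RHS]/(fine 0%E) -Z; congr fine; apply: eq_integral => p _.
by rewrite /F !patchE eqxx.
Qed.

Lemma weak_form_trace1 : weak_form (cst 0) (cst 1 : spacetime R -> R) (fun=> cst 0) (cst 1).
Proof.
move=> phi tphi; have [r cphi] := test_cutoff tphi.
have cl : coef_loc (cst 0) (cst 1 : spacetime R -> R) (fun=> cst 0).
  by split => [||i]; [exact: L1loc0|exact/L2loc_L1loc/L2loc_cst|exact: L1loc0].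
rewrite (weak_form_split cl cphi (lexx _)).
rewrite Rintegral_zero// add0r big1 ?addr0 => [|i _]; last exact: Rintegral_zero.
have cD := cutoff_derive dirt cphi.
have i1 := cutoff_intg (L2loc_L1loc (L2loc_cst 1)) cD (lexx _).
have mH := @measurable_half R.
pose F := (fun p => cst 1 p * 'D_dirt phi p) \_ (halfspace : set (mspacetime R)).
have iF : intg mu4 setT F.
  move: i1 => /(integrable_mkcond _ mH); apply: eq_integrable => // p _.
  by rewrite /F /= !patchE; case: ifPn.
rewrite Rintegral_mkcond /Rintegral -fineN; congr fine.
rewrite -(@integral21_prod_meas1 _ _ _ _ _ leb mu3 (EFin \o F) iF).
have E x : fubini_G leb (EFin \o F) x = (- phi (0, x))%:E.
  rewrite /fubini_G.
  have [b b0 br] : exists2 b : R, 0 < b & r < b.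
    by exists (`|r| + 1); [rewrite ltr_wpDl|rewrite (le_lt_trans (ler_norm r))// ltrDl].
  have out s : b <= s -> ~ (s <= r /\ cube r x).
    by move=> bs [sr _]; have := lt_le_trans br (le_trans bs sr); rewrite ltxx.
  transitivity (\int[leb]_(s in `]0%R, +oo[) ('D_dirt phi (s, x))%:E)%E.
    rewrite [RHS]integral_mkcond; apply: eq_integral => s _.
    rewrite /F /= !patchE; case: ifPn => [/set_mem|/negP s0].
      by rewrite halfE /= => s0; rewrite mul1r ifT// inE /= in_itv/= s0.
    rewrite ifF//; apply/negP => /set_mem; rewrite /= in_itv/= andbT => s0'.
    by apply: s0; rewrite inE halfE.
  apply: (@integral_derive_tail R (fun s : R => phi (s, x)) (fun s : R => 'D_dirt phi (s, x)) 0 b b0).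
  - move=> s; have := @is_derive_line _ _ phi (0, x) dirt s.
    rewrite dirt_add0 => H.
    rewrite (_ : (fun s => phi (s, x)) = (fun t => phi ((0, x) + t *: dirt))).
      by apply: H; exact: smooth_derivable cphi.1 I.
    by apply/funext => t; rewrite dirt_add0.
  - rewrite (_ : (fun s => 'D_dirt phi (s, x)) = (fun t => 'D_dirt phi ((0, x) + t *: dirt))).
      exact: (@continuous_line ('D_dirt phi) (0, x) dirt (smooth_continuous cD.1)).
    by apply/funext => t; rewrite dirt_add0.
  - by move=> s /out; exact: (cphi.2 (s, x)).
  - by move=> s /out; exact: (cD.2 (s, x)).
rewrite [LHS](eq_integral (fun x : mspace R => (- phi (0, x))%:E)) => [|x _]; last exact: (E x).
have [C _ HC] : exists2 C : R, 0 <= C & forall p, cube r p.2 /\ 0 <= p.1 <= 0 -> `|phi p| <= C.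
  have cK := @compact_slice R 0 0 r.
  have [C C0 HC] := continuous_compact_bound cK (smooth_continuous cphi.1).
  by exists C => // p [pc p0]; apply: HC; split => //=; rewrite in_itv.
have mphi : measurable_fun (setT : set (mspacetime R)) phi.
  by apply: smooth_measurable => //; exact: cphi.1.
have i0 : intg mu3 setT (fun x => phi (0, x)).
  apply: (@intg_bounded R _ _ mu3 (cube r) (fun x => phi (0, x)) (`|C|) (@measurable_cube R r) (@cube_lty R r)).
  - exact: (@measurable_fun_pair2 _ _ _ (measurableTypeR R) (mspace R) _ phi 0).
  - by move=> x nx; apply: cphi.2 => -[].
  - move=> x; have [xc|nx] := pselect (cube r x).
      by rewrite (le_trans (HC (0, x) _)) ?ler_norm//= lexx.
    by rewrite cphi.2 ?normr0// => -[].
have -> : (- (\int[mu3]_x (cst 1 x * phi (0, x))%:E) = (-1)%:E * (\int[mu3]_x (phi (0, x))%:E))%E.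
  by rewrite EFinN mulN1e; congr (- _)%E; apply: eq_integral => x _; rewrite mul1r.
rewrite -integralZl//; apply: eq_integral => x _.
by rewrite -EFinM mulN1r.
Qed.

End Divergence.

(** * The energy inequality integrated against a decreasing weight *)

Section WeightedEnergy.
Context {R : realType}.
Notation mu3 := (@leb3 R).
Notation mu4 := (@leb4 R).
Notation leb := (@lebesgue_measure R).
Variables (T : R) (eta eta' : R -> R) (e d : spacetime R -> R) (c : R).
Hypothesis d_eta : forall t : R, is_derive t 1 eta (eta' t).
Hypothesis c_eta' : continuous eta'.
Hypothesis eta_ge0 : forall t, 0 <= eta t.
Hypothesis eta'_le0 : forall t, eta' t <= 0.
Hypothesis eta_T : forall t, T <= t -> eta t = 0.
Hypothesis eta'_T : forall t, T <= t -> eta' t = 0.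
Hypotheses (me : measurable_fun (slab T : set (mspacetime R)) e)
  (md : measurable_fun (slab T : set (mspacetime R)) d).
Hypotheses (e0 : forall p, 0 <= e p) (d0 : forall p, 0 <= d p).
Hypothesis c0 : 0 <= c.
Hypothesis energy_le : {ae leb, forall t : R, 0 < t < T ->
  (\int[mu3]_x (e (t, x))%:E + \int[mu4]_(p in slab t) (d p)%:E <= c%:E)%E}.

Let D (s : R) : \bar R := (\int[mu3]_x (d (s, x))%:E)%E.
Let A (s : R) : \bar R := (\int[mu3]_x (e (s, x))%:E)%E.

Let D0 s : (0 <= D s)%E.
Proof. by apply: integral_ge0 => x _; rewrite lee_fin. Qed.

Let A0 s : (0 <= A s)%E.
Proof. by apply: integral_ge0 => x _; rewrite lee_fin. Qed.

Let Neta'_ge0 t : 0 <= - eta' t. Proof. by rewrite oppr_ge0. Qed.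

Let ceta : continuous eta.
Proof.
move=> t; apply: differentiable_continuous; apply/derivable1_diffP.
by have [] := d_eta t.
Qed.

Let meta' : measurable_fun setT eta'. Proof. exact: continuous_measurable_fun. Qed.
Let meta : measurable_fun setT eta. Proof. exact: continuous_measurable_fun. Qed.

Let meta_fst (f : R -> R) : measurable_fun setT f ->
  measurable_fun (slab T : set (mspacetime R)) (fun p : spacetime R => f p.1).
Proof.
move=> mf; apply: measurable_funTS.
exact: (@measurableT_comp _ _ _ (mspacetime R) (measurableTypeR R) (measurableTypeR R) f).
Qed.

Let eta_tail s : (\int[leb]_(t in `]s, +oo[) (- eta' t)%:E = (eta s)%:E)%E.
Proof.
have [b sb Tb] : exists2 b, s < b & T <= b.
  by exists (Num.max (s + 1) T); rewrite ?lt_max ?ltrDl ?ltr01// le_max lexx orbT.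
have dN (t : R) : is_derive t 1 (- eta) (- eta' t) by exact: is_deriveN.
rewrite (@integral_derive_tail R (- eta) (- eta') s b sb)//.
- by rewrite fctE opprK.
- by move=> t; apply: cvgN; exact: c_eta'.
- by move=> t bt; rewrite fctE eta_T ?oppr0// (le_trans Tb).
- by move=> t bt; rewrite fctE eta'_T ?oppr0// (le_trans Tb).
Qed.

Let weighted_slab (w : R -> R) (h : spacetime R -> R) : measurable_fun setT w ->
  (forall t, 0 <= w t) -> measurable_fun (slab T : set (mspacetime R)) h ->
  (forall p, 0 <= h p) ->
  (\int[mu4]_(p in slab T) (w p.1 * h p)%:E =
   \int[leb]_(t in `]0%R, T[) ((w t)%:E * \int[mu3]_x (h (t, x))%:E))%E.
Proof.
move=> mw w0 mh h0.
have [-> _] := tonelli_slab (measurable_funM (meta_fst mw) mh)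
  (fun p _ => mulr_ge0 (w0 p.1) (h0 p)).
apply: eq_integral => t /set_mem; rewrite /= in_itv/= => tT.
rewrite -ge0_integralZl_EFin//.
- by move=> x _; rewrite lee_fin.
- have mH : measurable_fun [set: mspacetime R] (h \_ (slab T)).
    exact/(measurable_restrictT _ (measurable_slab T)).
  have := @measurable_fun_pair2 _ _ _ (measurableTypeR R) (mspace R) _ _ t mH.
  move=> mHt; apply/measurable_EFinP; apply: eq_measurable_fun mHt => x _.
  by rewrite patchE ifT// inE slabE.
Qed.

Let W : set (R * R) := [set z | 0 < z.1 /\ z.1 < z.2 /\ z.2 < T].

Let mW : measurable (W : set (measurableTypeR R * measurableTypeR R)).
Proof.
apply: (open_measurable_mbasis (mbasis_prod (@mbasis_real R) mbasis_real)).
have oW : open W.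
  apply: openI; last apply: openI.
  - by apply: (@open_comp _ _ (fst : R * R -> R) [set t : R | 0 < t]) => [q _|];
      [exact: cvg_fst|exact: open_gt].
  - rewrite (_ : (fun z : R * R => _) = (fun z : R * R => z.2 - z.1) @^-1` [set t : R | 0 < t]).
      apply: open_comp => [q _|]; last exact: open_gt.
      by apply: cvgB; [exact: cvg_snd|exact: cvg_fst].
    by apply/funext => z /=; rewrite subr_gt0.
  - by apply: (@open_comp _ _ (snd : R * R -> R) [set t : R | t < T]) => [q _|];
      [exact: cvg_snd|exact: open_lt].
by move=> x; move: oW; rewrite openE => h /h.
Qed.

Let I : set R := `]0, T[%classic.

Let DI : R -> \bar R := D \_ I.

Let K (z : R * R) : \bar R := ((fun z => (- eta' z.2)%:E * DI z.1)%E \_ W) z.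

Let mDI : measurable_fun (setT : set (measurableTypeR R)) DI.
Proof.
apply/(measurable_restrictT _ (measurable_itv _)).
exact: (tonelli_slab md (fun p _ => d0 p)).2.
Qed.

Let DI0 s : (0 <= DI s)%E.
Proof. by rewrite /DI patchE; case: ifP. Qed.

Let mK : measurable_fun (setT : set (measurableTypeR R * measurableTypeR R)) K.
Proof.
apply/(measurable_restrictT _ mW); apply: emeasurable_funM.
- apply: measurable_funTS; apply/measurable_EFinP.
  apply: (@measurableT_comp _ _ _ (measurableTypeR R * measurableTypeR R)%type (measurableTypeR R) (measurableTypeR R) (fun t => - eta' t) _ snd) => //.
  by apply: measurableT_comp => //; exact: meta'.
- apply: measurable_funTS.
  exact: (@measurableT_comp _ _ _ (measurableTypeR R * measurableTypeR R)%type (measurableTypeR R) _ DI).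
Qed.

Let K0 z : (0 <= K z)%E.
Proof.
by rewrite /K patchE; case: ifP => // _; rewrite mule_ge0// ?lee_fin.
Qed.

Let KF s : fubini_F leb K s = (((fun s => (eta s)%:E * D s) \_ I) s)%E.
Proof.
rewrite /fubini_F patchE; case: ifPn => [/set_mem|/negP]; rewrite /I /= ?in_itv/=.
  move=> /andP[s0 sT].
  transitivity (\int[leb]_(t in `]s, +oo[) ((- eta' t)%:E * D s))%E.
    rewrite [RHS]integral_mkcond; apply: eq_integral => t _.
    have DIs : DI s = D s by rewrite /DI patchE ifT//; apply/mem_set; rewrite /I /= in_itv/= s0.
    rewrite /K !patchE DIs.
    rewrite mem_setE in_itv/= andbT; case: ifPn => [/set_mem[_ [-> _]]//|/negP nW].
    case: ltP => // st; have [Tt|tT] := leP T t; first by rewrite eta'_T// oppr0 mul0e.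
    by exfalso; apply: nW; apply/mem_set.
  rewrite ge0_integralZr//; first by rewrite eta_tail.
    by apply/measurable_EFinP; apply: measurable_funTS; apply: measurableT_comp => //; exact: meta'.
  by move=> x _; rewrite lee_fin.
move=> sI; rewrite integral0_eq// => t _; rewrite /K patchE; case: ifP => // _.
by rewrite /DI patchE ifF ?mule0//; apply/negP.
Qed.

Let KG t : fubini_G leb K t =
  (((fun t => (- eta' t)%:E * \int[mu4]_(p in slab t) (d p)%:E) \_ I) t)%E.
Proof.
rewrite /fubini_G patchE; case: ifPn => [/set_mem|/negP]; rewrite /I /= ?in_itv/=.
  move=> /andP[t0 tT].
  have mdt : measurable_fun (slab t : set (mspacetime R)) d.
    by apply: measurable_funS md; [exact: measurable_slab|apply: sub_slab; exact: ltW].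
  have [-> mDt] := tonelli_slab mdt (fun p _ => d0 p).
  rewrite -ge0_integralZl_EFin//.
  rewrite [RHS]integral_mkcond; apply: eq_integral => s _.
  rewrite /K !patchE mem_setE in_itv/=; case: ifPn => [/set_mem[/= s0 [st _]]|/negP nW].
    rewrite s0 st /= /DI patchE ifT//; apply/mem_set.
    by rewrite /I /= in_itv/= s0 (lt_trans st).
  by case: ifP => // /andP[s0 st]; exfalso; apply: nW; apply/mem_set.
  by move=> x _; exact: D0.
move=> tI; rewrite integral0_eq// => s _; rewrite /K patchE; case: ifPn => // /set_mem[/= s0 [st tT]].
by exfalso; apply: tI; apply/mem_set; rewrite /= in_itv/= (lt_trans s0).
Qed.

(** The inequality at time t is multiplied by - eta' t >= 0 and integrated
    over ]0, T[. By Tonelli on 0 < s < t < T the dissipation up to time t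
    contributes eta s times its density at time s, since eta s is the integral
    of - eta' over ]s, +oo[. *)
Lemma weighted_energy :
  (\int[mu4]_(p in slab T) (- eta' p.1 * e p)%:E +
   \int[mu4]_(p in slab T) (eta p.1 * d p)%:E <= (eta 0 * c)%:E)%E.
Proof.
have mN : measurable_fun (setT : set (measurableTypeR R)) (fun t => - eta' t).
  by apply: measurableT_comp => //; exact: meta'.
rewrite (weighted_slab mN Neta'_ge0 me e0) (weighted_slab meta eta_ge0 md d0).
have <- : (\int[leb]_s fubini_F leb K s = \int[leb]_(t in I) ((eta t)%:E * D t))%E.
  by rewrite [RHS]integral_mkcond; apply: eq_integral => s _; rewrite KF.
rewrite (@fubini_tonelli _ _ _ _ _ leb leb K mK K0).
have -> : (\int[leb]_t fubini_G leb K t =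
    \int[leb]_(t in I) ((- eta' t)%:E * \int[mu4]_(p in slab t) (d p)%:E))%E.
  by rewrite [RHS]integral_mkcond; apply: eq_integral => s _; rewrite KG.
have mI : measurable (I : set (measurableTypeR R)) by exact: measurable_itv.
have mA : measurable_fun (I : set (measurableTypeR R)) A.
  exact: (tonelli_slab me (fun p _ => e0 p)).2.
have B0 t : (0 <= \int[mu4]_(p in slab t) (d p)%:E)%E.
  by apply: integral_ge0 => p _; rewrite lee_fin.
have mG : measurable_fun (I : set (measurableTypeR R))
   (fun t => (- eta' t)%:E * \int[mu4]_(p in slab t) (d p)%:E)%E.
  have := @measurable_fun_fubini_tonelli_G _ _ (measurableTypeR R) (measurableTypeR R) _ leb K mK K0.
  move=> /(@measurable_funTS _ _ _ _ I); apply: eq_measurable_fun => t tI.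
  by apply: (etrans (KG t)); rewrite patchE tI.
have mNE : measurable_fun (I : set (measurableTypeR R)) (fun t => (- eta' t)%:E).
  by apply/measurable_EFinP; exact: measurable_funTS.
rewrite -ge0_integralD//; last 3 first.
- by move=> t _; apply: mule_ge0; [rewrite lee_fin|exact: A0].
- exact: (emeasurable_funM mNE mA).
- by move=> t _; apply: mule_ge0; [rewrite lee_fin|exact: B0].
apply: (@le_trans _ _ (\int[leb]_(t in I) ((- eta' t)%:E * c%:E))%E).
  apply: ae_ge0_le_integral => //.
  - move=> t _; apply: adde_ge0; (apply: mule_ge0; first by rewrite lee_fin).
    + exact: A0.
    + exact: B0.
  - by apply: emeasurable_funD => //; apply: emeasurable_funM.
  - by move=> t _; apply: mule_ge0; rewrite lee_fin.
  - by apply: emeasurable_funM => //; exact: measurable_cst.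
  - apply: (@filterS _ _ (ae_filter_ringOfSetsType leb)) energy_le => t h.
    rewrite /I /= in_itv/= => /h {}h.
    by rewrite -ge0_muleDr; [rewrite lee_wpmul2l// lee_fin|exact: A0|exact: B0].
rewrite ge0_integralZr//.
  have -> : (\int[leb]_(t in I) (- eta' t)%:E = (eta 0)%:E)%E.
  rewrite -eta_tail [LHS]integral_mkcond [RHS]integral_mkcond; apply: eq_integral => t _.
  rewrite !patchE /I !mem_setE !in_itv/= andbT; case: ltP => //= t0.
  by case: ltP => // /eta'_T ->; rewrite oppr0.
  by rewrite EFinM.
by move=> t _; rewrite lee_fin.
Qed.
End WeightedEnergy.

(** * The weak equations tested with a strong solution *)

Section TestedEquations.
Context {R : realType}.
Notation mu3 := (@leb3 R).
Notation mu4 := (@leb4 R).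
Variables (m E H : spacetime R -> vec R) (Dm : 'I_3 -> spacetime R -> vec R)
  (mt : spacetime R -> vec R) (m0 E0 H0 : space3 R -> vec R).
Hypothesis ws : weak_solution_with m E H Dm mt m0 E0 H0.
Hypotheses (cm0 : forall k, continuous (fun x => m0 x 0 k))
  (cE0 : forall k, continuous (fun x => E0 x 0 k))
  (cH0 : forall k, continuous (fun x => H0 x 0 k)).
Variables (T T1 r : R).
Hypotheses (T10 : 0 < T1) (T1T : T1 < T) (Tr : T <= r).

Lemma intg_cube_continuous (g : space3 R -> R) s : continuous g -> intg mu3 (cube s) g.
Proof.
move=> cg; have [C C0 HC] := continuous_compact_bound (@cube_compact R s) cg.
apply: intg_le (intg_cst_cube s C) _ => //; first exact: measurable_cube.
by apply: measurable_funTS; exact: continuous_measurable3.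
Qed.

Section OneTest.
Variables (theta f : spacetime R -> R).
Hypotheses (ct : cutoff T1 r theta) (tf : tame T f).

Let thx p : 'I_3 -> R := fun i => 'D_(dirx i) theta p.
Let fx p : 'I_3 -> R := fun i => 'D_(dirx i) f p.
Let mS := @measurable_slab R T.

Lemma test_gradm i k : has_int mu4 (slab T)
  (fun p => Dm i p 0 k * (theta p * f p) + m p 0 k * (thx p i * f p + theta p * fx p i)) 0.
Proof.
have cl : coef_loc (fun p => Dm i p 0 k) (cst 0) (fun j p => (j == i)%:R * m p 0 k).
  split => [||j]; [exact/L2loc_L1loc/(weak_Dm_L2loc ws)|exact: L1loc0|].
  by apply: L1locZ; exact/L2loc_L1loc/(weak_m_L2loc ws).
have := @weak_form_tested R _ _ _ (cst 0) T T1 r theta f (cst 0) T10 T1T Tr ct tf cl (or_introl erefl) (weak_form_gradm ws i k).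
rewrite Rintegral_zero// oppr0 => I; apply: has_int_eq I _ _ => // p _.
rewrite /tested /= mul0r addr0 (bigD1 i)//= eqxx mul1r big1 ?addr0// => j ji.
by rewrite (negbTE ji) !mul0r.
Qed.

Lemma test_gradm1 i : has_int mu4 (slab T)
  (fun p => thx p i * f p + theta p * fx p i) 0.
Proof.
have cl : coef_loc (cst 0) (cst 0) (fun j (_ : spacetime R) => (j == i)%:R : R).
  by split => [||j]; [exact: L1loc0|exact: L1loc0|exact/L2loc_L1loc/L2loc_cst].
have := @weak_form_tested R _ _ _ (cst 0) T T1 r theta f (cst 0) T10 T1T Tr ct tf cl (or_introl erefl) (weak_form_gradm1 i).
rewrite Rintegral_zero// oppr0 => I; apply: has_int_eq I _ _ => // p _.
rewrite /tested /= !mul0r !add0r (bigD1 i)//= eqxx mul1r big1 ?addr0// => j ji.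
by rewrite (negbTE ji) !mul0r.
Qed.

Lemma test_trace k (f0 : space3 R -> R) :
  (forall x, f (t, x) @[t --> 0^'+] --> f0 x) ->
  has_int mu4 (slab T)
   (fun p => mt p 0 k * (theta p * f p)
      + m p 0 k * ('D_dirt theta p * f p + theta p * 'D_dirt f p))
   (- \int[mu3]_x (m0 x 0 k * (theta (0, x) * f0 x))).
Proof.
move=> ff0.
have cl : coef_loc (fun p => mt p 0 k) (fun p => m p 0 k) (fun=> cst 0).
  by split => [||j]; [exact/L2loc_L1loc/(weak_mt_L2loc ws)|exact/L2loc_L1loc/(weak_m_L2loc ws)|exact: L1loc0].
have w0 : (fun x => m0 x 0 k) = cst 0 \/ (forall r, intg mu3 (cube r) (fun x => m0 x 0 k)) /\
    forall x, f (t, x) @[t --> 0^'+] --> f0 x.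
  by right; split => // s; exact: intg_cube_continuous.
have I := weak_form_tested T10 T1T Tr ct tf cl w0 (weak_form_trace ws k).
apply: has_int_eq I _ _ => // p _.
by rewrite /tested /= big1 ?addr0// => j _; rewrite mul0r.
Qed.

Lemma test_trace1 (f0 : space3 R -> R) :
  (forall x, f (t, x) @[t --> 0^'+] --> f0 x) ->
  has_int mu4 (slab T)
   (fun p => 'D_dirt theta p * f p + theta p * 'D_dirt f p)
   (- \int[mu3]_x (theta (0, x) * f0 x)).
Proof.
move=> ff0.
have cl : coef_loc (cst 0) (cst 1 : spacetime R -> R) (fun=> cst 0).
  by split => [||i]; [exact: L1loc0|exact/L2loc_L1loc/L2loc_cst|exact: L1loc0].
have w0 : (cst 1 : space3 R -> R) = cst 0 \/ (forall r, intg mu3 (cube r) (cst 1)) /\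
    forall x, f (t, x) @[t --> 0^'+] --> f0 x.
  by right; split => // s; exact: intg_cst_cube.
have I := weak_form_tested T10 T1T Tr ct tf cl w0 weak_form_trace1.
apply: has_int_eq I _ _ => // [p _|].
  by rewrite /tested /= big1 ?addr0 => [|j _]; rewrite mul0r// mul1r add0r.
by congr (- _); apply: eq_Rintegral => x _; rewrite mul1r.
Qed.

Lemma test_landau_lifshitz k : has_int mu4 (slab T)
  (fun p => (mt p 0 k + c3 (m p 0) (mt p 0) k - 2 * c3 (m p 0) (H p 0) k) * (theta p * f p)
    + \sum_(i < 3) 2 * c3 (m p 0) (Dm i p 0) k * (thx p i * f p + theta p * fx p i)) 0.
Proof.
have l1 : L1loc (fun p => (mt p + cross (m p) (mt p)) 0 k).
  under eq_fun do rewrite mxE; apply: L1locD.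
    exact/L2loc_L1loc/(weak_mt_L2loc ws).
  by apply: L1loc_cross => j; [exact: (weak_m_L2loc ws)|exact: (weak_mt_L2loc ws)].
have l2 : L1loc (fun p => cross (m p) (H p) 0 k).
  by apply: L1loc_cross => j; [exact: (weak_m_L2loc ws)|exact: (weak_H_L2loc ws)].
have l3 i : L1loc (fun p => cross (m p) (Dm i p) 0 k).
  by apply: L1loc_cross => j; [exact: (weak_m_L2loc ws)|exact: (weak_Dm_L2loc ws)].
have cl : coef_loc (fun p => (mt p + cross (m p) (mt p)) 0 k - 2 * cross (m p) (H p) 0 k) (cst 0)
  (fun i p => 2 * cross (m p) (Dm i p) 0 k).
  split => [||j]; [|exact: L1loc0|exact: L1locZ].
  by apply: L1locD l1 _; apply: L1locN; exact: L1locZ.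
have := @weak_form_tested R _ _ _ (cst 0) T T1 r theta f (cst 0) T10 T1T Tr ct tf cl (or_introl erefl) (weak_form_landau_lifshitz ws k).
rewrite Rintegral_zero// oppr0 => I; apply: has_int_eq I _ _ => // p _.
rewrite /tested /= mul0r addr0 mxE !crossE; congr (_ + _).
by apply: eq_bigr => i _; rewrite crossE.
Qed.

End OneTest.

Section VectorTest.
Variables (theta : spacetime R -> R) (f : 'I_3 -> spacetime R -> R) (f0 : 'I_3 -> space3 R -> R).
Hypotheses (ct : cutoff T1 r theta) (tf : forall k, tame T (f k))
  (ff0 : forall k x, f k (t, x) @[t --> 0^'+] --> f0 k x).

Let thx p : 'I_3 -> R := fun i => 'D_(dirx i) theta p.
Let fx p : 'I_3 -> 'I_3 -> R := fun i k => 'D_(dirx i) (f k) p.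
Let mS := @measurable_slab R T.

Lemma test_faraday : has_int mu4 (slab T)
  (fun p => d3 (H p 0) (fun k => 'D_dirt theta p * f k p + theta p * 'D_dirt (f k) p)
     - d3 (E p 0) (fun k => theta p * curl3 (fx p) k + c3 (thx p) (f^~ p) k)
     - theta p * d3 (mt p 0) (f^~ p))
  (\sum_(k < 3) - \int[mu3]_x (H0 x 0 k * (theta (0, x) * f0 k x))).
Proof.
have I k : has_int mu4 (slab T) (tested (fun p => - mt p 0 k) (fun p => H p 0 k)
    (curl_coef E k) theta (f k)) (- \int[mu3]_x (H0 x 0 k * (theta (0, x) * f0 k x))).
  have cl : coef_loc (fun p => - mt p 0 k) (fun p => H p 0 k) (curl_coef E k).
    split => [||j]; [exact/L1locN/L2loc_L1loc/(weak_mt_L2loc ws)|exact/L2loc_L1loc/(weak_H_L2loc ws)|].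
    by apply: L1loc_curl_coef => j'; exact: (weak_E_L2loc ws).
  have w0 : (fun x => H0 x 0 k) = cst 0 \/ (forall r, intg mu3 (cube r) (fun x => H0 x 0 k)) /\
      forall x, f k (t, x) @[t --> 0^'+] --> f0 k x.
    by right; split => // s; exact: intg_cube_continuous.
  exact: (weak_form_tested T10 T1T Tr ct (tf k) cl w0 (weak_form_faraday ws k)).
apply: has_int_eq (has_int_sum mS I) _ _ => // p _.
exact: (faraday_sum (mt p 0) (H p 0) (E p 0) (f^~ p) (fun k => 'D_dirt (f k) p)
  (thx p) (fx p) (theta p) ('D_dirt theta p)).
Qed.

Lemma test_ampere : has_int mu4 (slab T)
  (fun p => d3 (E p 0) (fun k => 'D_dirt theta p * f k p + theta p * 'D_dirt (f k) p)
     + d3 (H p 0) (fun k => theta p * curl3 (fx p) k + c3 (thx p) (f^~ p) k))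
  (\sum_(k < 3) - \int[mu3]_x (E0 x 0 k * (theta (0, x) * f0 k x))).
Proof.
have I k : has_int mu4 (slab T) (tested (cst 0) (fun p => E p 0 k)
    (fun i p => - curl_coef H k i p) theta (f k)) (- \int[mu3]_x (E0 x 0 k * (theta (0, x) * f0 k x))).
  have cl : coef_loc (cst 0) (fun p => E p 0 k) (fun i p => - curl_coef H k i p).
    split => [||j]; [exact: L1loc0|exact/L2loc_L1loc/(weak_E_L2loc ws)|].
    by apply: L1locN; apply: L1loc_curl_coef => j'; exact: (weak_H_L2loc ws).
  have w0 : (fun x => E0 x 0 k) = cst 0 \/ (forall r, intg mu3 (cube r) (fun x => E0 x 0 k)) /\
      forall x, f k (t, x) @[t --> 0^'+] --> f0 k x.
    by right; split => // s; exact: intg_cube_continuous.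
  exact: (weak_form_tested T10 T1T Tr ct (tf k) cl w0 (weak_form_ampere ws k)).
apply: has_int_eq (has_int_sum mS I) _ _ => // p _.
exact: (ampere_sum (H p 0) (E p 0) (f^~ p) (fun k => 'D_dirt (f k) p)
  (thx p) (fx p) (theta p) ('D_dirt theta p)).
Qed.

Lemma test_landau_lifshitz3 : has_int mu4 (slab T)
  (fun p => theta p * (d3 (mt p 0) (f^~ p) + d3 (c3 (m p 0) (mt p 0)) (f^~ p)
      - 2 * d3 (c3 (m p 0) (H p 0)) (f^~ p)
      + \sum_(i < 3) 2 * d3 (c3 (m p 0) (Dm i p 0)) (fx p i))
    + \sum_(i < 3) 2 * thx p i * d3 (c3 (m p 0) (Dm i p 0)) (f^~ p)) 0.
Proof.
have I := has_int_sum mS (fun k => test_landau_lifshitz ct (tf k) k).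
apply: has_int_eq I _ _ => // [p _|]; last by rewrite big1.
exact: (landau_sum (m p 0) (mt p 0) (H p 0) (f^~ p) (thx p) (fun i => Dm i p 0) (fx p) (theta p)).
Qed.

Lemma test_gradm3 i : has_int mu4 (slab T)
  (fun p => theta p * (d3 (Dm i p 0) (f^~ p) + d3 (m p 0) (fx p i))
    + thx p i * d3 (m p 0) (f^~ p)) 0.
Proof.
have I := has_int_sum mS (fun k => test_gradm ct (tf k) i k).
apply: has_int_eq I _ _ => // [p _|]; last by rewrite big1.
exact: (gradm_sum (Dm i p 0) (m p 0) (f^~ p) (fx p i) (theta p) (thx p i)).
Qed.

Lemma test_trace3 : has_int mu4 (slab T)
  (fun p => 'D_dirt theta p * d3 (m p 0) (f^~ p)
     + theta p * (d3 (m p 0) (fun k => 'D_dirt (f k) p) + d3 (mt p 0) (f^~ p)))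
  (\sum_(k < 3) - \int[mu3]_x (m0 x 0 k * (theta (0, x) * f0 k x))).
Proof.
have I := has_int_sum mS (fun k => test_trace ct (tf k) k (@ff0 k)).
apply: has_int_eq I _ _ => // p _.
exact: (trace_sum (mt p 0) (m p 0) (f^~ p) (fun k => 'D_dirt (f k) p) (theta p) ('D_dirt theta p)).
Qed.

End VectorTest.

(** Green's formula in both variables: the gradient of m against a time
    derivative and the time derivative of m against a space derivative. The
    gradient equation is tested with D_t (theta f) and the trace equation with
    D_i (theta f), and mixed second derivatives cancel. *)
Lemma test_mixed theta f f0 i k : cutoff T1 r theta -> tame T f ->
  (forall x, f (t, x) @[t --> 0^'+] --> f0 x) ->
  (forall x, derivable f0 x (ex i)) ->
  has_int mu4 (slab T)
   (fun p => Dm i p 0 k * ('D_dirt theta p * f p + theta p * 'D_dirt f p)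
      - mt p 0 k * ('D_(dirx i) theta p * f p + theta p * 'D_(dirx i) f p))
   (\int[mu3]_x (m0 x 0 k * ('D_(dirx i) theta (0, x) * f0 x))
    + \int[mu3]_x (m0 x 0 k * (theta (0, x) * 'D_(ex i) f0 x))).
Proof.
move=> ct tf ff0 df0; have mS := @measurable_slab R T.
have T0 : 0 < T by exact: lt_trans T1T.
have A1 := test_gradm (cutoff_derive dirt ct) tf i k.
have A2 := test_gradm ct (tame_derive dirt tf) i k.
have A3 := test_trace (cutoff_derive (dirx i) ct) tf k ff0.
have A4 := test_trace ct (tame_derive (dirx i) tf) k (tame_trace_derive T0 tf ff0 df0).
have A := has_intD mS (has_intD mS A1 A2) (has_intN mS (has_intD mS A3 A4)).
apply: has_int_eq A _ _ => // [p Tp|]; last by rewrite add0r sub0r opprD !opprK.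
have st : smooth setT theta by case: ct.
exact: (mixed_sum _ _ _ _ _ _ _ _ _
  (@derive_comm _ _ setT theta p (dirx i) dirt openT st I)
  (tame_comm (dirx i) dirt tf Tp)).
Qed.

End TestedEquations.

(** * The weights in time and space *)

Section Weights.
Context {R : realType}.

Section TimeWeight.
Variables (T1 lam : R).
Hypotheses (T10 : 0 < T1) (lam0 : 0 < lam).

Let kap : R := (lam * T1 ^+ 2)^-1.
Let kap0 : 0 < kap. Proof. by rewrite invr_gt0 mulr_gt0// exprn_gt0. Qed.

(** As -eta' / eta = 1 / (kap * (T1 - t)^2), the value of kap makes eta decay
    at least at the rate lam on ]0, T1[. *)
Definition eta (t : R) : R := rho (kap * (T1 - t)).
Definition eta' (t : R) : R := - kap * flat 'X^2 (kap * (T1 - t)).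

Lemma is_derive_eta (t : R) : is_derive t 1 eta (eta' t).
Proof.
have dq : is_derive t 1 (fun s : R => kap * (T1 - s)) (- kap).
  have := @is_deriveZ _ _ _ (fun s : R => T1 - s) kap t 1 (-1) _.
  rewrite /GRing.scale /= mulrN1; apply.
  have := is_deriveB (is_derive_cst T1 t 1) (is_derive_id t (1 : R)).
  by rewrite sub0r.
have := @is_derive1_comp _ (@rho R) _ t _ _ (is_derive_rho _) dq.
by rewrite mulrC.
Qed.

Lemma smooth_eta : smooth setT eta.
Proof.
have -> : eta = rho \o (fun t => - kap * t + kap * T1).
  by apply/funext => t /=; congr rho; ring.
by apply: smooth_comp; [exact: openT|exact: smooth_rho|exact: smooth_affine].
Qed.

Lemma continuous_eta' : continuous eta'.
Proof.
have -> : eta' = 'D_1 eta.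
  by apply/funext => t; have [_ ->] := is_derive_eta t.
apply: smooth_continuous; exact: smooth_derive smooth_eta.
Qed.

Lemma eta_ge0 t : 0 <= eta t. Proof. exact: rho_ge0. Qed.

Lemma eta'_le0 t : eta' t <= 0.
Proof.
rewrite /eta' mulNr oppr_le0 mulr_ge0 ?(ltW kap0)// flat_X2E mulr_ge0 ?rho_ge0//.
by rewrite invr_ge0 sqr_ge0.
Qed.

Lemma eta_T t : T1 <= t -> eta t = 0.
Proof. by move=> Tt; rewrite /eta rho_le0// pmulr_rle0// subr_le0. Qed.

Lemma eta'_T t : T1 <= t -> eta' t = 0.
Proof.
move=> Tt; rewrite /eta' flat_X2E rho_le0 ?mulr0//.
by rewrite pmulr_rle0// subr_le0.
Qed.

Lemma eta_gt0 t : t < T1 -> 0 < eta t.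
Proof. by move=> tT; rewrite /eta rho_gt0// mulr_gt0// subr_gt0. Qed.

Lemma eta_decay t : 0 < t -> lam * eta t <= - eta' t.
Proof.
move=> t0; have [Tt|tT] := leP T1 t.
  by rewrite eta_T// eta'_T// mulr0 oppr0.
rewrite /eta' flat_X2E /eta mulNr opprK mulrA ler_wpM2r ?rho_ge0//.
have d0 : 0 < T1 - t by rewrite subr_gt0.
have -> : kap * (kap * (T1 - t)) ^- 2 = kap^-1 * (T1 - t) ^- 2.
  by field; rewrite !gt_eqF.
rewrite /kap invrK -mulrA -[leLHS]mulr1 ler_wpM2l ?(ltW lam0)//.
rewrite ler_pdivlMr ?exprn_gt0// mul1r lerXn2r ?nnegrE ?ltW//.
by rewrite ltrBlDr ltrDl.
Qed.

End TimeWeight.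

Section SpaceWeight.

Definition coord1 (p : spacetime R) : R := p.2.1.1.
Definition coord2 (p : spacetime R) : R := p.2.1.2.
Definition coord3 (p : spacetime R) : R := p.2.2.
Definition normsq (p : spacetime R) : R :=
  coord1 p * coord1 p + coord2 p * coord2 p + coord3 p * coord3 p.

Let s4 : continuous (snd : spacetime R -> space3 R).
Proof. by move=> p; exact: cvg_snd. Qed.
Let f3 : continuous (fst : space3 R -> R * R).
Proof. by move=> p; exact: cvg_fst. Qed.
Let s3 : continuous (snd : space3 R -> R).
Proof. by move=> p; exact: cvg_snd. Qed.
Let f2 : continuous (fst : R * R -> R).
Proof. by move=> p; exact: cvg_fst. Qed.
Let s2 : continuous (snd : R * R -> R).
Proof. by move=> p; exact: cvg_snd. Qed.

Let c1 : continuous (fst \o (fst \o (snd : spacetime R -> space3 R))).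
Proof.
move=> p; apply: continuous_comp; last exact: f2.
by apply: continuous_comp; [exact: s4|exact: f3].
Qed.
Let c2 : continuous (snd \o (fst \o (snd : spacetime R -> space3 R))).
Proof.
move=> p; apply: continuous_comp; last exact: s2.
by apply: continuous_comp; [exact: s4|exact: f3].
Qed.
Let c3 : continuous (snd \o (snd : spacetime R -> space3 R)).
Proof. by move=> p; apply: continuous_comp; [exact: s4|exact: s3]. Qed.

Let derive_lin (f : {linear spacetime R -> R}) p v : continuous f ->
  is_derive p v f (f v).
Proof.
move=> cf; have df := @linear_differentiable _ _ _ f p cf.
by split; [exact: diff_derivable|rewrite deriveE// diff_lin].
Qed.

Lemma smooth_coords : [/\ smooth setT coord1, smooth setT coord2 & smooth setT coord3].
Proof.
have h1 := @smooth_linear _ _ _ (fst \o (fst \o snd)) c1.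
have h2 := @smooth_linear _ _ _ (snd \o (fst \o snd)) c2.
have h3 := @smooth_linear _ _ _ (snd \o snd) c3.
by split.
Qed.

Lemma smooth_normsq : smooth setT normsq.
Proof.
have [h1 h2 h3] := smooth_coords.
have -> : normsq = coord1 * coord1 + coord2 * coord2 + coord3 * coord3 by [].
have oT := @openT (spacetime R).
by do 2?[apply: smoothD => //]; apply: smoothM.
Qed.

Lemma is_derive_normsq p v : is_derive p v normsq
  (2 * (coord1 p * coord1 v + coord2 p * coord2 v + coord3 p * coord3 v)).
Proof.
have d1 : is_derive p v coord1 (coord1 v) := @derive_lin (fst \o (fst \o snd)) p v c1.
have d2 : is_derive p v coord2 (coord2 v) := @derive_lin (snd \o (fst \o snd)) p v c2.
have d3 : is_derive p v coord3 (coord3 v) := @derive_lin (snd \o snd) p v c3.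
have D := is_deriveD (is_deriveD (is_deriveM d1 d1) (is_deriveM d2 d2)) (is_deriveM d3 d3).
by apply: is_derive_eq D _; rewrite /GRing.scale /=; ring.
Qed.

Variable n : nat.
Let N : R := n.+1%:R.
Let N0 : 0 < N. Proof. by rewrite ltr0n. Qed.

(** The factor exp(1) makes xi equal to 1 at the origin. *)
Definition xi (p : spacetime R) : R := expR 1 * rho (1 - normsq p / N ^+ 2).

Lemma smooth_xi : smooth setT xi.
Proof.
have oT := @openT (spacetime R).
have -> : xi = cst (expR 1) * (rho \o ((fun s => - N ^- 2 * s + 1) \o normsq)).
  by apply/funext => p; rewrite /xi fctE /=; congr (_ * rho _); ring.
apply: smoothM => //; first exact: smooth_cst.
apply: smooth_comp => //; first exact: smooth_rho.
by apply: smooth_comp => //; [exact: smooth_affine|exact: smooth_normsq].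
Qed.

Lemma normsq_ge0 p : 0 <= normsq p.
Proof. by rewrite /normsq -!expr2 !addr_ge0// sqr_ge0. Qed.

Lemma xi_itv p : 0 <= xi p <= 1.
Proof.
rewrite /xi mulr_ge0 ?expR_ge0 ?rho_ge0//=.
have [h|h] := ltP 0 (1 - normsq p / N ^+ 2); last by rewrite rho_le0// mulr0.
rewrite rhoE// -expRD -[leRHS]expR0 ler_expR subr_le0.
by rewrite invf_ge1// gerBl divr_ge0 ?normsq_ge0// exprn_ge0// ltW.
Qed.

Lemma is_derive_xi p v : is_derive p v xi
  (- expR 1 * flat 'X^2 (1 - normsq p / N ^+ 2) *
   (2 * (coord1 p * coord1 v + coord2 p * coord2 v + coord3 p * coord3 v) / N ^+ 2)).
Proof.
have sx : derivable xi p v by exact: smooth_derivable smooth_xi I.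
split => //.
pose q := (fun s => - N ^- 2 * s + 1) \o normsq.
have oT := @openT (spacetime R).
have sq : smooth setT q.
  by apply: smooth_comp => //; [exact: smooth_affine|exact: smooth_normsq].
have dq : 'D_v q p = - N ^- 2 * (2 * (coord1 p * coord1 v + coord2 p * coord2 v + coord3 p * coord3 v)).
  have -> : q = (fun x => (- N ^- 2) *: normsq x) + cst 1 by [].
  have D := is_deriveD (is_deriveZ (- N ^- 2) (is_derive_normsq p v)) (is_derive_cst (1 : R) p v).
  by have [_ ->] := D; rewrite addr0.
have -> : xi = (fun x => expR 1 *: (rho \o q) x).
  by apply/funext => x; rewrite /xi /q /GRing.scale /=; congr (_ * rho _); ring.
rewrite deriveZ; last first.
  apply: diff_derivable; apply: differentiable_comp; first exact: (sq [::]).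
  exact: (smooth_rho [::]).
rewrite derive_comp1; [|exact: (sq [::])|exact: (smooth_rho [::])].
rewrite dq; have [_ ->] := is_derive_rho (q p).
rewrite /GRing.scale /= /q /=.
have -> : - N ^- 2 * normsq p + 1 = 1 - normsq p / N ^+ 2 by ring.
by ring.
Qed.

Lemma xi_dirt p : 'D_dirt xi p = 0.
Proof.
have [_ ->] := is_derive_xi p dirt.
by rewrite /coord1 /coord2 /coord3 /= !mulr0 !addr0 mulr0 mul0r mulr0.
Qed.

Lemma normsq_out p : ~ cube N p.2 -> N ^+ 2 <= normsq p.
Proof.
move=> nc; rewrite leNgt; apply/negP => h; apply: nc.
have sq (a : R) : a * a <= normsq p -> a \in `[- N, N].
  move=> ha; rewrite in_itv/= -ler_norml -(@ler_pXn2r _ 2)// ?nnegrE ?(ltW N0)//.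
  by rewrite real_normK ?num_real// expr2 (le_trans ha)// ltW.
rewrite /cube /setX /=; split; first split; apply: sq; rewrite /normsq -!expr2.
- by rewrite -addrA lerDl addr_ge0// sqr_ge0.
- by rewrite [X in X + _]addrC -addrA lerDl addr_ge0// sqr_ge0.
- by rewrite lerDr addr_ge0// sqr_ge0.
Qed.

Lemma xi_out p : ~ cube N p.2 -> xi p = 0.
Proof.
move=> /normsq_out h; rewrite /xi rho_le0 ?mulr0// subr_le0.
by rewrite ler_pdivlMr ?mul1r// exprn_gt0.
Qed.

End SpaceWeight.

Lemma xi_dirx_bound : exists2 K : R, 0 <= K &
  forall n i p, `|'D_(dirx i) (xi n) p| <= K / n.+1%:R.
Proof.
have [C C0 HC] := @flat_bounded R 'X^2.
exists (expR 1 * C * 2) => [|n i p]; first by rewrite !mulr_ge0// expR_ge0.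
have [_ ->] := is_derive_xi n p (dirx i); set N := n.+1%:R.
have N0 : 0 < N by rewrite ltr0n.
have [cN|/normsq_out h] := pselect (cube N p.2); last first.
  rewrite flat_X2E rho_le0 ?mulr0 ?mul0r ?normr0; last first.
    by rewrite subr_le0 ler_pdivlMr ?mul1r// exprn_gt0.
  by rewrite divr_ge0// ?(ltW N0)// !mulr_ge0// expR_ge0.
have cb : `|coord1 p * coord1 (dirx i) + coord2 p * coord2 (dirx i) + coord3 p * coord3 (dirx i)| <= N.
  move: cN; rewrite /cube /setX /= !in_itv/= -!ler_norml => -[[h1 h2] h3].
  by case: i => -[|[|[|//]]] ?; rewrite /coord1 /coord2 /coord3 /= ?mulr0 ?mulr1 ?addr0 ?add0r.
move: cb (HC (1 - normsq p / N ^+ 2)); set b := (X in `|X| <= N); set a := flat _ _.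
move=> bN aC.
have -> : - expR 1 * a * (2 * b / N ^+ 2) = - (expR 1 * (2 / N ^+ 2)) * (a * b) by ring.
have k0 : 0 <= expR (1 : R) * (2 / N ^+ 2).
  by rewrite mulr_ge0 ?expR_ge0// divr_ge0// exprn_ge0// ltW.
have -> : expR 1 * C * 2 / N = expR 1 * (2 / N ^+ 2) * (C * N).
  by field; rewrite gt_eqF.
rewrite normrM normrN (ger0_norm k0) ler_wpM2l// normrM.
exact: ler_pM.
Qed.

Lemma xi_cvg p : xi n p @[n --> \oo] --> (1 : R).
Proof.
have rc : {for (1 : R), continuous (@rho R)} by exact: smooth_continuous smooth_rho _.
have qc : 1 - normsq p / n.+1%:R ^+ 2 @[n --> \oo] --> (1 : R).
  rewrite -[X in _ --> X]subr0; apply: cvgB; first exact: cvg_cst.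
  rewrite -(mulr0 (normsq p)); apply: cvgM; first exact: cvg_cst.
  have -> : (fun n : nat => (n.+1%:R ^+ 2)^-1 : R) = harmonic * harmonic.
    by apply/funext => n; rewrite fctE /harmonic /= expr2 invfM.
  by rewrite -[X in _ --> X](mulr0 0); apply: cvgM; exact: cvg_harmonic.
have E : expR 1 * rho 1 = 1 :> R.
  by rewrite rhoE// invr1 expRN divff// gt_eqF// expR_gt0.
rewrite -[X in _ --> X]E; apply: cvgM; first exact: cvg_cst.
exact: (cvg_comp _ _ qc rc).
Qed.

Section Theta.
Variables (T1 lam : R) (n : nat).
Hypotheses (T10 : 0 < T1) (lam0 : 0 < lam).

(** The factor xi enters squared: the space gradient of theta is then 2 eta xi
    grad xi, and the factor xi left in it lets theta itself absorb the terms
    quadratic in the difference of the solutions. *)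
Definition theta : spacetime R -> R := (eta T1 lam \o fst) * (xi n * xi n).

Lemma smooth_theta : smooth setT theta.
Proof.
have oT := @openT (spacetime R).
have sx := smooth_xi n.
apply: smoothM => //; last exact: smoothM.
by apply: smooth_comp => //; [exact: smooth_eta|exact: smooth_fst].
Qed.

Lemma thetaE p : theta p = eta T1 lam p.1 * xi n p ^+ 2.
Proof. by rewrite /theta fctE /= expr2. Qed.

Lemma theta_cutoff r : n.+1%:R <= r -> cutoff T1 r theta.
Proof.
move=> nr; split; first exact: smooth_theta.
move=> p np; rewrite thetaE.
have [pT|Tp] := leP p.1 T1; last by rewrite eta_T ?mul0r// ltW.
rewrite xi_out ?expr0n ?mulr0// => pc; apply: np; split => //.
move: pc; rewrite /cube /setX /= !in_itv/= => -[[/andP[? ?] /andP[? ?]] /andP[? ?]].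
by do !split; apply/andP; split; lra.
Qed.

Let dfst (p v : spacetime R) : 'D_v (eta T1 lam \o fst) p = eta' T1 lam p.1 * v.1.
Proof.
have df : differentiable (fst : spacetime R -> R) p by exact: (smooth_fst [::]).
rewrite derive_comp1//; last exact: (@smooth_eta T1 lam [::]).
have [_ ->] := is_derive_eta T1 lam p.1; congr (_ * _).
by rewrite deriveE// (@diff_lin _ _ _ fst)// => q; exact: cvg_fst.
Qed.

Let dtheta (p v : spacetime R) : 'D_v theta p =
  eta' T1 lam p.1 * v.1 * xi n p ^+ 2 + eta T1 lam p.1 * (2 * xi n p * 'D_v (xi n) p).
Proof.
have oT := @openT (spacetime R); have sx := smooth_xi n.
have dx := derivableP (smooth_derivable sx I : derivable (xi n) p v).
have se : smooth setT (eta T1 lam \o fst : spacetime R -> R).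
  by apply: smooth_comp => //; [exact: smooth_eta|exact: smooth_fst].
have de := derivableP (smooth_derivable se I : derivable (eta T1 lam \o fst) p v).
have [_ ->] := is_deriveM de (is_deriveM dx dx).
by rewrite dfst /GRing.scale /= fctE; move: ('D_v _ p) (xi n p) => a b; ring.
Qed.

Lemma theta_dirt p : 'D_dirt theta p = eta' T1 lam p.1 * xi n p ^+ 2.
Proof. by rewrite dtheta xi_dirt /= !mulr0 addr0 mulr1. Qed.

Lemma theta_dirx i p : 'D_(dirx i) theta p =
  eta T1 lam p.1 * (2 * xi n p * 'D_(dirx i) (xi n) p).
Proof. by rewrite dtheta /= mulr0 mul0r add0r. Qed.

End Theta.

End Weights.

(** * The strong solution *)

Section StrongSolution.
Context {R : realType}.
Variables (T : R) (m E H : spacetime R -> vec R) (m0 E0 H0 : space3 R -> vec R).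
Hypothesis T0 : 0 < T.
Hypothesis ad : admissible_data m0 E0 H0.
Hypothesis ss : smooth_solution T m E H m0 E0 H0.

Definition component (F : spacetime R -> vec R) (k : 'I_3) : spacetime R -> R := fun p => F p 0 k.
Definition component0 (F : space3 R -> vec R) (k : 'I_3) : space3 R -> R := fun x => F x 0 k.

Lemma strong_tame k : [/\ tame T (component m k), tame T (component E k) & tame T (component H k)].
Proof.
split; apply: tame_coord.
- exact: (strong_m_smooth ss).
- by move=> T' /(strong_bounded ss)[].
- exact: (strong_E_smooth ss).
- by move=> T' /(strong_bounded ss)[].
- exact: (strong_H_smooth ss).
- by move=> T' /(strong_bounded ss)[].
Qed.

Let tm k : tame T (component m k). Proof. by have [] := strong_tame k. Qed.
Let tE k : tame T (component E k). Proof. by have [] := strong_tame k. Qed.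
Let tH k : tame T (component H k). Proof. by have [] := strong_tame k. Qed.

Definition mdt (k : 'I_3) : spacetime R -> R := 'D_dirt (component m k).
Definition mdx (i k : 'I_3) : spacetime R -> R := 'D_(dirx i) (component m k).
Definition mdxx (i k : 'I_3) : spacetime R -> R := 'D_(dirx i) (mdx i k).
Definition mlap (k : 'I_3) : spacetime R -> R := mdxx i0 k + mdxx i1 k + mdxx i2 k.

(** Twice the effective field, up to sign, corrected by the time derivative.
    The Landau-Lifshitz equation reads D_t m = mfield x m, so that this field
    can be tested against the weak equation in place of the effective field of
    the weak solution, which is only a distribution. *)
Definition mfield (k : 'I_3) : spacetime R -> R :=
  mdt k - cst 2 * (mlap k + component H k).

Lemma tame_mdt k : tame T (mdt k). Proof. exact: tame_derive. Qed.
Lemma tame_mdx i k : tame T (mdx i k). Proof. exact: tame_derive. Qed.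
Lemma tame_mfield k : tame T (mfield k).
Proof.
apply: tameB; first exact: tame_mdt.
apply: tameM; first exact: tame_cst.
apply: tameD => //; have tx i : tame T (mdxx i k) by exact/tame_derive/tame_mdx.
by do 2?apply: tameD.
Qed.

Lemma derivative_coord (F : spacetime R -> vec R) v p k : smooth (slab T) F ->
  slab T p -> 'D_v F p 0 k = 'D_v (component F k) p.
Proof. by move=> sF Tp; rewrite derive_coord//; exact: smooth_derivable sF Tp. Qed.

Lemma curl_coord (F : spacetime R -> vec R) p k : smooth (slab T) F ->
  slab T p -> curl dirx F p 0 k = curl3 (fun i j => 'D_(dirx i) (component F j) p) k.
Proof.
move=> sF Tp; rewrite mxE /curl3.
exact: (f_equal2 (fun x y : R => x - y) (derivative_coord _ _ sF Tp) (derivative_coord _ _ sF Tp)).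
Qed.

Lemma strong_unit p : slab T p -> d3 (fun k => component m k p) (fun k => component m k p) = 1.
Proof. exact: (strong_m_unit ss). Qed.

Definition crossf (f g : 'I_3 -> spacetime R -> R) (k : 'I_3) : spacetime R -> R :=
  f (k + 1) * g (k + 2%:R) - f (k + 2%:R) * g (k + 1).

Lemma tame_crossf f g k : (forall j, tame T (f j)) -> (forall j, tame T (g j)) ->
  tame T (crossf f g k).
Proof. by move=> tf tg; apply: tameB; apply: tameM. Qed.

Lemma crossfE f g k p : crossf f g k p = c3 (f^~ p) (g^~ p) k.
Proof. by []. Qed.

Lemma crossf_derive f g k v p : (forall j, tame T (f j)) -> (forall j, tame T (g j)) ->
  slab T p -> 'D_v (crossf f g k) p =
  c3 (fun j => 'D_v (f j) p) (g^~ p) k + c3 (f^~ p) (fun j => 'D_v (g j) p) k.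
Proof.
move=> tf tg Tp.
have D j l := is_deriveM (derivableP (@tame_derivable _ _ _ v p (tf j) Tp)) (derivableP (@tame_derivable _ _ _ v p (tg l) Tp)).
have [_ ->] := is_deriveB (D (k + 1) (k + 2%:R)) (D (k + 2%:R) (k + 1)).
rewrite /GRing.scale /= /c3.
move: ('D_v _ _) ('D_v _ _) ('D_v _ _) ('D_v _ _) => a b c d.
by move: (f _ p) (g _ p) (f _ p) (g _ p) => x y z t; ring.
Qed.

Lemma strong_field p k : slab T p ->
  c3 (fun j => mfield j p) (fun j => component m j p) k = mdt k p.
Proof.
move=> Tp; pose u := component m.
have LL j : mdt j p + c3 (u^~ p) (fun l => mdt l p) j =
    2 * (c3 (u^~ p) (fun l => mdxx i0 l p) j + c3 (u^~ p) (fun l => mdxx i1 l p) j +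
      c3 (u^~ p) (fun l => mdxx i2 l p) j) + 2 * c3 (u^~ p) (fun l => component H l p) j.
  have coef (A B C S : vec R) : A + B = 2 *: S + 2 *: C ->
      A 0 j + B 0 j = 2 * S 0 j + 2 * C 0 j.
    by move/(congr1 (fun M : vec R => M 0 j)); rewrite !mxE.
  have h := coef _ _ _ _ (strong_landau_lifshitz ss Tp).
  have dmE l : 'D_dirt m p 0 l = mdt l p := derivative_coord dirt l (strong_m_smooth ss) Tp.
  have crE i : 'D_(dirx i) (fun q => cross (m q) ('D_(dirx i) m q)) p 0 j =
      c3 (u^~ p) (fun l => mdxx i l p) j.
    rewrite (@near_eq_derive _ _ _ _ (fun q => \row_l crossf u (mdx i) l q)); last first.
      apply: (open_near_eq (@open_slab R T)) => // q /set_mem Tq.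
      apply/rowP => l; rewrite !mxE /crossf.
      by rewrite !(derivative_coord _ _ (strong_m_smooth ss) Tq).
    have tc l : tame T (crossf u (mdx i) l) by apply: tame_crossf => // l'; exact: tame_mdx.
    rewrite derive_coord; last first.
      apply/derivable_mxP => a l; rewrite (_ : (fun q => _) = crossf u (mdx i) l); last first.
        by apply/funext => q; rewrite mxE.
      exact: (tame_derivable (tc l) Tp).
    rewrite (_ : (fun q => _) = crossf u (mdx i) j); last first.
      by apply/funext => q; rewrite mxE.
    rewrite (crossf_derive j (dirx i) (tm) (tame_mdx i) Tp).
    rewrite -[RHS]add0r; congr (_ + _).
    by rewrite /c3 /mdx mulrC subrr.
  have e2 : cross (m p) ('D_dirt m p) 0 j = c3 (u^~ p) (fun l => mdt l p) j.
    by rewrite mxE (dmE (j + 1)) (dmE (j + 2%:R)).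
  have e3 : cross (m p) (H p) 0 j = c3 (u^~ p) (fun l => component H l p) j by rewrite mxE.
  have S : (\sum_(i < 3) 'D_(dirx i) (fun q => cross (m q) ('D_(dirx i) m q)) p) 0 j =
      c3 (u^~ p) (fun l => mdxx i0 l p) j + c3 (u^~ p) (fun l => mdxx i1 l p) j +
      c3 (u^~ p) (fun l => mdxx i2 l p) j.
    apply: (eq_trans (summxE _ _ _ _ _)).
    apply: (eq_trans (sum3E _)).
    exact: (f_equal2 +%R (f_equal2 +%R (crE i0) (crE i1)) (crE i2)).
  exact: (eq_trans (eq_trans (f_equal2 +%R (esym (dmE j)) (esym e2)) h)
    (f_equal2 +%R (f_equal (fun x => 2 * x) S) (f_equal (fun x => 2 * x) e3))).
have pE l : mfield l p = mdt l p - 2 * (mdxx i0 l p + mdxx i1 l p + mdxx i2 l p + component H l p).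
  by [].
have := LL k; rewrite /c3 !pE.
rewrite -/u.
move: (mdt _ p) (mdt _ p) (mdt _ p) (mdxx i0 _ p) (mdxx i0 _ p) (mdxx i1 _ p) (mdxx i1 _ p)
 (mdxx i2 _ p) (mdxx i2 _ p) (component H _ p) (component H _ p) (u _ p) (u _ p).
by move=> x0 x1 x2 x3 x4 x5 x6 x7 x8 x9 x10 x11 x12 h; lra.
Qed.

Lemma strong_field_derive i p k : slab T p -> 'D_dirt (mdx i k) p =
  c3 (fun j => 'D_(dirx i) (mfield j) p) (fun j => component m j p) k +
  c3 (fun j => mfield j p) (fun j => mdx i j p) k.
Proof.
move=> Tp; have -> : 'D_dirt (mdx i k) p = 'D_(dirx i) (mdt k) p.
  exact: (tame_comm dirt (dirx i) (tm k) Tp).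
rewrite -(crossf_derive k (dirx i) tame_mfield tm Tp).
apply: near_eq_derive; apply: (open_near_eq (@open_slab R T)) => // q /set_mem Tq.
by rewrite crossfE strong_field.
Qed.

Lemma strong_faraday3 p k : slab T p -> 'D_dirt (component H k) p +
  curl3 (fun i j => 'D_(dirx i) (component E j) p) k = - mdt k p.
Proof.
move=> Tp.
have coef (A B C : vec R) : A + B = - C -> A 0 k + B 0 k = - C 0 k.
  by move/(congr1 (fun M : vec R => M 0 k)); rewrite !mxE.
have h := coef _ _ _ (strong_faraday ss Tp).
exact: (eq_trans (eq_trans (f_equal2 +%R (esym (derivative_coord dirt k (strong_H_smooth ss) Tp))
  (esym (curl_coord k (strong_E_smooth ss) Tp))) h)
  (f_equal -%R (derivative_coord dirt k (strong_m_smooth ss) Tp))).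
Qed.

Lemma strong_ampere3 p k : slab T p -> 'D_dirt (component E k) p -
  curl3 (fun i j => 'D_(dirx i) (component H j) p) k = 0.
Proof.
move=> Tp.
have coef (A B : vec R) : A - B = 0 -> A 0 k - B 0 k = 0.
  by move/(congr1 (fun M : vec R => M 0 k)); rewrite !mxE.
have h := coef _ _ (strong_ampere ss Tp).
exact: (eq_trans (f_equal2 (fun x y : R => x - y) (esym (derivative_coord dirt k (strong_E_smooth ss) Tp))
  (esym (curl_coord k (strong_H_smooth ss) Tp))) h).
Qed.

Let sm0 k : smooth setT (component0 m0 k).
Proof. by apply: smooth_coord (data_m_smooth ad); exact: openT. Qed.

Let coord_cvg (F : spacetime R -> vec R) (F0 : space3 R -> vec R) x k :
  F (t, x) @[t --> 0^'+] --> F0 x -> component F k (t, x) @[t --> 0^'+] --> component0 F0 k x.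
Proof.
move=> h; apply: (@continuous_cvg _ _ _ _ _ (fun t => F (t, x)) (fun M : vec R => M 0 k) (F0 x)) h.
exact: (@differentiable_continuous _ _ _ (F0 x) (fun M : vec R => M 0 k) (differentiable_coord _ _ _)).
Qed.

Lemma strong_traces k x :
  [/\ component m k (t, x) @[t --> 0^'+] --> component0 m0 k x,
      component E k (t, x) @[t --> 0^'+] --> component0 E0 k x &
      component H k (t, x) @[t --> 0^'+] --> component0 H0 k x].
Proof.
split; apply: coord_cvg.
- exact: (strong_m_initial ss).
- exact: (strong_E_initial ss).
- exact: (strong_H_initial ss).
Qed.

Lemma mdx_trace i k x :
  mdx i k (t, x) @[t --> 0^'+] --> 'D_(ex i) (component0 m0 k) x.
Proof.
apply: (@tame_trace_derive _ T (component m k) (component0 m0 k) (ex i) T0 (tm k)) => y.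
  by have [] := strong_traces k y.
exact: smooth_derivable (sm0 k) I.
Qed.

Lemma mdx0_derivable i k x : derivable ('D_(ex i) (component0 m0 k)) x (ex i).
Proof. exact: smooth_derivable (smooth_derive (ex i) (sm0 k)) I. Qed.

Lemma data_continuous k : [/\ continuous (component0 m0 k), continuous (component0 E0 k)
  & continuous (component0 H0 k)].
Proof.
have sc (F : space3 R -> vec R) : smooth setT F -> continuous (component0 F k).
  move=> sF x; apply: differentiable_continuous.
  exact: (smooth_coord k (@openT _) sF) [::] x I.
by split; apply: sc; [exact: (data_m_smooth ad)|exact: (data_E_smooth ad)|exact: (data_H_smooth ad)].
Qed.

Lemma initial_unit x : d3 (fun k => component0 m0 k x) (fun k => component0 m0 k x) = 1.
Proof.
have c k : component m k (t, x) @[t --> 0^'+] --> component0 m0 k x by have [] := strong_traces k x.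
have C : d3 (fun k => component m k (t, x)) (fun k => component m k (t, x)) @[t --> 0^'+] -->
    d3 (fun k => component0 m0 k x) (fun k => component0 m0 k x).
  under eq_fun do rewrite d3E; rewrite d3E.
  by apply: cvgD; [apply: cvgD|]; apply: cvgM; exact: c.
rewrite -(cvg_lim (@norm_hausdorff _ _) C); apply: cvg_lim; first exact: norm_hausdorff.
apply: cvg_near_cst; near=> t; apply: strong_unit; rewrite slabE /=.
by apply/andP; split; near: t; [exact: nbhs_right_gt|exact: nbhs_right_lt].
Unshelve. all: by end_near. Qed.

Lemma initial_orthogonal i x :
  d3 (fun k => component0 m0 k x) (fun k => 'D_(ex i) (component0 m0 k) x) = 0.
Proof.
pose f : space3 R -> R := fun q => d3 (fun k => component0 m0 k q) (fun k => component0 m0 k q).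
have fc : f = cst (1:R) by apply/funext => q; exact: initial_unit.
have D k := derivableP (smooth_derivable (sm0 k) I : derivable (component0 m0 k) x (ex i)).
have fE : f = component0 m0 i0 * component0 m0 i0 + component0 m0 i1 * component0 m0 i1 + component0 m0 i2 * component0 m0 i2.
  by apply/funext => q; rewrite /f d3E.
have := is_deriveD (is_deriveD (is_deriveM (D i0) (D i0)) (is_deriveM (D i1) (D i1)))
  (is_deriveM (D i2) (D i2)).
rewrite -fE fc => -[_]; rewrite derive_cst /GRing.scale /= d3E.
move: ('D_(ex i) _ x) ('D_(ex i) _ x) ('D_(ex i) _ x) (component0 m0 _ x) (component0 m0 _ x) (component0 m0 _ x).
by move=> a b c y z t h; lra.
Qed.

Lemma initial_laplacian i x :
  d3 (fun k => component0 m0 k x) (fun k => 'D_(ex i) ('D_(ex i) (component0 m0 k)) x) =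
  - d3 (fun k => 'D_(ex i) (component0 m0 k) x) (fun k => 'D_(ex i) (component0 m0 k) x).
Proof.
pose f : space3 R -> R := fun q => d3 (fun k => component0 m0 k q) (fun k => 'D_(ex i) (component0 m0 k) q).
have fc : f = cst (0:R) by apply/funext => q; exact: initial_orthogonal.
have D k := derivableP (smooth_derivable (sm0 k) I : derivable (component0 m0 k) x (ex i)).
have D2 k := derivableP (@mdx0_derivable i k x).
have fE : f = component0 m0 i0 * 'D_(ex i) (component0 m0 i0) + component0 m0 i1 * 'D_(ex i) (component0 m0 i1) + component0 m0 i2 * 'D_(ex i) (component0 m0 i2).
  by apply/funext => q; rewrite /f d3E.
have := is_deriveD (is_deriveD (is_deriveM (D i0) (D2 i0)) (is_deriveM (D i1) (D2 i1)))
  (is_deriveM (D i2) (D2 i2)).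
rewrite -fE fc => -[_]; rewrite derive_cst /GRing.scale /= !d3E.
move: ('D_(ex i) ('D_(ex i) _) x) ('D_(ex i) ('D_(ex i) _) x) ('D_(ex i) ('D_(ex i) _) x).
move: ('D_(ex i) _ x) ('D_(ex i) _ x) ('D_(ex i) _ x) (component0 m0 _ x) (component0 m0 _ x) (component0 m0 _ x).
by move=> a b c y z t a' b' c' h; lra.
Qed.

Definition initial_density x : R :=
  d3 (fun k => component0 H0 k x) (fun k => component0 H0 k x)
  + d3 (fun k => component0 E0 k x) (fun k => component0 E0 k x)
  + \sum_(i < 3) d3 (fun k => 'D_(ex i) (component0 m0 k) x) (fun k => 'D_(ex i) (component0 m0 k) x).

End StrongSolution.

(** * The pointwise relative energy inequality *)

Section RelativeEnergy.
Context {R : realType}.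
Notation V := ('I_3 -> R).
Implicit Types a b c : V.

Lemma d3_lin a b c (s t : R) : d3 a (fun k => s * b k + t * c k) = s * d3 a b + t * d3 a c.
Proof. by rewrite !d3E; ring. Qed.

Lemma d3_young_cross_abs (s : R) a b c (P : R) : 0 < s -> d3 b b <= P ->
  `|2 * d3 a (c3 b c)| <= s * d3 a a + s^-1 * (P * d3 c c).
Proof.
move=> s0 bP; rewrite ler_norml; apply/andP; split; first exact: d3_young_cross.
have := d3_young_cross (fun k => - a k) c s0 bP.
have -> : d3 (fun k => - a k) (fun k => - a k) = d3 a a by rewrite !d3E; ring.
have -> : d3 (fun k => - a k) (c3 b c) = - d3 a (c3 b c) by rewrite !d3E; ring.
by rewrite mulrN lerN2.
Qed.

(** The fields of both solutions at one point, and the values there of a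
    weight and of its derivatives. *)
Variables (w u p E1 H1 E2 H2 Wt ut E1t H1t : V) (W ux px uxx uxt E1x H1x : 'I_3 -> V).
Variables (th tht : R) (thx : V).

Let dl k := w k - u k.
Let dlt k := Wt k - ut k.
Let dE k := E2 k - E1 k.
Let dH k := H2 k - H1 k.
Let dx i k := W i k - ux i k.

Definition tested_faraday := d3 H2 (fun k => tht * H1 k + th * H1t k)
  - d3 E2 (fun k => th * curl3 H1x k + c3 thx H1 k) - th * d3 Wt H1.
Definition tested_ampere := d3 E2 (fun k => tht * E1 k + th * E1t k)
  + d3 H2 (fun k => th * curl3 E1x k + c3 thx E1 k).
Definition tested_mixed i k := W i k * (tht * ux i k + th * uxt i k)
  - Wt k * (thx i * ux i k + th * uxx i k).
Definition tested_landau_lifshitz (f : V) (fx : 'I_3 -> V) :=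
  th * (d3 Wt f + d3 (c3 w Wt) f - 2 * d3 (c3 w H2) f + \sum_(i < 3) 2 * d3 (c3 w (W i)) (fx i))
  + \sum_(i < 3) 2 * thx i * d3 (c3 w (W i)) f.
Definition tested_gradm i (f fx : V) :=
  th * (d3 (W i) f + d3 w fx) + thx i * d3 w f.
Definition tested_gradm1 i (f fx : R) := thx i * f + th * fx.
Definition tested_trace (f ft : V) := tht * d3 w f + th * (d3 w ft + d3 Wt f).

(** The magnetic and electric equations are tested with the strong H1 and E1
    and Green's formula with the gradient of u: this produces the scalar
    products of the two solutions in the relative energy. The Landau-Lifshitz
    equation tested with p and the terms with c3 p (ux i) remove what is
    linear in the difference; the tests with u and with c3 (ux i) u do the
    same for |w - u|^2 = 2 - 2 w . u. *)
Definition tested_total :=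
  2 * tested_faraday + 2 * tested_ampere
  + 2 * (\sum_(i < 3) \sum_(k < 3) tested_mixed i k)
  - tested_landau_lifshitz p px
  - 2 * (\sum_(i < 3) tested_gradm i (c3 p (ux i)) (fun k => c3 (px i) (ux i) k + c3 p (uxx i) k))
  + 2 * (\sum_(i < 3) tested_gradm1 i (d3 u (c3 p (ux i)))
       (d3 u (fun k => c3 (px i) (ux i) k + c3 p (uxx i) k)))
  + 2 * (tested_trace u ut - tht)
  - 2 * tested_landau_lifshitz u ux
  + 4 * (\sum_(i < 3) tested_gradm i (c3 (ux i) u) (c3 (uxx i) u)).

Let energy2 := d3 E2 E2 + d3 H2 H2 + \sum_(i < 3) d3 (W i) (W i).
Let energy1 := d3 E1 E1 + d3 H1 H1 + \sum_(i < 3) d3 (ux i) (ux i).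
Let denergy := d3 dE dE + d3 dH dH + \sum_(i < 3) d3 (dx i) (dx i).

Hypotheses (w1 : d3 w w = 1) (u1 : d3 u u = 1).
Hypotheses (hut : forall k, ut k = c3 p u k)
  (hH1 : forall k, H1 k = (ut k - p k) / 2 - \sum_(i < 3) uxx i k)
  (hH1t : forall k, H1t k = - ut k - curl3 E1x k)
  (hE1t : forall k, E1t k = curl3 H1x k)
  (huxt : forall i k, uxt i k = c3 (px i) u k + c3 p (ux i) k).

(** Quadratic in the difference, without derivatives of the weight. *)
Let main := - d3 dlt (c3 p dl) + 2 * d3 dH (c3 p dl) - 2 * (\sum_(i < 3) d3 (dx i) (c3 (px i) dl))
  - 2 * d3 dlt (c3 u dl) - 4 * (\sum_(i < 3) d3 (dx i) (c3 (ux i) dl)) + 4 * d3 dH (c3 u dl).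

(** The contribution of the space gradient of the weight. *)
Let cut := 2 * (d3 H2 (c3 thx E1) - d3 E2 (c3 thx H1))
  + \sum_(i < 3) thx i * (- 2 * d3 Wt (ux i) - 2 * d3 (W i) ut - 2 * d3 (W i) (c3 p dl)
     + 2 * d3 (ux i) (c3 p dl) - 4 * d3 (W i) (c3 u dl) + 4 * d3 (ux i) (c3 u dl)).

Let dt_part : 2 * d3 H2 H1 + 2 * d3 E2 E1 + 2 * (\sum_(i < 3) d3 (W i) (ux i)) + 2 * (d3 w u - 1)
  = energy2 + energy1 - denergy - d3 dl dl.
Proof.
have sq a b : d3 (fun k => a k - b k) (fun k => a k - b k) = d3 a a + d3 b b - 2 * d3 a b.
  by rewrite !d3E; ring.
rewrite /denergy /energy1 /energy2 /dl /dE /dH /dx !sum3E !sq w1 u1; ring.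
Qed.

Let mixedE i : \sum_(k < 3) tested_mixed i k =
  tht * d3 (W i) (ux i) + th * (d3 (W i) (uxt i) - d3 Wt (uxx i)) - thx i * d3 Wt (ux i).
Proof. by rewrite sum3E /tested_mixed !d3E; ring. Qed.

Let th_part : d3 Wt Wt + d3 ut ut
  + 2 * (d3 H2 H1t - d3 E2 (curl3 H1x) - d3 Wt H1 + d3 E2 E1t + d3 H2 (curl3 E1x))
  + 2 * (\sum_(i < 3) (d3 (W i) (uxt i) - d3 Wt (uxx i)))
  - (d3 Wt p + d3 (c3 w Wt) p - 2 * d3 (c3 w H2) p + \sum_(i < 3) 2 * d3 (c3 w (W i)) (px i))
  - 2 * (\sum_(i < 3) (d3 (W i) (c3 p (ux i)) + (d3 dl (c3 (px i) (ux i)) + d3 dl (c3 p (uxx i)))))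
  + 2 * (d3 w ut + d3 Wt u)
  - 2 * (d3 Wt u + d3 (c3 w Wt) u - 2 * d3 (c3 w H2) u + \sum_(i < 3) 2 * d3 (c3 w (W i)) (ux i))
  + 4 * (\sum_(i < 3) (d3 (W i) (c3 (ux i) u) + d3 w (c3 (uxx i) u)))
  = d3 dlt dlt + main.
Proof.
pose L k := \sum_(i < 3) uxx i k.
have b1 : d3 H2 H1t = - d3 H2 ut - d3 H2 (curl3 E1x) by rewrite !d3E !hH1t; ring.
have b2 : d3 E2 E1t = d3 E2 (curl3 H1x) by rewrite !d3E !hE1t.
have b3 : d3 Wt L = d3 Wt (uxx i0) + d3 Wt (uxx i1) + d3 Wt (uxx i2).
  by rewrite !d3E /L !sum3E; ring.
have b4 : d3 dl (c3 p L) = d3 dl (c3 p (uxx i0)) + d3 dl (c3 p (uxx i1)) + d3 dl (c3 p (uxx i2)).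
  by rewrite !d3E !c3E /L !sum3E; ring.
have b5 : d3 w (c3 L u) = d3 w (c3 (uxx i0) u) + d3 w (c3 (uxx i1) u) + d3 w (c3 (uxx i2) u).
  by rewrite !d3E !c3E /L !sum3E; ring.
have b6 : d3 dlt dlt = d3 Wt Wt + d3 ut ut - 2 * d3 ut Wt.
  by rewrite !d3E /dlt; ring.
have rt := @relative_time R w u p dl L ut H1 Wt H2 (fun=> erefl) hut hH1.
have dt := @distance_time R w u p dl L ut H1 Wt H2 (fun=> erefl) hut hH1.
have rs i := @relative_space R w u p dl (W i) (ux i) (uxx i) (px i) (uxt i) (fun=> erefl) (huxt i).
have ds i := @distance_space R w u dl (W i) (ux i) (fun=> erefl).
rewrite b6 /main !sum3E.
have := rs i0; have := rs i1; have := rs i2; have := ds i0; have := ds i1; have := ds i2.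
move: rt dt b1 b2 b3 b4 b5 => {rs ds b6}; rewrite -/dlt -/dH.
rewrite -[fun k => W i0 k - ux i0 k]/(dx i0) -[fun k => W i1 k - ux i1 k]/(dx i1) -[fun k => W i2 k - ux i2 k]/(dx i2).
lra.
Qed.

Let cut_part i : - 2 * d3 Wt (ux i) - 2 * d3 (c3 w (W i)) p - 2 * d3 w (c3 p (ux i))
    + 2 * d3 u (c3 p (ux i)) - 4 * d3 (c3 w (W i)) u + 4 * d3 w (c3 (ux i) u) =
  - 2 * d3 Wt (ux i) - 2 * d3 (W i) ut - 2 * d3 (W i) (c3 p dl)
     + 2 * d3 (ux i) (c3 p dl) - 4 * d3 (W i) (c3 u dl) + 4 * d3 (ux i) (c3 u dl).
Proof. by rewrite !d3E !c3E !hut !c3E /dl; ring. Qed.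

Let d3_sum a b c : d3 a (fun k => b k + c k) = d3 a b + d3 a c.
Proof. by rewrite !d3E; ring. Qed.
Let d3_lin1 a b c s : d3 a (fun k => s * b k + c k) = s * d3 a b + d3 a c.
Proof. by rewrite !d3E; ring. Qed.
Let d3_dl a : d3 w a - d3 u a = d3 dl a.
Proof. by rewrite !d3E /dl; ring. Qed.

(** The energies of both solutions plus the tested equations reproduce the
    energy of the difference, up to quadratic errors and cutoff terms. *)
Lemma tested_totalE :
  - tht * energy2 + th * d3 Wt Wt + (- tht * energy1 + th * d3 ut ut) + tested_total =
  - tht * (denergy + d3 dl dl) + th * (d3 dlt dlt + main) + cut.
Proof.
rewrite -th_part.
have -> : denergy + d3 dl dl = energy2 + energy1 - (2 * d3 H2 H1 + 2 * d3 E2 E1 + 2 * (\sum_(i < 3) d3 (W i) (ux i)) + 2 * (d3 w u - 1)).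
  by rewrite dt_part; ring.
have -> : cut = 2 * (d3 H2 (c3 thx E1) - d3 E2 (c3 thx H1)) + \sum_(i < 3) thx i *
    (- 2 * d3 Wt (ux i) - 2 * d3 (c3 w (W i)) p - 2 * d3 w (c3 p (ux i))
    + 2 * d3 u (c3 p (ux i)) - 4 * d3 (c3 w (W i)) u + 4 * d3 w (c3 (ux i) u)).
  by congr (_ + _); apply: eq_bigr => i _; rewrite cut_part.
rewrite /tested_total /tested_faraday /tested_ampere /tested_landau_lifshitz /tested_gradm
  /tested_gradm1 /tested_trace.
rewrite (eq_bigr _ (fun i _ => mixedE i)).
rewrite !sum3E !d3_lin !d3_lin1 !d3_sum -!d3_dl.
ring.
Qed.

Section LowerBound.
Variables (P K kappa lam et det x : R) (y : V).
Hypotheses (x01 : 0 <= x <= 1) (et0 : 0 <= et) (let_det : lam * et <= det).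
Hypotheses (kappa0 : 0 < kappa) (kappaK : kappa <= K) (yk : forall i, `|y i| <= kappa).
Hypotheses (pP : d3 p p <= P) (pxP : forall i, d3 (px i) (px i) <= P)
  (uxP : forall i, d3 (ux i) (ux i) <= P).
Hypothesis lamP : 11 * P + 10 + (12 * P + 24) * K <= lam.
Hypotheses (hth : th = et * x ^+ 2) (htht : tht = - det * x ^+ 2)
  (hthx : forall i, thx i = et * (2 * x * y i)).

Let D0 := d3 dl dl.
Let P0 : 0 <= P. Proof. by apply: le_trans pP; exact: d3_ge0. Qed.

(** Young's inequality with weights chosen so that at most half of |dlt|^2 is
    used. *)
Let main_ge : - (2^-1 * d3 dlt dlt + 3 * denergy + (11 * P + 6) * D0) <= main.
Proof.
have s2 : 0 < 2^-1 :> R by rewrite invr_gt0.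
have s4 : 0 < 4^-1 :> R by rewrite invr_gt0.
have a1 := d3_young_cross_abs dlt dl s2 pP.
have a2 := d3_young_cross_abs dH dl ltr01 pP.
have a3 i := d3_young_cross_abs (dx i) dl ltr01 (pxP i).
have u1' : d3 u u <= 1 by rewrite u1.
have a4 := d3_young_cross_abs dlt dl s4 u1'.
have a5 i := d3_young_cross_abs (dx i) dl ltr01 (uxP i).
have a6 := d3_young_cross_abs dH dl ltr01 u1'.
have e0 := d3_ge0 dE.
rewrite /main /denergy !sum3E -/D0.
move: a1 a2 (a3 i0) (a3 i1) (a3 i2) a4 (a5 i0) (a5 i1) (a5 i2) a6.
rewrite -/D0 !invrK !invr1 !ler_norml !mul1r.
do 10!(move=> /andP[? ?]).
lra.
Qed.

Let scaled z B : `|z| <= B -> forall i, `|y i * z| <= kappa * B.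
Proof. by move=> zB i; rewrite normrM; apply: ler_pM. Qed.

Let scaledx z B : `|z| <= B -> forall i, `|x * (y i * z)| <= kappa * B.
Proof.
move=> zB i; case/andP: x01 => x0 x1; rewrite normrM ger0_norm//.
rewrite -[leRHS]mul1r; apply: ler_pM => //; exact: scaled.
Qed.

Let young_abs a b : `|2 * d3 a b| <= d3 a a + d3 b b.
Proof.
rewrite ler_norml; apply/andP; split; first exact: d3_young.
have := d3_young (fun k => - a k) b.
have -> : d3 (fun k => - a k) (fun k => - a k) = d3 a a by rewrite !d3E; ring.
have -> : d3 (fun k => - a k) b = - d3 a b by rewrite !d3E; ring.
by rewrite mulrN lerN2.
Qed.

Let cross_abs a b Q : d3 b b <= Q -> `|x * (2 * d3 a (c3 b dl))| <= d3 a a + Q * (x ^+ 2 * D0).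
Proof.
move=> bQ; have := d3_young_cross_abs a (fun k => x * dl k) ltr01 bQ.
have -> : d3 a (c3 b (fun k => x * dl k)) = x * d3 a (c3 b dl) by rewrite !d3E !c3E; ring.
have -> : d3 (fun k => x * dl k) (fun k => x * dl k) = x ^+ 2 * D0 by rewrite /D0 !d3E; ring.
by rewrite invr1 !mul1r mulrCA.
Qed.

Let y2 : d3 y y <= 3 * kappa ^+ 2.
Proof.
have h i : y i * y i <= kappa ^+ 2.
  by have := yk i; rewrite ler_norml => /andP[*]; rewrite expr2; nra.
by rewrite d3E; have := h i0; have := h i1; have := h i2; lra.
Qed.

Let cross_y a b : `|x * (2 * d3 a (c3 y b))| <= kappa * (d3 a a + 3 * d3 b b).
Proof.
case/andP: x01 => x0 x1; rewrite normrM ger0_norm//.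
have h := d3_young_cross_abs a b kappa0 y2.
have h2 : kappa^-1 * (3 * kappa ^+ 2 * d3 b b) = kappa * (3 * d3 b b) by field; rewrite gt_eqF.
rewrite h2 -mulrDr in h.
by rewrite -[leRHS]mul1r; apply: ler_pM.
Qed.

Let cut_term i : - (kappa * (d3 Wt Wt + d3 ut ut + 4 * d3 (W i) (W i) + 4 * d3 (ux i) (ux i)
     + (2 * P + 4) * (x ^+ 2 * D0))) <=
  x * y i * (- 2 * d3 Wt (ux i) - 2 * d3 (W i) ut - 2 * d3 (W i) (c3 p dl)
     + 2 * d3 (ux i) (c3 p dl) - 4 * d3 (W i) (c3 u dl) + 4 * d3 (ux i) (c3 u dl)).
Proof.
have u1' : d3 u u <= 1 by rewrite u1.
have := scaledx (young_abs Wt (ux i)) i; have := scaledx (young_abs (W i) ut) i.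
have := scaled (cross_abs (W i) pP) i; have := scaled (cross_abs (ux i) pP) i.
have := scaled (cross_abs (W i) u1') i; have := scaled (cross_abs (ux i) u1') i.
rewrite !ler_norml !mulrDr.
do 6!(move=> /andP[? ?]).
lra.
Qed.

(** The factor x of the gradient of the weight is attached to dl, so that
    terms containing dl are bounded by x^2 |dl|^2; all others are products of
    densities of finite energy times kappa. *)
Let cut_ge : - (et * (kappa * (8 * (energy2 + energy1 + d3 Wt Wt + d3 ut ut)
     + (12 * P + 24) * (x ^+ 2 * D0)))) <= cut.
Proof.
have lin a b c : (forall k, b k = et * (2 * x * y k)) -> d3 a (c3 b c) = et * (x * (2 * d3 a (c3 y c))).
  by move=> hb; rewrite !d3E !c3E !hb; ring.
have -> : cut = et * (2 * (x * (2 * d3 H2 (c3 y E1))) - 2 * (x * (2 * d3 E2 (c3 y H1))) +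
   2 * \sum_(i < 3) x * y i * (- 2 * d3 Wt (ux i) - 2 * d3 (W i) ut - 2 * d3 (W i) (c3 p dl)
     + 2 * d3 (ux i) (c3 p dl) - 4 * d3 (W i) (c3 u dl) + 4 * d3 (ux i) (c3 u dl))).
  rewrite /cut (lin H2 thx E1 hthx) (lin E2 thx H1 hthx) !sum3E !hthx; ring.
rewrite -mulrN ler_wpM2l// sum3E.
have := cut_term i0; have := cut_term i1; have := cut_term i2.
have := cross_y H2 E1; have := cross_y E2 H1; rewrite !ler_norml => /andP[h1 h2] /andP[h3 h4].
have [g1 g2 g3 g4] := And4 (mulr_ge0 (ltW kappa0) (d3_ge0 H2)) (mulr_ge0 (ltW kappa0) (d3_ge0 E2))
  (mulr_ge0 (ltW kappa0) (d3_ge0 H1)) (mulr_ge0 (ltW kappa0) (d3_ge0 E1)).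
have [g5 g6] := conj (mulr_ge0 (ltW kappa0) (d3_ge0 Wt)) (mulr_ge0 (ltW kappa0) (d3_ge0 ut)).
rewrite /energy2 /energy1 !sum3E.
move: h1 h2 h3 h4 g1 g2 g3 g4 g5 g6; rewrite !mulrDr.
lra.
Qed.

(** The decay rate lam is chosen in lamP to absorb all errors that are
    quadratic in the difference, multiplied by the weight et * x ^+ 2. What is
    left of the cutoff terms is of size kappa times the densities of both
    solutions, which the weighted energies control since et <= det. *)
Lemma relative_energy_le :
  et * x ^+ 2 * (denergy + d3 dl dl) <=
  (1 + 8 * kappa) * ((det * energy2 + et * d3 Wt Wt) + (det * energy1 + et * d3 ut ut))
  + tested_total.
Proof.
have e20 : 0 <= energy2 by rewrite /energy2 sum3E !addr_ge0// d3_ge0.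
have e10 : 0 <= energy1 by rewrite /energy1 sum3E !addr_ge0// d3_ge0.
have De0 : 0 <= denergy by rewrite /denergy sum3E !addr_ge0// d3_ge0.
have D00 : 0 <= D0 by exact: d3_ge0.
have Dt0 : 0 <= d3 dlt dlt by exact: d3_ge0.
have Wt0 : 0 <= d3 Wt Wt by exact: d3_ge0.
have ut0 : 0 <= d3 ut ut by exact: d3_ge0.
have K0 : 0 <= K by apply: le_trans (ltW kappa0) kappaK.
have PK0 : 0 <= (12 * P + 24) * K by rewrite mulr_ge0// addr_ge0// mulr_ge0.
have lam4 : 4 <= lam by apply: le_trans lamP; move: PK0 P0; lra.
have et_det : et <= det by apply: le_trans let_det; rewrite ler_peMl//; lra.
have det0 : 0 <= det by exact: le_trans et_det.
case/andP: x01 => x0 x1.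
have x2 : x ^+ 2 <= 1 by rewrite expr_le1.
have q0 : 0 <= et * x ^+ 2 by rewrite mulr_ge0// sqr_ge0.
have A2 : det * x ^+ 2 * energy2 <= det * energy2 by rewrite ler_wpM2r// ler_piMr.
have A1 : det * x ^+ 2 * energy1 <= det * energy1 by rewrite ler_wpM2r// ler_piMr.
have AW : et * x ^+ 2 * d3 Wt Wt <= et * d3 Wt Wt by rewrite ler_wpM2r// ler_piMr.
have Au : et * x ^+ 2 * d3 ut ut <= et * d3 ut ut by rewrite ler_wpM2r// ler_piMr.
have B2 : kappa * (et * energy2) <= kappa * (det * energy2) by rewrite ler_wpM2l ?(ltW kappa0)// ler_wpM2r.
have B1 : kappa * (et * energy1) <= kappa * (det * energy1) by rewrite ler_wpM2l ?(ltW kappa0)// ler_wpM2r.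
have h1 : lam * (et * x ^+ 2) * (denergy + D0) <= det * x ^+ 2 * (denergy + D0).
  by apply: ler_wpM2r; [rewrite addr_ge0|rewrite [leLHS]mulrA; apply: ler_wpM2r; rewrite ?sqr_ge0].
have h2 := ler_wpM2l q0 main_ge.
have h3 : kappa * ((12 * P + 24) * (et * x ^+ 2 * D0)) <= K * ((12 * P + 24) * (et * x ^+ 2 * D0)).
  by rewrite ler_wpM2r// mulr_ge0 ?(mulr_ge0 q0)// addr_ge0// mulr_ge0.
have h4 : (11 * P + 10 + (12 * P + 24) * K) * (et * x ^+ 2 * D0) <= lam * (et * x ^+ 2 * D0).
  by rewrite ler_wpM2r// (mulr_ge0 q0).
have h5 : 4 * (et * x ^+ 2 * denergy) <= lam * (et * x ^+ 2 * denergy).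
  by rewrite ler_wpM2r// (mulr_ge0 q0).
have h6 : 0 <= et * x ^+ 2 * d3 dlt dlt by rewrite mulr_ge0.
have h7 : 0 <= et * x ^+ 2 * D0 by rewrite mulr_ge0.
have Z := tested_totalE; have C := cut_ge.
rewrite hth htht in Z.
rewrite -/D0 in Z *.
move: tested_total Z C h1 h2 h3 h4 h5 h6 h7 A2 A1 AW Au B2 B1 => S.
move: energy2 energy1 denergy D0 main cut (d3 dlt dlt) (d3 Wt Wt) (d3 ut ut) => e2 e1 De D mn ct Dt nW nu.
rewrite !mulNr !opprK => Z C h1 h2 h3 h4 h5 h6 h7 A2 A1 AW Au B2 B1.
have -> : S = det * x ^+ 2 * (De + D) + et * x ^+ 2 * (Dt + mn) + ct - (det * x ^+ 2 * e2 + et * x ^+ 2 * nW + (det * x ^+ 2 * e1 + et * x ^+ 2 * nu)).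
  by rewrite -Z; ring.
lra.
Qed.

End LowerBound.
End RelativeEnergy.

(** * A limit and a finiteness argument for nonnegative integrands *)

Section IntegralLimits.
Context d (X : measurableType d) {R : realType} (mu : {measure set X -> \bar R}).

(** Fatou's lemma. *)
Lemma ae_zero_of_limit A (f_ : (X -> R)^nat) f (a : R^nat) : measurable A ->
  (forall n, measurable_fun A (f_ n)) -> (forall n x, A x -> 0 <= f_ n x) ->
  (forall x, A x -> f_ n x @[n --> \oo] --> f x) ->
  (forall n, (\int[mu]_(x in A) (f_ n x)%:E <= (a n)%:E)%E) ->
  a n @[n --> \oo] --> (0 : R) ->
  {ae mu, forall x, A x -> f x = 0}.
Proof.
move=> mA mf_ f_0 f_f fa a0.
have mf : measurable_fun A f by apply: measurable_fun_cvg mf_ f_f.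
have f0 x : A x -> 0 <= f x.
  move=> Ax; rewrite -(cvg_lim (@norm_hausdorff _ _) (@f_f x Ax)).
  apply: limr_ge; first by apply/cvg_ex; exists (f x); exact: f_f.
  by apply: nearW => n; exact: f_0.
have F : (\int[mu]_(x in A) (f x)%:E <= 0)%E.
  have -> : (\int[mu]_(x in A) (f x)%:E = \int[mu]_(x in A) limn_einf (fun n => (f_ n x)%:E))%E.
    apply: eq_integral => x /set_mem Ax.
    have h : (f_ n x)%:E @[n --> \oo] --> (f x)%:E.
      by apply: cvg_EFin; [exact: nearW|exact: f_f].
    by have [-> _] := cvg_limn_einf_sup h.
  apply: (le_trans (fatou mu mA _ _)).
  - by move=> n; exact/measurable_EFinP.
  - by move=> n x Ax; rewrite lee_fin; exact: f_0.
  have h : (\int[mu]_(x in A) (f_ n x)%:E)%E @[n --> \oo] --> 0%E.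
    apply: (@squeeze_cvge _ _ _ _ (cst 0%E) _ (fun n => (a n)%:E)).
    - apply: nearW => n; rewrite fa andbT; apply: integral_ge0 => x Ax.
      by rewrite lee_fin f_0.
    - exact: cvg_cst.
    - by apply: cvg_EFin; [exact: nearW|].
  by have [-> _] := cvg_limn_einf_sup h.
have I0 : (\int[mu]_(x in A) `|(f x)%:E| = 0)%E.
  apply/eqP; rewrite eq_le integral_ge0// andbT.
  rewrite (eq_integral (fun x => (f x)%:E))// => x /set_mem Ax.
  by rewrite /= ger0_norm// f0.
have mfE : measurable_fun A (EFin \o f) by exact/measurable_EFinP.
have [+ _] := ae_eq_integral_abs mu mA mfE.
move=> /(_ I0); apply: (@filterS _ _ (ae_filter_ringOfSetsType mu)) => x h Ax.
by have /= := h Ax; case.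
Qed.

Lemma has_int_of_bound A (f g : X -> R) (c : R) : measurable A ->
  measurable_fun A f -> measurable_fun A g ->
  (forall x, A x -> 0 <= f x) -> (forall x, A x -> 0 <= g x) ->
  (\int[mu]_(x in A) (f x)%:E + \int[mu]_(x in A) (g x)%:E <= c%:E)%E ->
  exists2 a, has_int mu A (fun x => f x + g x) a & a <= c.
Proof.
move=> mA mf mg f0 g0 h.
have i0 k : (forall x, A x -> 0 <= k x) -> (0 <= \int[mu]_(x in A) (k x)%:E)%E.
  by move=> k0; apply: integral_ge0 => x Ax; rewrite lee_fin k0.
have lf : (\int[mu]_(x in A) (f x)%:E < +oo)%E.
  by apply: (@le_lt_trans _ _ c%:E); rewrite ?ltry//; apply: le_trans h; rewrite leeDl// i0.
have lg : (\int[mu]_(x in A) (g x)%:E < +oo)%E.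
  by apply: (@le_lt_trans _ _ c%:E); rewrite ?ltry//; apply: le_trans h; rewrite leeDr// i0.
have abs k : (forall x, A x -> 0 <= k x) ->
    (\int[mu]_(x in A) (`|k x|)%:E = \int[mu]_(x in A) (k x)%:E)%E.
  by move=> k0; apply: eq_integral => x /set_mem Ax; rewrite ger0_norm// k0.
have jf : intg mu A f by apply: intgP => //; rewrite abs.
have jg : intg mu A g by apply: intgP => //; rewrite abs.
exists (\int[mu]_(x in A) f x + \int[mu]_(x in A) g x).
  by apply: has_intD.
rewrite -lee_fin EFinD /Rintegral !fineK//; apply: integrable_fin_num => //.
Qed.

End IntegralLimits.

(** * The combination of the tested equations *)

Section TotalTest.
Context {R : realType}.
Notation mu3 := (@leb3 R).
Notation mu4 := (@leb4 R).
Variables (m E H m' E' H' : spacetime R -> vec R) (Dm : 'I_3 -> spacetime R -> vec R)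
  (mt : spacetime R -> vec R) (m0 E0 H0 : space3 R -> vec R).
Variables (T T1 r : R) (theta : spacetime R -> R).
Hypotheses (T10 : 0 < T1) (T1T : T1 < T) (Tr : T <= r) (ct : cutoff T1 r theta).
Hypothesis ad : admissible_data m0 E0 H0.
Hypothesis ws : weak_solution_with m E H Dm mt m0 E0 H0.
Hypothesis ss : smooth_solution T m' E' H' m0 E0 H0.

Let T0 : 0 < T. Proof. exact: lt_trans T1T. Qed.
Let mS := @measurable_slab R T.

Let u := component m'.
Let pf := mfield m' H'.
Let ux := mdx m'.

Let cm0 k : continuous (component0 m0 k). Proof. by have [] := data_continuous ad k. Qed.
Let cE0 k : continuous (component0 E0 k). Proof. by have [] := data_continuous ad k. Qed.
Let cH0 k : continuous (component0 H0 k). Proof. by have [] := data_continuous ad k. Qed.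
Let tu k : tame T (u k). Proof. by have [] := strong_tame ss k. Qed.
Let tE k : tame T (component E' k). Proof. by have [] := strong_tame ss k. Qed.
Let tH k : tame T (component H' k). Proof. by have [] := strong_tame ss k. Qed.
Let tp k : tame T (pf k). Proof. exact: (tame_mfield ss). Qed.
Let tux i k : tame T (ux i k). Proof. exact: (tame_mdx ss). Qed.
Let u_u0 k x : u k (t, x) @[t --> 0^'+] --> component0 m0 k x.
Proof. by have [] := strong_traces ss k x. Qed.
Let E_E0 k x : component E' k (t, x) @[t --> 0^'+] --> component0 E0 k x.
Proof. by have [] := strong_traces ss k x. Qed.
Let H_H0 k x : component H' k (t, x) @[t --> 0^'+] --> component0 H0 k x.
Proof. by have [] := strong_traces ss k x. Qed.

Let g0 i k : space3 R -> R := 'D_(ex i) (component0 m0 k).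

Definition relative_test (p : spacetime R) : R :=
  tested_total (m p 0) (u^~ p) (pf^~ p) ((component E')^~ p) ((component H')^~ p) (E p 0) (H p 0) (mt p 0)
    ((mdt m')^~ p) (fun k => 'D_dirt (component E' k) p) (fun k => 'D_dirt (component H' k) p)
    (fun i => Dm i p 0) (fun i k => ux i k p) (fun i k => 'D_(dirx i) (pf k) p)
    (fun i k => mdxx m' i k p) (fun i k => 'D_dirt (ux i k) p)
    (fun i k => 'D_(dirx i) (component E' k) p) (fun i k => 'D_(dirx i) (component H' k) p)
    (theta p) ('D_dirt theta p) (fun i => 'D_(dirx i) theta p).

Definition initial_test : R :=
  2 * (\sum_(k < 3) - \int[mu3]_x (component0 H0 k x * (theta (0, x) * component0 H0 k x)))
  + 2 * (\sum_(k < 3) - \int[mu3]_x (component0 E0 k x * (theta (0, x) * component0 E0 k x)))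
  + 2 * (\sum_(i < 3) \sum_(k < 3)
      ((\int[mu3]_x (component0 m0 k x * ('D_(dirx i) theta (0, x) * g0 i k x)))
    + \int[mu3]_x (component0 m0 k x * (theta (0, x) * 'D_(ex i) (g0 i k) x))))
  + 2 * ((\sum_(k < 3) - \int[mu3]_x (component0 m0 k x * (theta (0, x) * component0 m0 k x)))
     + \int[mu3]_x (theta (0, x) * 1)).

Let crossf_self (a : 'I_3 -> R) k : c3 a a k = 0.
Proof. by rewrite /c3 mulrC subrr. Qed.

Let dotf (f g : 'I_3 -> spacetime R -> R) : spacetime R -> R :=
  f i0 * g i0 + f i1 * g i1 + f i2 * g i2.

Let tame_dotf f g : (forall k, tame T (f k)) -> (forall k, tame T (g k)) -> tame T (dotf f g).
Proof. by move=> tf tg; apply: tameD; [apply: tameD|]; apply: tameM. Qed.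

Let dotf_derive f g v p : (forall k, tame T (f k)) -> (forall k, tame T (g k)) -> slab T p ->
  'D_v (dotf f g) p = d3 (fun k => 'D_v (f k) p) (g^~ p) + d3 (f^~ p) (fun k => 'D_v (g k) p).
Proof.
move=> tf tg Tp.
have D j := is_deriveM (derivableP (@tame_derivable _ _ _ v p (tf j) Tp)) (derivableP (@tame_derivable _ _ _ v p (tg j) Tp)).
have [_ ->] := is_deriveD (is_deriveD (D i0) (D i1)) (D i2).
rewrite /GRing.scale /= !d3E.
move: ('D_v _ _) ('D_v _ _) ('D_v _ _) ('D_v _ _) ('D_v _ _) ('D_v _ _) => a b c d e f'.
by move: (f _ p) (g _ p) (f _ p) (g _ p) (f _ p) (g _ p) => x y z t x' y'; ring.
Qed.

Let pxu i k := crossf pf (ux i) k.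
Let tpxu i k : tame T (pxu i k). Proof. exact: tame_crossf. Qed.
Let uxu i k := crossf (ux i) u k.
Let tuxu i k : tame T (uxu i k). Proof. exact: tame_crossf. Qed.

Let sum0 : \sum_(i < 3) (0 : R) = 0. Proof. by rewrite big1. Qed.

Let pxu_derive i p : slab T p -> (fun k => 'D_(dirx i) (pxu i k) p) =
  (fun k => c3 (fun k => 'D_(dirx i) (pf k) p) (fun k => ux i k p) k
     + c3 (pf^~ p) (fun k => mdxx m' i k p) k).
Proof. by move=> Tp; apply/funext => k; exact: (crossf_derive k (dirx i) tp (tux i) Tp). Qed.

Let uxu_derive i p : slab T p -> (fun k => 'D_(dirx i) (uxu i k) p) =
  c3 (fun k => mdxx m' i k p) (u^~ p).
Proof.
move=> Tp; apply/funext => k; apply: (eq_trans (crossf_derive k (dirx i) (tux i) tu Tp)).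
by rewrite [X in _ + X](crossf_self (fun k => ux i k p)) addr0.
Qed.

Let upxu_derive i p : slab T p -> 'D_(dirx i) (dotf u (pxu i)) p =
  d3 (u^~ p) (fun k => c3 (fun k => 'D_(dirx i) (pf k) p) (fun k => ux i k p) k
     + c3 (pf^~ p) (fun k => mdxx m' i k p) k).
Proof.
move=> Tp; apply: (eq_trans (dotf_derive (dirx i) tu (tpxu i) Tp)).
rewrite (pxu_derive i Tp) -[RHS]add0r; congr (_ + _).
have triple (a b : 'I_3 -> R) : d3 a (c3 b a) = 0 by rewrite !d3E !c3E; ring.
exact: (triple (fun k => ux i k p) (pf^~ p)).
Qed.

Lemma relative_testP : has_int mu4 (slab T) relative_test initial_test.
Proof.
have F1 := test_faraday ws cH0 T10 T1T Tr ct tH H_H0.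
have F2 := test_ampere ws cE0 T10 T1T Tr ct tE E_E0.
have F34 := has_int_sum mS (fun i : 'I_3 => has_int_sum mS (fun k : 'I_3 =>
  test_mixed ws cm0 T10 T1T Tr k ct (tux i k) (@mdx_trace R T m' E' H' m0 E0 H0 T0 ad ss i k)
    (@mdx0_derivable R m0 E0 H0 ad i k))).
have F5 := test_landau_lifshitz3 ws T10 T1T Tr ct tp.
have F6 := has_int_sum mS (fun i : 'I_3 => test_gradm3 ws T10 T1T Tr ct (tpxu i) i).
have F6' := has_int_sum mS (fun i : 'I_3 => test_gradm1 T10 T1T Tr ct (tame_dotf tu (tpxu i)) i).
have F7 := test_trace3 ws cm0 T10 T1T Tr ct tu u_u0.
have F8 := test_landau_lifshitz3 ws T10 T1T Tr ct tu.
have F9 := has_int_sum mS (fun i : 'I_3 => test_gradm3 ws T10 T1T Tr ct (tuxu i) i).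
have G6 : has_int mu4 (slab T) (fun p => \sum_(i < 3) tested_gradm (m p 0) (fun i => Dm i p 0)
   (theta p) (fun i => 'D_(dirx i) theta p) i
   (c3 (pf^~ p) (fun k => ux i k p)) (fun k => c3 (fun k => 'D_(dirx i) (pf k) p) (fun k => ux i k p) k
     + c3 (pf^~ p) (fun k => mdxx m' i k p) k)) 0.
  by apply: has_int_eq F6 _ sum0 => // p Tp; apply: eq_bigr => i _; rewrite -(pxu_derive i Tp).
have G6' : has_int mu4 (slab T) (fun p => \sum_(i < 3) tested_gradm1
   (theta p) (fun i => 'D_(dirx i) theta p) i
   (d3 (u^~ p) (c3 (pf^~ p) (fun k => ux i k p))) (d3 (u^~ p) (fun k => c3 (fun k => 'D_(dirx i) (pf k) p) (fun k => ux i k p) k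
     + c3 (pf^~ p) (fun k => mdxx m' i k p) k))) 0.
  apply: has_int_eq F6' _ sum0 => // p Tp; apply: eq_bigr => i _.
  by rewrite -(upxu_derive i Tp) /tested_gradm1 d3E.
have G7' : has_int mu4 (slab T) (fun p => 'D_dirt theta p) (- (\int[mu3]_x (theta (0, x) * 1))).
  have c1 : forall x : space3 R, cst 1 ((t, x) : spacetime R) @[t --> 0^'+] --> cst (1 : R) x.
    by move=> x; apply: cvg_cst.
  apply: has_int_eq (test_trace1 T10 T1T Tr ct (tame_cst T (1 : R)) c1) _ _ => // p Tp.
  by rewrite derive_cst mulr0 addr0 mulr1.
have G9 : has_int mu4 (slab T) (fun p => \sum_(i < 3) tested_gradm (m p 0) (fun i => Dm i p 0)
   (theta p) (fun i => 'D_(dirx i) theta p) i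
   (c3 (fun k => ux i k p) (u^~ p)) (c3 (fun k => mdxx m' i k p) (u^~ p))) 0.
  by apply: has_int_eq F9 _ sum0 => // p Tp; apply: eq_bigr => i _; rewrite -(uxu_derive i Tp).
have F := has_intD mS (has_intD mS (has_intD mS (has_intD mS (has_intD mS (has_intD mS (has_intD mS
  (has_intD mS (has_intZ 2 mS F1) (has_intZ 2 mS F2)) (has_intZ 2 mS F34)) (has_intN mS F5))
  (has_intN mS (has_intZ 2 mS G6))) (has_intZ 2 mS G6')) (has_intZ 2 mS (has_intD mS F7 (has_intN mS G7'))))
  (has_intN mS (has_intZ 2 mS F8))) (has_intZ 4 mS G9).
apply: has_int_eq F _ _ => //.
rewrite !(mulr0, oppr0, addr0) opprK; reflexivity.
Qed.

Let initial_sum (M h e : 'I_3 -> R) (g gg : 'I_3 -> 'I_3 -> R) (th : R) (thx : 'I_3 -> R) :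
  d3 M M = 1 -> (forall i, d3 M (g i) = 0) -> (forall i, d3 M (gg i) = - d3 (g i) (g i)) ->
  2 * (\sum_(k < 3) - (h k * (th * h k))) + 2 * (\sum_(k < 3) - (e k * (th * e k)))
  + 2 * (\sum_(i < 3) \sum_(k < 3) (M k * (thx i * g i k) + M k * (th * gg i k)))
  + 2 * ((\sum_(k < 3) - (M k * (th * M k))) + th * 1)
  = - 2 * (th * (d3 h h + d3 e e + \sum_(i < 3) d3 (g i) (g i))).
Proof.
move=> M1 Mg Mgg.
have -> : \sum_(i < 3) \sum_(k < 3) (M k * (thx i * g i k) + M k * (th * gg i k)) =
    \sum_(i < 3) - (th * d3 (g i) (g i)).
  apply: eq_bigr => i _; transitivity (thx i * d3 M (g i) + th * d3 M (gg i)).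
    by rewrite !d3E sum3E; ring.
  by rewrite Mg Mgg mulr0 add0r mulrN.
have -> : \sum_(k < 3) - (M k * (th * M k)) = - th.
  by transitivity (- (th * d3 M M)); [rewrite !d3E sum3E; ring|rewrite M1 mulr1].
by rewrite !d3E !sum3E; ring.
Qed.

Let initial_intg th (a b : space3 R -> R) : cutoff T1 r th -> continuous a -> continuous b ->
  intg mu3 setT (fun x => a x * (th (0, x) * b x)).
Proof.
move=> [sth th0] ca cb.
have mC := @measurable_cube R r.
apply: (@intg_ext _ _ _ mu3 (cube r) setT _ mC (@measurableT _ _)) => //.
- by move=> x _ nx; rewrite th0 ?mul0r ?mulr0// => -[].
- apply: intg_cube_continuous => x; apply: cvgM; first exact: ca.
  apply: cvgM; last exact: cb.
  have cth : continuous th := smooth_continuous sth.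
  have cp : {for x, continuous (fun y : space3 R => (0, y) : spacetime R)}.
    by apply: (@cvg_pair _ _ _ _ (nbhs (0 : R)) (nbhs x)); [exact: cvg_cst|exact: cvg_id].
  exact: (@continuous_comp _ _ _ (fun y : space3 R => (0, y) : spacetime R) th _ cp (cth (0, x))).
Qed.

Let has_intT (f : space3 R -> R) : intg mu3 setT f -> has_int mu3 setT f (\int[mu3]_x f x).
Proof. by []. Qed.

(** As m0 is a unit vector, m0 . D_i m0 = 0 and m0 . D_i D_i m0 = - |D_i
    m0|^2. Hence the terms with derivatives of theta vanish and those with
    second derivatives of m0 produce the initial exchange energy. *)
Lemma initial_testP : has_int mu3 setT (fun x => - 2 * (theta (0, x) * initial_density m0 E0 H0 x)) initial_test.
Proof.
have cg i k : continuous (g0 i k).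
  by apply: smooth_continuous; apply: smooth_derive; apply: smooth_coord (data_m_smooth ad); exact: openT.
have cgg i k : continuous ('D_(ex i) (g0 i k)).
  apply: smooth_continuous; do 2 apply: smooth_derive.
  by apply: smooth_coord (data_m_smooth ad); exact: openT.
have mT : measurable (setT : set (mspace R)) by exact: measurableT.
have c1 : continuous (cst (1 : R) : space3 R -> R) by move=> x; exact: cvg_cst.
have I1 := has_int_sum mT (fun k => has_intN mT (has_intT (initial_intg ct (@cH0 k) (@cH0 k)))).
have I2 := has_int_sum mT (fun k => has_intN mT (has_intT (initial_intg ct (@cE0 k) (@cE0 k)))).
have I3 := has_int_sum mT (fun i => has_int_sum mT (fun k => has_intD mT
  (has_intT (initial_intg (cutoff_derive (dirx i) ct) (@cm0 k) (@cg i k)))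
  (has_intT (initial_intg ct (@cm0 k) (@cgg i k))))).
have I4 := has_int_sum mT (fun k => has_intN mT (has_intT (initial_intg ct (@cm0 k) (@cm0 k)))).
have i5 : intg mu3 setT (fun x => theta (0, x) * 1).
  by apply: intg_eq (initial_intg ct c1 c1) => // x _; rewrite mul1r.
have I := has_intD mT (has_intD mT (has_intD mT (has_intZ 2 mT I1) (has_intZ 2 mT I2)) (has_intZ 2 mT I3))
  (has_intZ 2 mT (has_intD mT I4 (has_intT i5))).
apply: has_int_eq I _ erefl => // x _.
exact: (initial_sum (fun k => component0 H0 k x) (fun k => component0 E0 k x) (theta (0, x))
  (fun i => 'D_(dirx i) theta (0, x)) (initial_unit T0 ss x)
  (fun i => initial_orthogonal T0 ad ss i x) (fun i => initial_laplacian T0 ad ss i x)).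
Qed.

End TotalTest.

(** * Weighted energy bounds of both solutions *)

Section EnergyBounds.
Context {R : realType}.
Notation mu3 := (@leb3 R).
Notation mu4 := (@leb4 R).
Variables (m E H : spacetime R -> vec R) (Dm : 'I_3 -> spacetime R -> vec R)
  (mt : spacetime R -> vec R) (m' E' H' : spacetime R -> vec R)
  (m0 E0 H0 : space3 R -> vec R) (T T1 lam : R).
Hypotheses (T10 : 0 < T1) (T1T : T1 < T) (lam0 : 0 < lam).
Hypothesis ad : admissible_data m0 E0 H0.
Hypothesis ws : weak_solution_with m E H Dm mt m0 E0 H0.
Hypothesis ss : smooth_solution T m' E' H' m0 E0 H0.

Let T0 : 0 < T. Proof. exact: lt_trans T1T. Qed.
Let mS := @measurable_slab R T.
Let c0 := \int[mu3]_x initial_density m0 E0 H0 x.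

Let initial_density_sqnorm x : sqnorm (E0 x) + sqnorm (H0 x) +
  \sum_(i < 3) sqnorm ('D_(ex i) m0 x) = initial_density m0 E0 H0 x.
Proof.
rewrite /initial_density [sqnorm _ + _]addrC; congr (_ + _); apply: eq_bigr => i _.
apply: eq_bigr => k _; have d : derivable m0 x (ex i) by exact: smooth_derivable (data_m_smooth ad) I.
by rewrite /component0 -(derive_coord k d).
Qed.

Lemma initial_density_intg : intg mu3 setT (initial_density m0 E0 H0).
Proof.
have mT : measurable (setT : set (mspace R)) by exact: measurableT.
have sq (F : space3 R -> vec R) : L2_space F -> intg mu3 setT (fun x => sqnorm (F x)).
  move=> LF; have I k : intg mu3 setT (fun x => F x 0 k * F x 0 k).
    have h := Lfun2_integrable_sqr (LF k).
    by apply: eq_integrable h => // x _ /=; rewrite expr2.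
  apply: intg_eq (intgD mT (intgD mT (I i0) (I i1)) (I i2)) => // x _.
  by rewrite /sqnorm /dot sum3E.
have D i := sq _ (data_gradm_L2 ad i).
apply: intg_eq (intgD mT (intgD mT (sq _ (data_E_L2 ad)) (sq _ (data_H_L2 ad)))
  (intgD mT (intgD mT (D i0) (D i1)) (D i2))) => // x _.
by rewrite -initial_density_sqnorm sum3E.
Qed.

Lemma initial_energyE : initial_energy m0 E0 H0 = c0%:E.
Proof.
rewrite /c0 /Rintegral fineK; last exact: integrable_fin_num initial_density_intg.
by rewrite /initial_energy /energy; apply: eq_integral => x _; rewrite initial_density_sqnorm.
Qed.

Let c0_ge0 : 0 <= c0.
Proof.
rewrite -lee_fin -initial_energyE; apply: integral_ge0 => x _; rewrite lee_fin.
by rewrite !addr_ge0 ?sqnorm_ge0// sumr_ge0// => i _; exact: sqnorm_ge0.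
Qed.

Definition weak_density p : R := sqnorm (E p) + sqnorm (H p) + \sum_(i < 3) sqnorm (Dm i p).
Definition strong_density p : R :=
  sqnorm (E' p) + sqnorm (H' p) + \sum_(i < 3) sqnorm ('D_(dirx i) m' p).

Let density_ge0 (a b : R) (c : 'I_3 -> R) : 0 <= a -> 0 <= b -> (forall i, 0 <= c i) ->
  0 <= a + b + \sum_(i < 3) c i.
Proof. by move=> a0 b0 c_ge0; rewrite !addr_ge0// sumr_ge0. Qed.

Let weighted (e d : spacetime R -> R) :
  measurable_fun (slab T : set (mspacetime R)) e -> measurable_fun (slab T : set (mspacetime R)) d ->
  (forall p, 0 <= e p) -> (forall p, 0 <= d p) ->
  {ae (@lebesgue_measure R), forall t : R, 0 < t < T ->
    (\int[mu3]_x (e (t, x))%:E + \int[mu4]_(p in slab t) (d p)%:E <= c0%:E)%E} ->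
  exists2 a, has_int mu4 (slab T)
      (fun p => - eta' T1 lam p.1 * e p + eta T1 lam p.1 * d p) a &
    a <= eta T1 lam 0 * c0.
Proof.
move=> me md e0 d0 h.
have meta (f : R -> R) : continuous f ->
    measurable_fun (slab T : set (mspacetime R)) (fun p : spacetime R => f p.1).
  move=> cf; apply: measurable_funTS.
  exact: (measurableT_comp (continuous_measurable_fun cf) measurable_fst).
have ceta : continuous (eta T1 lam) by exact: smooth_continuous (smooth_eta T1 lam).
have ceta' : continuous (eta' T1 lam) by exact: continuous_eta'.
apply: has_int_of_bound => //.
- by apply: measurable_funM => //; apply: measurableT_comp => //; exact: (meta (eta' T1 lam)).
- by apply: measurable_funM => //; exact: (meta (eta T1 lam)).
- by move=> p _; rewrite mulr_ge0// oppr_ge0; exact: eta'_le0.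
- by move=> p _; rewrite mulr_ge0//; exact: eta_ge0.
apply: weighted_energy => //.
- exact: is_derive_eta.
- exact: eta_ge0.
- by move=> t; exact: eta'_le0.
- by move=> t Tt; apply: eta_T => //; apply: le_trans (ltW T1T) Tt.
- by move=> t Tt; apply: eta'_T => //; apply: le_trans (ltW T1T) Tt.
Qed.

Lemma weak_weighted_energy : exists2 a, has_int mu4 (slab T)
    (fun p => - eta' T1 lam p.1 * weak_density p + eta T1 lam p.1 * sqnorm (mt p)) a &
  a <= eta T1 lam 0 * c0.
Proof.
have mL F : LinftyL2 T F -> measurable_fun (slab T : set (mspacetime R)) (fun p => sqnorm (F p)).
  by move=> FL; apply: measurable_sqnorm => k; have [] := @LinftyL2_intg R T F k T0 FL.
apply: weighted => //.
- apply: measurable_funD; first apply: measurable_funD.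
  + exact: mL (weak_E_LinftyL2 ws T0).
  + exact: mL (weak_H_LinftyL2 ws T0).
  + by apply: measurable_sum => i; apply: mL; exact: (weak_gradm_LinftyL2 ws T0).
- by apply: measurable_sqnorm => k; have [] := L2_slab_intg k (weak_dtm_L2 ws T0).
- by move=> p; apply: density_ge0 => *; exact: sqnorm_ge0.
- by move=> p; exact: sqnorm_ge0.
apply: (@filterS _ _ (ae_filter_ringOfSetsType (@lebesgue_measure R)) _ _ _ (weak_energy ws)).
by move=> t h /andP[t0 _]; rewrite -initial_energyE; exact: h.
Qed.

Lemma strong_weighted_energy : exists2 a, has_int mu4 (slab T)
    (fun p => - eta' T1 lam p.1 * strong_density p + eta T1 lam p.1 * sqnorm ('D_dirt m' p)) a &
  a <= eta T1 lam 0 * c0.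
Proof.
have mF (F : spacetime R -> vec R) : smooth (slab T) F ->
    measurable_fun (slab T : set (mspacetime R)) (fun p => sqnorm (F p)).
  move=> sF; apply: measurable_sqnorm => k; apply: continuous_measurable4; first exact: open_slab.
  move=> p Tp; apply: differentiable_continuous.
  exact: (smooth_coord k (@open_slab R T) sF) [::] p Tp.
apply: weighted => //.
- apply: measurable_funD; first apply: measurable_funD.
  + exact: mF (strong_E_smooth ss).
  + exact: mF (strong_H_smooth ss).
  + by apply: measurable_sum => i; apply: mF; apply: smooth_derive; exact: (strong_m_smooth ss).
- by apply: mF; apply: smooth_derive; exact: (strong_m_smooth ss).
- by move=> p; apply: density_ge0 => *; exact: sqnorm_ge0.
- by move=> p; exact: sqnorm_ge0.
apply: aeW => t tT; rewrite -initial_energyE -(strong_energy ss tT); exact: lexx.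
Qed.

End EnergyBounds.

(** * The energy of the difference vanishes *)

Section Uniqueness.
Context {R : realType}.
Notation mu3 := (@leb3 R).
Notation mu4 := (@leb4 R).
Variables (m E H : spacetime R -> vec R) (Dm : 'I_3 -> spacetime R -> vec R)
  (mt : spacetime R -> vec R) (m' E' H' : spacetime R -> vec R)
  (m0 E0 H0 : space3 R -> vec R) (T T1 P : R).
Hypotheses (T10 : 0 < T1) (T1T : T1 < T).
Hypothesis ad : admissible_data m0 E0 H0.
Hypothesis ws : weak_solution_with m E H Dm mt m0 E0 H0.
Hypothesis ss : smooth_solution T m' E' H' m0 E0 H0.
Hypothesis pP : forall p, slab T p ->
  d3 ((mfield m' H')^~ p) ((mfield m' H')^~ p) <= P.
Hypothesis pxP : forall i p, slab T p ->
  d3 (fun k => 'D_(dirx i) (mfield m' H' k) p) (fun k => 'D_(dirx i) (mfield m' H' k) p) <= P.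
Hypothesis uxP : forall i p, slab T p -> d3 (fun k => mdx m' i k p) (fun k => mdx m' i k p) <= P.

Let T0 : 0 < T. Proof. exact: lt_trans T1T. Qed.
Let mS := @measurable_slab R T.

(** The squared distance of the magnetizations is added to the energy of the
    difference, which by itself does not see constants. *)
Definition gap p : R := d3 (fun k => E p 0 k - component E' k p) (fun k => E p 0 k - component E' k p)
  + d3 (fun k => H p 0 k - component H' k p) (fun k => H p 0 k - component H' k p)
  + \sum_(i < 3) d3 (fun k => Dm i p 0 k - mdx m' i k p) (fun k => Dm i p 0 k - mdx m' i k p)
  + d3 (fun k => m p 0 k - component m' k p) (fun k => m p 0 k - component m' k p).

Section FixedWeight.
Variables (K lam : R).
Hypotheses (K0 : 0 < K)
  (KP : forall n i p, `|'D_(dirx i) (@xi R n) p| <= K / n.+1%:R).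
Hypotheses (lam0 : 0 < lam) (lamP : 11 * P + 10 + (12 * P + 24) * K <= lam).

Let th n := theta T1 lam n.
Let test n := relative_test m E H m' E' H' Dm mt (th n).

Let strong_densityE p : slab T p -> strong_density m' E' H' p =
  d3 ((component E')^~ p) ((component E')^~ p) + d3 ((component H')^~ p) ((component H')^~ p)
  + \sum_(i < 3) d3 (fun k => mdx m' i k p) (fun k => mdx m' i k p).
Proof.
move=> Tp; congr (_ + _); apply: eq_bigr => i _; apply: eq_bigr => k _.
by rewrite (derivative_coord (dirx i) k (strong_m_smooth ss) Tp).
Qed.

Let strong_dtE p : slab T p -> sqnorm ('D_dirt m' p) = d3 ((mdt m')^~ p) ((mdt m')^~ p).
Proof.
move=> Tp; apply: eq_bigr => k _.
by rewrite (derivative_coord dirt k (strong_m_smooth ss) Tp).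
Qed.

Let gap_le n p : slab T p -> sqnorm (m p) = 1 ->
  th n p * gap p <= (1 + 8 * (K / n.+1%:R)) *
    ((- eta' T1 lam p.1 * weak_density E H Dm p + eta T1 lam p.1 * sqnorm (mt p))
   + (- eta' T1 lam p.1 * strong_density m' E' H' p + eta T1 lam p.1 * sqnorm ('D_dirt m' p)))
  + test n p.
Proof.
move=> Tp mp; have t0 : 0 < p.1 by move: Tp; rewrite slabE => /andP[].
rewrite (strong_densityE Tp) (strong_dtE Tp) /th thetaE.
apply: (@relative_energy_le R (m p 0) ((component m')^~ p) ((mfield m' H')^~ p)
  ((component E')^~ p) ((component H')^~ p) (E p 0) (H p 0) (mt p 0) ((mdt m')^~ p)
  (fun k => 'D_dirt (component E' k) p) (fun k => 'D_dirt (component H' k) p)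
  (fun i => Dm i p 0) (fun i k => mdx m' i k p) (fun i k => 'D_(dirx i) (mfield m' H' k) p)
  (fun i k => mdxx m' i k p) (fun i k => 'D_dirt (mdx m' i k) p)
  (fun i k => 'D_(dirx i) (component E' k) p) (fun i k => 'D_(dirx i) (component H' k) p)
  (th n p) ('D_dirt (th n) p) (fun i => 'D_(dirx i) (th n) p) mp (strong_unit ss Tp) _ _ _ _ _
  P K (K / n.+1%:R) lam (eta T1 lam p.1) (- eta' T1 lam p.1) (xi n p)
  (fun i => 'D_(dirx i) (xi n) p)).
- by move=> k; rewrite (strong_field ss k Tp).
- move=> k; rewrite sum3E.
  have alg (h a b c t : R) : h = (t - (t - 2 * (a + b + c + h))) / 2 - (a + b + c) by field.
  exact: alg.
- move=> k; have alg (a b c : R) : a + b = - c -> a = - c - b by move=> <-; ring.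
  exact/alg/(strong_faraday3 ss k Tp).
- by move=> k; apply/subr0_eq; exact: (strong_ampere3 ss k Tp).
- by move=> i k; exact: (strong_field_derive ss i k Tp).
- exact: xi_itv.
- exact: eta_ge0.
- exact: eta_decay.
- by rewrite divr_gt0.
- by rewrite ler_pdivrMr// ler_peMr// ?(ltW K0)// ler1n.
- by move=> i; exact: KP.
- exact: pP.
- by move=> i; exact: pxP.
- by move=> i; exact: uxP.
- exact: lamP.
- exact: thetaE.
- by rewrite /th theta_dirt// opprK.
- by move=> i; rewrite /th theta_dirx.
Qed.

Let c0 := \int[mu3]_x initial_density m0 E0 H0 x.
Let s n := initial_test m0 E0 H0 (th n).

Let testP n : has_int mu4 (slab T) (test n) (s n) /\
  has_int mu3 setT (fun x => - 2 * (th n (0, x) * initial_density m0 E0 H0 x)) (s n).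
Proof.
have Tr : T <= n.+1%:R + T by rewrite lerDr.
have ct : cutoff T1 (n.+1%:R + T) (th n).
  by apply: theta_cutoff => //; rewrite lerDl ltW.
split; first exact: (relative_testP T10 T1T Tr ct ad ws ss).
exact: (initial_testP T10 T1T ct ad ss).
Qed.

Let th_bound n p : 0 <= th n p <= eta T1 lam p.1.
Proof.
have /andP[x0 x1] := xi_itv n p; have e0 := eta_ge0 T1 lam p.1.
by rewrite /th thetaE mulr_ge0 ?sqr_ge0//= ler_piMr// expr_le1.
Qed.

Let th_cvg p : th n p @[n --> \oo] --> eta T1 lam p.1.
Proof.
rewrite (_ : (fun n => th n p) = (fun n => eta T1 lam p.1 * (xi n p * xi n p))); last first.
  by apply/funext => n; rewrite /th thetaE expr2.
rewrite -[X in _ --> X]mulr1; apply: cvgM; first exact: cvg_cst.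
by rewrite -[X in _ --> X]mulr1; apply: cvgM; exact: xi_cvg.
Qed.

Let initial_cvg : s n @[n --> \oo] --> - 2 * (eta T1 lam 0 * c0).
Proof.
have i0 := initial_density_intg ad.
have mT : measurable (setT : set (mspace R)) by exact: measurableT.
have d0 x : 0 <= initial_density m0 E0 H0 x.
  by rewrite /initial_density !addr_ge0 ?d3_ge0// sumr_ge0// => i _; exact: d3_ge0.
have e0 := eta_ge0 T1 lam 0.
have [|||| i1 C] := @cvg_Rintegral _ _ _ mu3 setT
   (fun n x => - 2 * (th n (0, x) * initial_density m0 E0 H0 x))
   (fun x => - 2 * (eta T1 lam 0 * initial_density m0 E0 H0 x))
   (fun x => 2 * (eta T1 lam 0 * initial_density m0 E0 H0 x)) mT.
- by move=> n; apply: intg_measurable; exact: (testP n).2.1.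
- move=> x _; have c : th n (0, x) @[n --> \oo] --> eta T1 lam 0 := @th_cvg (0, x).
  apply: cvgM; first exact: cvg_cst.
  by apply: cvgM; [exact: c|exact: cvg_cst].
- by do 2 apply: intgZ => //.
- move=> n x _; have /andP[t0 t1] := th_bound n (0, x).
  have b0 : 0 <= th n (0, x) * initial_density m0 E0 H0 x by exact: mulr_ge0.
  rewrite mulNr normrN ger0_norm; last exact: mulr_ge0.
  by apply: ler_wpM2l => //; apply: ler_wpM2r.
have sE : s = fun n => \int[mu3]_x (- 2 * (th n (0, x) * initial_density m0 E0 H0 x)).
  by apply/funext => n; rewrite (testP n).2.2.
rewrite sE; suff -> : - 2 * (eta T1 lam 0 * c0) =
    \int[mu3]_x (- 2 * (eta T1 lam 0 * initial_density m0 E0 H0 x)) by [].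
by rewrite (has_intZ (- 2) mT (has_intZ (eta T1 lam 0) mT (conj i0 erefl))).2.
Qed.

Let measurable_gap : measurable_fun (slab T : set (mspacetime R)) gap.
Proof.
have ms (F : spacetime R -> vec R) (f : 'I_3 -> spacetime R -> R) :
    (forall k, measurable_fun (slab T : set (mspacetime R)) (fun p => F p 0 k)) ->
    (forall k, tame T (f k)) ->
    measurable_fun (slab T : set (mspacetime R)) (fun p => d3 (fun k => F p 0 k - f k p) (fun k => F p 0 k - f k p)).
  move=> mF tf; apply: measurable_sum => k.
  have mk : measurable_fun (slab T : set (mspacetime R)) (fun p => F p 0 k - f k p).
    apply: measurable_funB => //; apply: continuous_measurable4; first exact: open_slab.
    by move=> p Tp; exact: (tame_continuous (tf k) Tp).
  exact: measurable_funM.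
have mL F k : LinftyL2 T F -> measurable_fun (slab T : set (mspacetime R)) (fun p => F p 0 k).
  by move=> FL; have [] := @LinftyL2_intg R T F k T0 FL.
apply: measurable_funD; first apply: measurable_funD; first apply: measurable_funD.
- apply: ms => k; first exact: mL (weak_E_LinftyL2 ws T0).
  by have [] := strong_tame ss k.
- apply: ms => k; first exact: mL (weak_H_LinftyL2 ws T0).
  by have [] := strong_tame ss k.
- apply: measurable_sum => i; apply: ms => k; first exact: mL (weak_gradm_LinftyL2 ws T0 i).
  exact: (tame_mdx ss).
- apply: ms => k; first exact: (weak_m_measurable ws k T0).
  by have [] := strong_tame ss k.
Qed.

Let gap_ge0 p : 0 <= gap p.
Proof. by rewrite /gap !addr_ge0 ?d3_ge0// sumr_ge0// => i _; exact: d3_ge0. Qed.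

Let gap_integral n : (\int[mu4]_(p in slab T) (th n p * gap p)%:E <=
  ((1 + 8 * (K / n.+1%:R)) * (2 * (eta T1 lam 0 * c0)) + s n)%:E)%E.
Proof.
have [a2 A2 a2c] := weak_weighted_energy T10 T1T lam0 ad ws.
have [a1 A1 a1c] := strong_weighted_energy T10 T1T lam0 ad ss.
have k0 : 0 <= 1 + 8 * (K / n.+1%:R) by rewrite addr_ge0// mulr_ge0// divr_ge0 ?(ltW K0).
have I := has_intD mS (has_intZ (1 + 8 * (K / n.+1%:R)) mS (has_intD mS A2 A1)) (testP n).1.
have tg0 p : 0 <= th n p * gap p by rewrite mulr_ge0//; have /andP[] := th_bound n p.
have le : {ae mu4, forall p, slab T p -> th n p * gap p <= (1 + 8 * (K / n.+1%:R)) *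
    ((- eta' T1 lam p.1 * weak_density E H Dm p + eta T1 lam p.1 * sqnorm (mt p))
   + (- eta' T1 lam p.1 * strong_density m' E' H' p + eta T1 lam p.1 * sqnorm ('D_dirt m' p)))
  + test n p}.
  apply: (@filterS _ _ (ae_filter_ringOfSetsType mu4) _ _ _ (weak_m_unit ws)) => p mp Tp.
  by apply: gap_le => //; exact/mp/slab_half/Tp.
have mth : measurable_fun (slab T : set (mspacetime R)) (th n).
  by apply: smooth_measurable => //; exact: smooth_theta.
have ig : intg mu4 (slab T) (fun p => th n p * gap p).
  apply: (intg_le_ae mS _ I.1).
    exact: measurable_funM.
  apply: (@filterS _ _ (ae_filter_ringOfSetsType mu4) _ _ _ le) => p h Tp.
  by rewrite ger0_norm//; exact: h.
have h := has_int_le mS (conj ig erefl) I le.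
rewrite /Rintegral in h; rewrite -[leLHS]fineK; last exact: integrable_fin_num ig.
rewrite lee_fin; apply: le_trans h _; rewrite lerD2r ler_wpM2l//.
by rewrite mulr_natl mulr2n lerD.
Qed.

(** The integral of theta_n * gap is at most (1 + O(1/n)) 2 eta(0) c0 - 2
    eta(0) c_n, where c0 is the initial energy and c_n the initial energy
    weighted by xi_n^2; this tends to 0. *)
Lemma weighted_gap_zero : {ae mu4, forall p, slab T p -> eta T1 lam p.1 * gap p = 0}.
Proof.
apply: (@ae_zero_of_limit _ _ _ mu4 (slab T) (fun n p => th n p * gap p)
  (fun p => eta T1 lam p.1 * gap p) (fun n =>
  (1 + 8 * (K / n.+1%:R)) * (2 * (eta T1 lam 0 * c0)) + s n) mS) => //.
- move=> n; apply: measurable_funM => //.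
  by apply: smooth_measurable => //; exact: smooth_theta.
- by move=> n p _; rewrite mulr_ge0//; have /andP[] := th_bound n p.
- by move=> p _; apply: cvgM; [exact: th_cvg|exact: cvg_cst].
- rewrite [X in _ --> X](_ : _ = (1 + 8 * (K * 0)) * (2 * (eta T1 lam 0 * c0)) + - 2 * (eta T1 lam 0 * c0)); last by ring.
  apply: cvgD; last exact: initial_cvg.
  apply: cvgM; last exact: cvg_cst.
  apply: cvgD; first exact: cvg_cst.
  apply: cvgM; first exact: cvg_cst.
  apply: cvgM; first exact: cvg_cst.
  exact: cvg_harmonic.
Qed.

End FixedWeight.
End Uniqueness.

(** * Weak-strong uniqueness *)

Section Conclusion.
Context {R : realType}.
Notation mu4 := (@leb4 R).

Lemma d3_sub_eq0 (a b : 'I_3 -> R) :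
  d3 (fun k => a k - b k) (fun k => a k - b k) = 0 -> forall k, a k = b k.
Proof.
move=> h k; apply/eqP; rewrite -subr_eq0 -sqrf_eq0 expr2; apply/eqP.
by apply: (psumr_eq0P _ h) => // i _; rewrite -expr2 sqr_ge0.
Qed.

Lemma smooth_solution_restrict T T' (m E H : spacetime R -> vec R) m0 E0 H0 : T' <= T ->
  smooth_solution T m E H m0 E0 H0 -> smooth_solution T' m E H m0 E0 H0.
Proof.
move=> TT ss; have sub := sub_slab TT.
have sm F : smooth (slab T) F -> smooth (slab T') (F : spacetime R -> vec R).
  by move=> sF vs p /sub; exact: sF.
split.
- exact/sm/(strong_m_smooth ss).
- exact/sm/(strong_E_smooth ss).
- exact/sm/(strong_H_smooth ss).
- move=> s /andP[s0 sT]; apply: (strong_bounded ss).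
  by rewrite s0 (lt_le_trans sT).
- by move=> p /sub; exact: (strong_m_unit ss).
- by move=> p /sub; exact: (strong_landau_lifshitz ss).
- by move=> p /sub; exact: (strong_faraday ss).
- by move=> p /sub; exact: (strong_ampere ss).
- by move=> p /sub; exact: (strong_divE ss).
- by move=> p /sub; exact: (strong_divHm ss).
- exact: (strong_m_initial ss).
- exact: (strong_E_initial ss).
- exact: (strong_H_initial ss).
- move=> t /andP[t0 tT]; apply: (strong_energy ss).
  by rewrite t0 (lt_le_trans tT).
Qed.

Lemma tame_d3_bounded T T' (f : 'I_3 -> spacetime R -> R) : (forall k, tame T (f k)) -> T' < T ->
  exists C : R, 0 <= C /\ forall p, slab T' p -> d3 (fun k => f k p) (fun k => f k p) <= C.
Proof.
move=> tf TT; have h k : exists C : R, forall p, slab T' p -> f k p * f k p <= C.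
  have [C C0 hC] := tame_bounded (tf k) TT; exists (C ^+ 2) => p Tp.
  by have := hC p Tp; rewrite ler_norml expr2 => /andP[*]; nra.
have [C0 h0] := h i0; have [C1 h1] := h i1; have [C2 h2] := h i2.
exists (`|C0| + `|C1| + `|C2|); split; first by rewrite !addr_ge0.
move=> p Tp; rewrite d3E; apply: lerD; first apply: lerD.
- exact: le_trans (h0 p Tp) (ler_norm _).
- exact: le_trans (h1 p Tp) (ler_norm _).
- exact: le_trans (h2 p Tp) (ler_norm _).
Qed.

Section Before.
Variables (m E H m' E' H' : spacetime R -> vec R) (m0 E0 H0 : space3 R -> vec R) (T T1 : R).
Hypotheses (T10 : 0 < T1) (T1T : T1 < T).
Hypothesis ad : admissible_data m0 E0 H0.
Hypothesis ws : weak_solution m E H m0 E0 H0.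
Hypothesis ss : smooth_solution T m' E' H' m0 E0 H0.

(** Between T1 and T there is room for a slab on which all derivatives of the
    strong solution are bounded; these bounds fix the rate lam of the weight. *)
Lemma weak_strong_uniqueness_before : {ae mu4, forall p : spacetime R, slab T1 p ->
  [/\ m p = m' p, E p = E' p & H p = H' p]}.
Proof.
have [Dm [mt wsD]] := ws.
pose T2 := (T1 + T) / 2.
have T12 : T1 < T2 by have := T1T; rewrite /T2; lra.
have T2T : T2 < T by have := T1T; rewrite /T2; lra.
have ss2 := smooth_solution_restrict (ltW T2T) ss.
have [Cp [Cp0 hp]] := tame_d3_bounded (tame_mfield ss) T2T.
have hpx i := tame_d3_bounded (fun k => tame_derive (dirx i) (tame_mfield ss k)) T2T.
have hux i := tame_d3_bounded (fun k => tame_mdx ss i k) T2T.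
have [Cx hCx] := choice hpx; have [Cu hCu] := choice hux.
pose P := Cp + \sum_(i < 3) Cx i + \sum_(i < 3) Cu i.
have Cx0 i : 0 <= Cx i by have [] := hCx i.
have Cu0 i : 0 <= Cu i by have [] := hCu i.
have le1 (C : 'I_3 -> R) i : (forall i, 0 <= C i) -> C i <= \sum_(i < 3) C i.
  by move=> C0; rewrite (bigD1 i)//= lerDl sumr_ge0.
have sx : 0 <= \sum_(i < 3) Cx i by exact: sumr_ge0.
have su : 0 <= \sum_(i < 3) Cu i by exact: sumr_ge0.
have pP p : slab T2 p -> d3 ((mfield m' H')^~ p) ((mfield m' H')^~ p) <= P.
  by move=> Tp; apply: le_trans (hp p Tp) _; rewrite /P -addrA lerDl addr_ge0.
have pxP i p : slab T2 p ->
    d3 (fun k => 'D_(dirx i) (mfield m' H' k) p) (fun k => 'D_(dirx i) (mfield m' H' k) p) <= P.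
  move=> Tp; apply: le_trans ((hCx i).2 p Tp) _; apply: le_trans (le1 Cx i Cx0) _.
  by rewrite /P addrAC lerDr addr_ge0.
have uxP i p : slab T2 p -> d3 (fun k => mdx m' i k p) (fun k => mdx m' i k p) <= P.
  move=> Tp; apply: le_trans ((hCu i).2 p Tp) _; apply: le_trans (le1 Cu i Cu0) _.
  by rewrite /P lerDr addr_ge0.
have [K K0 hK] := @xi_dirx_bound R.
have K1 : 0 < K + 1 by rewrite ltr_wpDl.
have KP n i p : `|'D_(dirx i) (@xi R n) p| <= (K + 1) / n.+1%:R.
  by apply: le_trans (hK n i p) _; rewrite ler_pM2r ?invr_gt0// lerDl.
pose lam := `|11 * P + 10 + (12 * P + 24) * (K + 1)| + 1.
have lam0 : 0 < lam by rewrite ltr_wpDl.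
have lamP : 11 * P + 10 + (12 * P + 24) * (K + 1) <= lam.
  by apply: le_trans (ler_norm _) _; rewrite lerDl.
have Z := weighted_gap_zero T10 T12 ad wsD ss2 pP pxP uxP K1 KP lam0 lamP.
apply: (@filterS _ _ (ae_filter_ringOfSetsType mu4) _ _ _ Z) => p h Tp.
have /eqP := h (sub_slab (ltW T12) Tp).
have p1 : p.1 < T1 by move: Tp; rewrite slabE => /andP[].
rewrite mulf_eq0 gt_eqF ?eta_gt0//= => /eqP gap0.
have s0 : 0 <= \sum_(i < 3) d3 (fun k => Dm i p 0 k - mdx m' i k p) (fun k => Dm i p 0 k - mdx m' i k p).
  by apply: sumr_ge0 => i _; exact: d3_ge0.
have := d3_ge0 (fun k => E p 0 k - component E' k p).
have := d3_ge0 (fun k => H p 0 k - component H' k p).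
have := d3_ge0 (fun k => m p 0 k - component m' k p).
move: gap0 s0; rewrite /gap.
set a := d3 _ _; set b := d3 _ _; set c := \sum_(_ < _) _; set d := d3 _ _ => e c0 d0 b0 a0.
have sum0 (x y z t : R) : x + y + z + t = 0 -> 0 <= x -> 0 <= y -> 0 <= z -> 0 <= t ->
    [/\ x = 0, y = 0 & t = 0] by move=> *; split; lra.
have [ea eb ed] := sum0 _ _ _ _ e a0 b0 c0 d0.
split; apply/rowP => k.
- exact: (d3_sub_eq0 ed k).
- exact: (d3_sub_eq0 ea k).
- exact: (d3_sub_eq0 eb k).
Qed.

End Before.
End Conclusion.

Theorem theorem3 (R : realType) (T : R)
    (m0 E0 H0 : space3 R -> vec R)
    (m1 E1 H1 m2 E2 H2 : spacetime R -> vec R) :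
  (0 < T)%R ->
  admissible_data m0 E0 H0 ->
  weak_solution m2 E2 H2 m0 E0 H0 ->
  smooth_solution T m1 E1 H1 m0 E0 H0 ->
  {ae leb4, forall p : spacetime R, slab T p ->
    [/\ m2 p = m1 p, E2 p = E1 p & H2 p = H1 p]}.
Proof.
move=> T0 ad ws ss.
(* n.+2 keeps t 0 positive *)
pose t n : R := T - T / n.+2%:R.
have t0 n : 0 < t n by rewrite subr_gt0 ltr_pdivrMr// ltr_pMr// ltr1n.
have tT n : t n < T by rewrite ltrBlDr ltrDl divr_gt0.
have h n := weak_strong_uniqueness_before (t0 n) (tT n) ad ws ss.
have /(ae_foralln) := h.
apply: (@filterS _ _ (ae_filter_ringOfSetsType (@leb4 R))) => p hp Tp.
have [n pn] : exists n, p.1 < t n.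
  have p1T : p.1 < T by move: Tp; rewrite slabE => /andP[].
  have d0 : 0 < T - p.1 by rewrite subr_gt0.
  have [n _ hn] := near_infty_natSinv_lt (PosNum (divr_gt0 d0 T0)).
  exists n; have := hn n (leqnn n) => /= hn'.
  rewrite /t ltrBrDl -ltrBrDr.
  apply: (@lt_trans _ _ (T / n.+1%:R)).
    by rewrite ltr_pM2l// ltf_pV2 ?posrE// ltr_nat.
  by rewrite mulrC -ltr_pdivlMr.
apply: (hp n); move: Tp; rewrite !slabE => /andP[-> _]; exact: pn.
Qed.
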